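(* Let $f:\mathbb R^d\to\mathbb R$ satisfy assumptions (A1)–(A4) of the context with parameters $B,H>0$ and sparsity level $s\ge1$, and let the query noise have sub-Gaussian parameter $\sigma^2$. There exist absolute constants such that the following holds. Suppose $$T\ge C_0\big(s^3\log^2d+s(1+H)^2(1+B^4H^4\log^2d)\big)$$ for a sufficiently large absolute constant $C_0$, and $T\le d$. Run the mirror descent algorithm $\mathcal A$ of the context with $$n=\big\lfloor(1+H)\sqrt{sT}\big\rfloor,\qquad \eta=B\sqrt{\frac{n\log d}{T}},\qquad \delta=\sqrt{\frac{s\log d}{n}}.$$ Then with probability $1-\mathcal O(d^{-1})$ its cumulative regret satisfies $$R^{\mathsf C}_{\mathcal A}(T)\le C\,\xi_{\sigma,s}\,B\sqrt{\log d}\,\Big[\frac{(1+H)^2s}{T}\Big]^{1/4}+\widetilde{\mathcal O}(T^{-1/2}),\qquad \xi_{\sigma,s}=1+\sigma+\sigma^2/s,$$ where $C$ is an absolute constant and $\widetilde{\mathcal O}(T^{-1/2})$ denotes a quantity bounded by $P(\sigma,s,H,B,\log d)\,T^{-1/2}$ for some fixed polynomial $P$.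
   Context: Query model: $f:\mathbb R^d\to\mathbb R$ is unknown; at each adaptively chosen query point $x$ one observes $y=f(x)+\xi$, where the noise variables of different queries are independent, independent of the algorithm's internal randomness, have mean zero and are sub-Gaussian with parameter $\sigma^2$, i.e. $\mathbb E e^{a\xi}\le e^{\sigma^2a^2/2}$ for all $a\in\mathbb R$. Let $f^*=\inf_{x\in\mathbb R^d}f(x)$. Assumptions. (A1) $f$ is convex on $\mathcal X=\mathbb R^d$. (A2) There is a minimizer $x^*$, $f(x^* )=f^*$, with $\|x^*\|_1\le B$. (A3) $f$ is differentiable and $\|\nabla f(x)\|_0\le s$, $\|\nabla f(x)\|_1\le H$ for all $x$, where $\|\cdot\|_0$ is the number of nonzero entries (the support may vary with $x$). (A4) $f$ is twice differentiable and $\|\nabla^2f(x)\|_1\le H$ for all $x$, where $\|A\|_1=\sum_{i,j}|A_{ij}|$. Lasso gradient estimate $\textsc{GradientEstimate}(x,m,\delta,\lambda)$: sample independent vectors $z_1,\dots,z_m$ uniformly from $\{\pm1\}^d$; query at $x+\delta z_i$ to observe $y_i=f(x+\delta z_i)+\xi_i$, put $\widetilde y_i=y_i/\delta$, and return a solution $(\widehat g,\widehat\mu)$ of $\min_{g\in\mathbb R^d,\mu\in\mathbb R}\frac1m\sum_{i=1}^m(\widetilde y_i-g^\top z_i-\mu)^2+\lambda\|g\|_1+\lambda|\mu|$. Bregman divergence: for a continuously differentiable strictly convex $\psi$, $\Delta_\psi(x,y)=\psi(y)-\psi(x)-\langle\nabla\psi(x),y-x\rangle$. The potential used is $\psi(x)=\psi_a(x)=\frac1{2(a-1)}\|x\|_a^2$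 with $a=\frac{2\log d}{2\log d-1}$. Mirror descent algorithm with estimated gradients: set $x_0=0$, $T'=\lfloor T/(2n)\rfloor$, $\widetilde{\mathcal X}=\{x:\|x\|_1\le B\}$. For $t=0,\dots,T'-1$: (i) $(\widehat g_t,\widehat\mu_t)=\textsc{GradientEstimate}(x_t,m,\delta,\lambda)$ with $m=2n$ fresh samples and $\lambda=C_1\big(\delta^{-1}\sigma\sqrt{\log d/n}+\delta H\big)$ for a suitable absolute constant $C_1$; (ii) de-biasing: $\widetilde g_t=\widehat g_t+\frac1m Z_t^\top(\widetilde Y_t-Z_t\widehat g_t-\widehat\mu_t 1_m)$, where $Z_t\in\mathbb R^{m\times d}$ has rows $z_1^\top,\dots,z_m^\top$, $\widetilde Y_t=(\widetilde y_1,\dots,\widetilde y_m)$ and $1_m$ is the all-ones vector (samples of step (i)); (iii) $x_{t+1}\in\arg\min_{x\in\widetilde{\mathcal X}}\{\eta\,\widetilde g_t^\top(x-x_t)+\Delta_\psi(x_t,x)\}$. Cumulative regret $R^{\mathsf C}_{\mathcal A}(T)$: the average of $f$ over all the query points of the algorithm (the points $x_t+\delta z_i$, $0\le t<T'$, $1\le i\le 2n$), minus $f^*$. *)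

(* Defs.v *)
(* Vectors of R^d are row vectors. *)
From HB Require Import structures.
From mathcomp Require Import all_boot all_order all_algebra.
From mathcomp Require Import all_classical all_reals all_analysis.

Set Implicit Arguments.
Unset Strict Implicit.
Unset Printing Implicit Defensive.

Import Order.TTheory GRing.Theory Num.Theory.
Import numFieldNormedType.Exports.

Local Open Scope classical_set_scope.
Local Open Scope ring_scope.

Section Vectors.
Context {R : realType}.

Definition dotv d (u v : 'rV[R]_d) : R := \sum_j u 0 j * v 0 j.

Definition l0norm d (u : 'rV[R]_d) : nat := #|[pred j | u 0 j != 0]|.

Definition l1norm m n (A : 'M[R]_(m, n)) : R := \sum_i \sum_j `|A i j|.

Definition lpnorm d (p : R) (u : 'rV[R]_d) : R :=
  (\sum_j `|u 0 j| `^ p) `^ p^-1.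

Definition gradient d (f : 'rV[R]_d -> R) (x : 'rV[R]_d) : 'rV[R]_d :=
  \row_j 'D_(delta_mx 0 j) (f : 'rV[R]_d -> R^o) x.

Definition hessian d (f : 'rV[R]_d -> R) (x : 'rV[R]_d) : 'M[R]_d :=
  'J (gradient f) x.

End Vectors.

Section Objective.
Context {R : realType} (d : nat).
Implicit Types (f : 'rV[R]_d -> R) (B H : R) (s : nat).

Definition convex_objective f :=
  convex_function (E := 'rV[R]_d) [set: 'rV[R]_d] f.

(* Minimality is stated pointwise because [inf] of an unbounded set is 0. *)
Definition has_bounded_minimizer f B :=
  exists xs : 'rV[R]_d, (forall y, f xs <= f y) /\ l1norm xs <= B.

Definition sparse_gradient f s H :=
  forall x, [/\ differentiable (f : 'rV[R]_d -> R^o) x,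
                (l0norm (gradient f x) <= s)%N
              & l1norm (gradient f x) <= H].

Definition bounded_hessian f H :=
  forall x, [/\ differentiable (f : 'rV[R]_d -> R^o) x,
                differentiable (gradient f) x
              & l1norm (hessian f x) <= H].

End Objective.

Section MirrorMap.
Context {R : realType} (d : nat).

Definition psi (a : R) (x : 'rV[R]_d) : R :=
  (2 * (a - 1))^-1 * lpnorm a x ^+ 2.

Definition psi_exponent : R := 2 * ln d%:R / (2 * ln d%:R - 1).

Definition bregman (h : 'rV[R]_d -> R) (x y : 'rV[R]_d) : R :=
  h y - h x - dotv (gradient h x) (y - x).

End MirrorMap.

Section Lasso.
Context {R : realType} (m d : nat).
Implicit Types (Z : 'M[R]_(m, d)) (Y : 'rV[R]_m) (g : 'rV[R]_d) (mu : R).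

Definition lasso_objective Z Y (lambda : R) g mu : R :=
  m%:R^-1 * (\sum_(i < m) (Y 0 i - dotv g (row i Z) - mu) ^+ 2)
  + lambda * l1norm g + lambda * `|mu|.

Definition lasso_solution Z Y (lambda : R) g mu :=
  forall g' mu',
    lasso_objective Z Y lambda g mu <= lasso_objective Z Y lambda g' mu'.

(* Row-vector form of g + m^-1 Z^T (Y - Z g - mu 1). *)
Definition debiased Z Y g mu : 'rV[R]_d :=
  g + m%:R^-1 *: ((Y - g *m Z^T - const_mx mu) *m Z).

End Lasso.

(* A sign vector is encoded by Booleans, [true] standing for -1. *)
Definition signs (R : realType) d (b : {ffun 'I_d -> bool}) : 'rV[R]_d :=
  \row_j (-1) ^+ b j.

Section Independence.
Context {disp : measure_display} {Omega : measurableType disp} {R : realType}.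

Definition mutually_independent (P : probability Omega R) (I : finType)
    (G : I -> set (set Omega)) :=
  forall (J : {set I}) (E : I -> set Omega), (forall i, i \in J -> G i (E i)) ->
    P (\bigcap_(i in [set` J]) E i) = (\prod_(i in J) P (E i))%E.

Definition measurable_wrt (F : set (set Omega)) (X : Omega -> R) :=
  forall A : set R, measurable A -> F (X @^-1` A).

End Independence.

(* [r] rounds of [m] queries each; [z t i] and [xi t i] are the sign vector and
   the noise of query i of round t. The sigma-algebra [V] carries the internal
   randomness other than the sign vectors, such as coins used to choose among
   several Lasso solutions; it may be trivial. *)
Section Sampling.
Context {disp : measure_display} {Omega : measurableType disp} {R : realType}.
Context (P : probability Omega R) (d r m : nat).
Context (V : set (set Omega)).
Context (z : 'I_r -> 'I_m -> Omega -> {ffun 'I_d -> bool}).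
Context (xi : 'I_r -> 'I_m -> {RV P >-> R}).

Definition sign_events t i : set (set Omega) :=
  preimage_set_system setT (z t i) setT.

Definition noise_events t i : set (set Omega) :=
  preimage_set_system setT (xi t i) measurable.

Definition sources (k : option ('I_r * 'I_m + 'I_r * 'I_m)) :
    set (set Omega) :=
  match k with
  | None => V
  | Some (inl (t, i)) => sign_events t i
  | Some (inr (t, i)) => noise_events t i
  end.

Record sampling_model (sigma : R) : Prop := {
  coins_sigma_algebra : sigma_algebra setT V;
  coins_measurable : V `<=` measurable;
  signs_measurable : forall t i, sign_events t i `<=` measurable;
  signs_uniform : forall t i b, P (z t i @^-1` [set b]) = (2 ^- d)%:E;
  noise_centered : forall t i, ('E_P[xi t i] = 0)%E;
  noise_subgaussian : forall t i (a : R),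
    (mmt_gen_fun P (xi t i) a <= (expR (sigma ^+ 2 * a ^+ 2 / 2))%:E)%E;
  sources_independent : mutually_independent P sources
}.

(* Everything available to the algorithm before round t. *)
Definition history (t : nat) : set (set Omega) :=
  <<s V `|` \bigcup_(k in [set k : 'I_r | (k < t)%N])
              \bigcup_(i in [set: 'I_m]) (sign_events k i `|` noise_events k i) >>.

Definition design (t : 'I_r) (w : Omega) : 'M[R]_(m, d) :=
  \matrix_(i < m) signs R (z t i w).

Definition query_point (delta : R) (x : nat -> Omega -> 'rV[R]_d) (t : 'I_r)
    (i : 'I_m) (w : Omega) : 'rV[R]_d :=
  x t w + delta *: signs R (z t i w).

Definition responses (f : 'rV[R]_d -> R) (delta : R)
    (x : nat -> Omega -> 'rV[R]_d) (t : 'I_r) (w : Omega) : 'rV[R]_m :=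
  \row_i ((f (query_point delta x t i w) + xi t i w) / delta).

Definition mirror_step (h : 'rV[R]_d -> R) (B eta : R) (g x y : 'rV[R]_d) :=
  l1norm y <= B /\
  forall y', l1norm y' <= B ->
    eta * dotv g (y - x) + bregman h x y <=
    eta * dotv g (y' - x) + bregman h x y'.

(* The three [_adapted] fields say that the chosen minimizers depend only on
   the coins and on the samples drawn so far. *)
Record mirror_descent_run (f : 'rV[R]_d -> R) (B eta delta lambda : R)
    (x : nat -> Omega -> 'rV[R]_d) (ghat : 'I_r -> Omega -> 'rV[R]_d)
    (muhat : 'I_r -> Omega -> R) : Prop := {
  run_init : forall w, x 0%N w = 0;
  run_lasso : forall t w,
    lasso_solution (design t w) (responses f delta x t w) lambda
      (ghat t w) (muhat t w);
  run_step : forall (t : 'I_r) w,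
    mirror_step (psi (psi_exponent d)) B eta
      (debiased (design t w) (responses f delta x t w) (ghat t w) (muhat t w))
      (x t w) (x t.+1 w);
  ghat_adapted : forall (t : 'I_r) j,
    measurable_wrt (history t.+1) (fun w => ghat t w 0 j);
  muhat_adapted : forall t : 'I_r, measurable_wrt (history t.+1) (muhat t);
  iterate_adapted : forall (t : 'I_r) j,
    measurable_wrt (history t.+1) (fun w => x t.+1 w 0 j)
}.

Definition cumulative_regret (f : 'rV[R]_d -> R) (delta : R)
    (x : nat -> Omega -> 'rV[R]_d) (w : Omega) : R :=
  (r * m)%:R^-1 * (\sum_(t < r) \sum_(i < m) f (query_point delta x t i w))
  - inf (range f).

End Sampling.

(* Main.v *)
(* The mirror map psi is strongly convex for the l1 norm with a dimension-free
   constant, and its Bregman divergence from 0 is at most ln d times the squared l1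
   norm. With xs a minimizer, mirror descent with estimated gradients g_t satisfies
     eta sum_t <g_t, x_t - xs> <= B^2 ln d + O(eta^2) sum_t |g_t|_oo^2.
   By convexity and |hessian|_1 <= H, the response at x_t + delta z_i divided by delta
   is affine in z_i with slope grad f(x_t), up to the noise xi_i / delta and a bias
   between 0 and delta H. If the columns of the design augmented by the constant
   column are incoherent at level 4 sqrt(ln d / n), the Lasso is accurate in l1 norm,
   and de-biasing leaves g_t = grad f(x_t) + zeta_t + gamma_t, where
   zeta_t = Z^T xi / (m delta) is linear in the noise and
   |gamma_t|_oo <= 768 (sigma + H) delta.
   Given the past and all sign vectors, the noise of round t is still centered and
   sub-Gaussian, so sum_t <zeta_t, x_t - xs> is a sub-Gaussian martingale.
   Finally |grad f(x)|_oo^2 <= 4H (f(x) - f(xs)), so the gradient part of |g_t|_oo^2 is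
   absorbed by the regret once eta H is below a constant; the B^4 H^4 term in the lower
   bound on T ensures this. *)
Require Import Defs.
From HB Require Import structures.
From mathcomp Require Import all_boot all_order all_algebra.
From mathcomp Require Import all_classical all_reals all_analysis.
From mathcomp Require Import measurable_realfun ring lra.
From mathcomp Require mpoly.

Set Implicit Arguments.
Unset Strict Implicit.
Unset Printing Implicit Defensive.

Import Order.TTheory GRing.Theory Num.Theory.
Import numFieldNormedType.Exports.

Local Open Scope classical_set_scope.
Local Open Scope ring_scope.

(** * Power functions *)

(** Conditional expectations never appear: a fresh source is integrated out against its own law, by
    Fubini on the product law, while whatever the other sources determine is held fixed. Because an
    exponent below 2 leaves the mirror map without a second derivative at vanishing coordinates,
    strong convexity rests on a lower bound for the one-variable Bregman divergence of |.|^a, not on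
    a Hessian. In the lower bound on T, the summand s^3 ln^2 d makes s times the coherence level
    small, and s (1+H)^2 lets at least one round of 2n queries fit. The hypothesis T <= d acts
    twice: it yields ln d >= 2, and it bounds the number of rounds by d in the union bound. The
    intercept f(x)/delta is penalized like any other parameter, so the Lasso works at sparsity s + 1
    and the constant regressor must be incoherent with the sign columns. That incoherence also makes
    the average of the sign vectors small, which pushes the first-order cost of querying away from
    x_t down to order T^(-1/2). *)

Section Powers.
Context {R : realType}.
Implicit Types (a p q t u v c M : R).

Lemma ln_leB1 t : 0 < t -> ln t <= t - 1.
Proof. by move=> t0; have := expR_ge1Dx (ln t); rewrite lnK ?posrE//; lra. Qed.

Lemma powR_ge1Dln p t : 0 < t -> 1 + p * ln t <= t `^ p.
Proof. by move=> t0; rewrite /powR gt_eqF// expR_ge1Dx. Qed.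

(* Bernoulli's inequality, from Young's inequality for [t = t * 1]. *)
Lemma powR_ge_tangent q t : 1 <= q -> 0 <= t -> 1 + q * (t - 1) <= t `^ q.
Proof.
rewrite le_eqVlt => /predU1P[<- t0|q1 t0]; first by rewrite powRr1//; lra.
have q0 : 0 < q by lra.
have q'0 : 0 < q / (q - 1) by rewrite divr_gt0//; lra.
have := @conjugate_powR R t 1 q (q / (q - 1)) t0 ler01 q0 q'0.
rewrite powR1 mulr1 mul1r.
have qV : q^-1 + (q / (q - 1))^-1 = 1 by field; apply/andP; split; apply/eqP; lra.
move=> /(_ qV) H.
have : q * t <= q * (t `^ q / q + (q / (q - 1))^-1) by rewrite ler_pM2l.
have -> : q * (t `^ q / q + (q / (q - 1))^-1) = t `^ q + (q - 1).
  by field; apply/andP; split; apply/eqP; lra.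
by lra.
Qed.

(** Bernoulli's inequality at exponent 1/p, applied to t^p. *)
Lemma powR_le_tangent p t : 0 <= p <= 1 -> 0 <= t -> t `^ p <= 1 + p * (t - 1).
Proof.
move=> /andP[]; rewrite le_eqVlt => /predU1P[<- _ t0|p0 p1 t0].
  by rewrite powRr0; lra.
have := @powR_ge_tangent p^-1 (t `^ p).
rewrite -powRrM mulfV ?gt_eqF// powRr1// powR_ge0 => /(_ _ isT).
rewrite invf_ge1// => /(_ p1) H.
have : p * (1 + p^-1 * (t `^ p - 1)) <= p * t by rewrite ler_pM2l.
by rewrite mulrDr mulrA mulfV ?gt_eqF//; lra.
Qed.

(** Power mean inequality: the tangent is taken at the mean [M] of the entries, so that the linear
    parts cancel in the sum. *)
Lemma sum_powR_le d p (x : 'I_d -> R) : 0 <= p <= 1 -> (0 < d)%N ->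
  (forall j, 0 <= x j) ->
  \sum_j x j `^ p <= d%:R `^ (1 - p) * (\sum_j x j) `^ p.
Proof.
move=> p01 d0 x0; have dR : (0 : R) < d%:R by rewrite ltr0n.
have : 0 <= \sum_j x j by apply: sumr_ge0.
rewrite le_eqVlt => /predU1P[S0|Sgt0].
  have xj j : x j = 0.
    move/esym/eqP: S0; rewrite psumr_eq0// => /allP/(_ j).
    by rewrite mem_index_enum => /(_ isT)/eqP.
  (* At p = 0 every term is 0^0 = 1 and the sum is d. *)
  have [->|p0] := eqVneq p 0.
    rewrite subr0 powRr1 ?ler0n// powRr0 mulr1.
    rewrite (eq_bigr (fun=> 1)) => [|j _]; last by rewrite powRr0.
    by rewrite sumr_const card_ord.
  rewrite big1 => [|j _]; last by rewrite xj powR0.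
  by rewrite mulr_ge0 ?powR_ge0.
set S := \sum_j x j in Sgt0 *; set M := S / d%:R.
have M0 : 0 < M by rewrite divr_gt0.
have E j : x j `^ p <= M `^ p * (1 + p * (x j / M - 1)).
  rewrite -[in leLHS](divfK (lt0r_neq0 M0) (x j)) [_ / _ * _]mulrC.
  rewrite powRM ?(ltW M0)//; last by rewrite divr_ge0// ltW.
  by rewrite ler_wpM2l ?powR_ge0// powR_le_tangent// divr_ge0// ltW.
apply: (le_trans (ler_sum _ (fun j _ => E j))).
rewrite -mulr_sumr big_split/= sumr_const card_ord -mulr_sumr sumrB -mulr_suml.
rewrite sumr_const card_ord -/S /M invfM invrK mulrA mulfV ?gt_eqF// mul1r subrr mulr0 addr0.
rewrite powRB; last by rewrite (gt_eqF dR) implybT.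
rewrite powRr1 ?ler0n// powRM ?invr_ge0 ?ler0n ?(ltW Sgt0)//.
rewrite -[d%:R^-1]powR_inv1 ?ler0n// powRAC powR_inv1 ?powR_ge0//.
by rewrite le_eqVlt; apply/orP; left; apply/eqP; ring.
Qed.

(** Each x_j^a is x_j times x_j^(a-1), and x_j is at most the sum. *)
Lemma sum_powR_le_powR_sum d a (x : 'I_d -> R) : 1 <= a ->
  (forall j, 0 <= x j) -> \sum_j x j `^ a <= (\sum_j x j) `^ a.
Proof.
move=> a1 x0; have : 0 <= \sum_j x j by apply: sumr_ge0.
have a0 : 0 < a by lra.
set S := \sum_j x j; rewrite le_eqVlt => /predU1P[S0|Sgt0].
  rewrite big1 ?powR_ge0// => j _; rewrite (_ : x j = 0) ?powR0 ?gt_eqF//.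
  move/esym/eqP: S0; rewrite psumr_eq0// => /allP/(_ j).
  by rewrite mem_index_enum => /(_ isT)/eqP.
have -> : S `^ a = \sum_j x j * S `^ (a - 1).
  by rewrite -mulr_suml mulr_powRB1// ltW.
apply: ler_sum => j _; rewrite -mulr_powRB1// ler_wpM2l// ge0_ler_powR//.
- by lra.
- by rewrite nnegrE x0.
- by rewrite nnegrE ltW.
- by rewrite /S (bigD1 j)//= lerDl sumr_ge0.
Qed.

(** With t = r^2, the bound ln r >= 1 - 1/r leaves exactly (r - 1)^2. *)
Lemma entropy_ge t : 0 < t -> (Num.sqrt t - 1) ^+ 2 <= t * ln t - t + 1.
Proof.
move=> t0; set r := Num.sqrt t; have r0 : 0 < r by rewrite sqrtr_gt0.
have tE : t = r ^+ 2 by rewrite sqr_sqrtr ?ltW.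
have lnr : 1 - r^-1 <= ln r.
  have := @ln_leB1 r^-1; rewrite invr_gt0 lnV ?posrE// => /(_ r0); lra.
have : 2 * r ^+ 2 * (1 - r^-1) <= 2 * r ^+ 2 * ln r.
  by rewrite ler_wpM2l// mulr_ge0// sqr_ge0.
have -> : 2 * r ^+ 2 * (1 - r^-1) = 2 * r ^+ 2 - 2 * r by field; rewrite gt_eqF.
rewrite tE lnXn// -mulr_natl; nra.
Qed.

End Powers.

Section PowerBregman.
Context {R : realType}.
Implicit Types (a p u v t : R).

Let powR_sqr_sub2 a w : 0 < w -> w ^+ 2 * w `^ (a - 2) = w `^ a.
Proof.
move=> w0; rewrite -powR_mulrn ?ltW// -powRD ?(gt_eqF w0) ?implybT//.
by congr (_ `^ _); lra.
Qed.

(* For t > 0 the bound follows from t^(a-1) >= 1 + (a-1) ln t; the difference then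
   dominates (a-1) (t ln t - t + 1) >= (a-1) (sqrt t - 1)^2, and for t > 9 the
   estimate ln t >= 4/3 takes over. *)
Lemma powR_bregman1 a t : 1 < a <= 2 ->
  (a - 1) / 36 * (t - 1) ^+ 2 * Num.max 1 `|t| `^ (a - 2) <=
  `|t| `^ a - 1 - a * (t - 1).
Proof.
move=> /andP[a1 a2]; have a0 : 0 < a by lra.
set w := Num.max 1 `|t|.
have w1 : 1 <= w by rewrite le_max lexx.
have wt : `|t| <= w by rewrite le_max lexx orbT.
have w0 : 0 < w by lra.
have wa0 : 0 <= w `^ (a - 2) by exact: powR_ge0.
have wa1 : w `^ (a - 2) <= 1.
  by rewrite -[leRHS](powRr0 w) ler_powR//; lra.
have [t0|t0|->] := ltgtP t 0; last first.
- rewrite normr0 powR0 ?gt_eqF//; nra.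
- have tn : `|t| = t by rewrite gtr0_norm.
  set r := Num.sqrt t; have r0 : 0 < r by rewrite sqrtr_gt0.
  have tE : t = r ^+ 2 by rewrite sqr_sqrtr ?ltW.
  have ent : (r - 1) ^+ 2 <= t * ln t - t + 1 by exact: entropy_ge.
  have tp := powR_ge1Dln (a - 1) t0.
  have taE : t `^ a = t * t `^ (a - 1) by rewrite mulr_powRB1// ltW.
  have LB : (a - 1) * (r - 1) ^+ 2 <= t `^ a - 1 - a * (t - 1).
    have : t * (1 + (a - 1) * ln t) <= t * t `^ (a - 1) by rewrite ler_pM2l.
    rewrite -taE; nra.
  rewrite tn; have [t1|t1] := leP t 1.
    apply: le_trans LB; rewrite -mulrA -mulrA ler_pM2l; last by lra.
    have r1 : r <= 1 by rewrite -[leRHS]sqrtr1 ler_wsqrtr.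
    have -> : (t - 1) ^+ 2 = (r - 1) ^+ 2 * (r + 1) ^+ 2 by rewrite tE; ring.
    have r4 : (r + 1) ^+ 2 <= 4 by nra.
    have : (r + 1) ^+ 2 * w `^ (a - 2) <= 4 * 1 by rewrite ler_pM// sqr_ge0.
    by have := sqr_ge0 (r - 1); nra.
  have wE : w = t by rewrite /w tn max_r// ltW.
  rewrite wE in w0 wa0 wa1 *.
  have E : t ^+ 2 * t `^ (a - 2) = t `^ a by exact: powR_sqr_sub2.
  have E' : t * t `^ (a - 2) = t `^ (a - 1).
    by apply: (mulfI (lt0r_neq0 t0)); rewrite -taE -E; ring.
  (* The constant 36 originates here: (r + 1)^2 <= 4 t and t^(a-1) <= 9. *)
  have [t9|t9] := leP t 9.
    apply: le_trans LB; rewrite -mulrA -mulrA ler_pM2l; last by lra.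
    have q9 : t `^ (a - 1) <= 9.
      apply: le_trans t9; rewrite -[leRHS]powRr1 ?(ltW t0)// ler_powR//; lra.
    have -> : (t - 1) ^+ 2 = (r - 1) ^+ 2 * (r + 1) ^+ 2 by rewrite tE; ring.
    have r1 : 1 <= r by rewrite -[leLHS]sqrtr1 ler_wsqrtr// ltW.
    have r4 : (r + 1) ^+ 2 <= 4 * t.
      have : 0 <= (r - 1) * (3 * r + 1) by rewrite mulr_ge0//; lra.
      by rewrite tE; lra.
    have : (r + 1) ^+ 2 * t `^ (a - 2) <= 36.
      apply: (le_trans (ler_wpM2r wa0 r4)); rewrite -mulrA E'; lra.
    by have := sqr_ge0 (r - 1); nra.
  have lnt : 4 / 3 <= ln t.
    rewrite tE lnXn// -mulr_natl; have := @ln_leB1 _ r^-1; rewrite invr_gt0 lnV ?posrE// => /(_ r0).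
    have r3 : 3 <= r.
      have -> : 3 = Num.sqrt (3 ^+ 2) :> R by rewrite sqrtr_sqr ger0_norm.
      by rewrite ler_wsqrtr//; apply: le_trans (ltW t9); lra.
    have : r^-1 <= 3^-1 by rewrite lef_pV2 ?posrE//; lra.
    lra.
  set q := t `^ (a - 1) in taE tp E' *.
  have q1 : 1 + (a - 1) * (4 / 3) <= q.
    by apply: le_trans tp; rewrite lerD2l ler_wpM2l//; lra.
  have q2 : 1 + (a - 1) <= q * (1 - (a - 1) / 36) by nra.
  have S : (t - 1) ^+ 2 * t `^ (a - 2) <= t * q.
    rewrite -E' mulrA; apply: ler_wpM2r => //; nra.
  rewrite taE -mulrA.
  have : (a - 1) / 36 * ((t - 1) ^+ 2 * t `^ (a - 2)) <= (a - 1) / 36 * (t * q).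
    by rewrite ler_wpM2l//; lra.
  have : t * (1 + (a - 1)) <= t * (q * (1 - (a - 1) / 36)) by rewrite ler_pM2l.
  nra.
- have tn : `|t| = - t by rewrite ltr0_norm.
  have S : (t - 1) ^+ 2 * w `^ (a - 2) <= 4 * w `^ a.
    by rewrite -(powR_sqr_sub2 a w0) mulrA ler_wpM2r//; rewrite tn in wt; nra.
  rewrite -mulrA.
  have : (a - 1) / 36 * ((t - 1) ^+ 2 * w `^ (a - 2)) <= (a - 1) / 36 * (4 * w `^ a).
    by rewrite ler_wpM2l//; lra.
  have wa := powR_ge0 w a; have ta := powR_ge0 `|t| a.
  have [t1|t1] := leP `|t| 1.
    have -> : w = 1 by rewrite /w max_l.
    by rewrite powR1; nra.
  have -> : w = `|t| by rewrite /w max_r// ltW.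
  nra.
Qed.

(** Up to the factor a (a - 1), the weight is the least second derivative of |.|^a on the segment
    from u to v. Taylor's formula is blocked by the singularity at 0; homogeneity of degree a
    reduces to base point 1 with t = v/u. *)
Lemma powR_bregman a u v : 1 < a <= 2 ->
  (a - 1) / 36 * (v - u) ^+ 2 * Num.max `|u| `|v| `^ (a - 2) <=
  `|v| `^ a - `|u| `^ a - a * (Num.sg u * `|u| `^ (a - 1)) * (v - u).
Proof.
move=> a12; have /andP[a1 a2] := a12; have a0 : 0 < a by lra.
have [->|u0] := eqVneq u 0.
  rewrite normr0 max_r// sgr0 powR0 ?gt_eqF// !(mul0r, mulr0, subr0).
  have [->|v0] := eqVneq v 0; first by rewrite expr0n mulr0 mul0r powR_ge0.
  have nv : 0 < `|v| by rewrite normr_gt0.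
  rewrite -[v ^+ 2]real_normK ?num_real// -mulrA powR_sqr_sub2//.
  have := powR_ge0 `|v| a; nra.
pose t := v / u; have vE : v = u * t by rewrite /t mulrCA mulfV// mulr1.
have nu : 0 < `|u| by rewrite normr_gt0.
have ua : 0 <= `|u| `^ a by exact: powR_ge0.
have -> : `|v| `^ a = `|u| `^ a * `|t| `^ a by rewrite vE normrM powRM.
have -> : a * (Num.sg u * `|u| `^ (a - 1)) * (v - u) = `|u| `^ a * (a * (t - 1)).
  by rewrite -(mulr_powRB1 (ltW nu) a0) vE {2}normrEsg; ring.
have -> : Num.max `|u| `|v| = `|u| * Num.max 1 `|t|.
  by rewrite maxr_pMr// mulr1 vE normrM.
have -> : (v - u) ^+ 2 = `|u| ^+ 2 * (t - 1) ^+ 2.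
  by rewrite real_normK ?num_real// vE; ring.
rewrite powRM// ?le_max ?ler01//.
have := ler_wpM2l ua (powR_bregman1 t a12).
rewrite -[X in X * _ <= _ -> _](powR_sqr_sub2 a nu).
by lra.
Qed.

End PowerBregman.

(** * The mirror map and its strong convexity *)

(** Turns directional derivatives into one-variable ones, for which the chain rule and the mean
    value theorem are at hand. *)
Lemma is_derive_line {R : numFieldType} {V W : normedModType R} (f : V -> W)
    (x v : V) (t : R) (D : W) :
  is_derive t 1 (fun h => f (h *: v + x)) D <-> is_derive (t *: v + x) v f D.
Proof.
have E : (fun h : R => h^-1 *: (((fun h => f (h *: v + x)) \o shift t) (h *: 1)
             - f (t *: v + x))) =
         (fun h : R => h^-1 *: ((f \o shift (t *: v + x)) (h *: v) - f (t *: v + x))).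
  apply/funext => h /=; congr (_ *: (f _ - _)).
  by rewrite addrA -scalerDl [_%:A]mulr1.
by split=> -[dx <-]; split; rewrite /derivable /derive ?E//; move: dx; rewrite /derivable E.
Qed.

(** * Differentiability of the mirror map *)

Section MirrorMapGradient.
Context {R : realType}.
Implicit Types (a y : R).

Lemma is_derive_norm_powR a y : 1 < a ->
  is_derive y 1 (fun y : R => `|y| `^ a) (a * (Num.sg y * `|y| `^ (a - 1))).
Proof.
move=> a1; have a0 : a - 1 > 0 by lra.
have [y0|y0|->] := ltgtP y 0.
- apply: (@near_eq_is_derive _ _ _ (fun z : R => (- z) `^ a)).
    by near=> z; rewrite /= ltr0_norm//; near: z; exact: lt_nbhsl.
  have H1 : is_derive (- y) 1 (fun z : R => z `^ a) (a * (- y) `^ (a - 1)).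
    by apply: is_derive1_powR; rewrite oppr_gt0.
  have H2 : is_derive y 1 (-%R : R -> R) (- 1) by exact: is_deriveN.
  have := is_derive1_comp H1 H2.
  by rewrite ltr0_norm// ltr0_sg// mulN1r mulrN1 -mulrN.
- apply: (@near_eq_is_derive _ _ _ (fun z : R => z `^ a)).
    by near=> z; rewrite /= gtr0_norm//; near: z; exact: lt_nbhsr.
  by rewrite gtr0_norm// gtr0_sg// mul1r; exact: is_derive1_powR.
- rewrite sgr0 mul0r mulr0.
  pose q := fun h : R => h^-1 *: (((fun y : R => `|y| `^ a) \o shift 0) (h *: 1) - `|0 : R| `^ a).
  have C : q @ 0^' --> (0 : R).
    apply/cvgrPdist_lt => e e0.
    (* The difference quotient at 0 has modulus |h|^(a-1), below e once |h| is below e^(1/(a-1)). *)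
    have d0 : 0 < e `^ (a - 1)^-1 by rewrite powR_gt0.
    near=> h.
    have h0 : h != 0 by near: h; exact: nbhs_dnbhs_neq.
    rewrite sub0r normrN /q /= addr0 [_%:A]mulr1 normr0 powR0 ?subr0 ?gt_eqF//; last lra.
    rewrite [_ *: _]/(_ * _) normrM normfV (ger0_norm (powR_ge0 _ _)).
    rewrite -mulr_powRB1//; last lra.
    rewrite mulKf ?normr_eq0//.
    have -> : e = (e `^ (a - 1)^-1) `^ (a - 1).
      by rewrite -powRrM mulVf ?gt_eqF// powRr1// ltW.
    rewrite gt0_ltr_powR ?nnegrE ?powR_ge0//.
    by near: h; apply: dnbhs0_lt.
  by split; [apply/cvg_ex; exists 0 | exact: cvg_lim].
Unshelve. all: by end_near. Qed.

Definition powsum d a (x : 'rV[R]_d) : R := \sum_j `|x 0 j| `^ a.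

(** [powsum a x] is the a-th power of the a-norm, so the factor of exponent 2/a - 1 is that norm to
    the power 2 - a. *)
Definition mirror_grad d a (x : 'rV[R]_d) : 'rV[R]_d :=
  \row_j ((a - 1)^-1 * (powsum a x `^ (2 / a - 1)
                        * (Num.sg (x 0 j) * `|x 0 j| `^ (a - 1)))).

Lemma powsum_ge0 d a (x : 'rV[R]_d) : 0 <= powsum a x.
Proof. by apply: sumr_ge0 => j _; exact: powR_ge0. Qed.

Lemma powsum_gt0 d a (x : 'rV[R]_d) : x != 0 -> 0 < powsum a x.
Proof.
move=> x0; have /rV0Pn[j xj] := x0.
rewrite /powsum (bigD1 j)//= ltr_pwDl ?powR_gt0 ?normr_gt0//.
by apply: sumr_ge0 => k _; exact: powR_ge0.
Qed.

Lemma psiE d a (x : 'rV[R]_d) :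
  psi a x = (2 * (a - 1))^-1 * powsum a x `^ (2 / a).
Proof.
by rewrite /psi /lpnorm -powR_mulrn ?powR_ge0// -powRrM [2 / a]mulrC.
Qed.

Lemma powsumZ d a (x : 'rV[R]_d) t : powsum a (t *: x) = `|t| `^ a * powsum a x.
Proof.
by rewrite /powsum mulr_sumr; apply: eq_bigr => j _; rewrite mxE normrM powRM.
Qed.

Lemma psiZ d a (x : 'rV[R]_d) t : a != 0 -> psi a (t *: x) = t ^+ 2 * psi a x.
Proof.
move=> a0; rewrite !psiE powsumZ powRM ?powR_ge0 ?powsum_ge0// -powRrM.
by rewrite [a * _]mulrCA mulfV// mulr1 powR_mulrn// real_normK ?num_real// mulrCA.
Qed.

Lemma mirror_grad0 d a : mirror_grad a (0 : 'rV[R]_d) = 0.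
Proof. by apply/rowP => j; rewrite !mxE sgr0 mul0r !mulr0. Qed.

(** The chain rule needs a positive power sum. At the origin homogeneity gives psi(h u) = h^2 psi(u)
    instead, with derivative 0. *)
Lemma is_derive_psi d a (x u : 'rV[R]_d) : 1 < a ->
  is_derive x u (psi a : 'rV[R]_d -> R^o) (dotv (mirror_grad a x) u).
Proof.
move=> a1; have a0 : 0 < a by lra.
rewrite -[x]add0r -[0](scale0r u); apply/is_derive_line; rewrite scale0r add0r.
have [->|x0] := eqVneq x 0.
  rewrite mirror_grad0 /dotv big1 => [|j _]; last by rewrite mxE mul0r.
  rewrite (_ : (fun _ => _) = psi a u \*: ((id : R -> R) * (id : R -> R))); last first.
    by apply/funext => h /=; rewrite addr0 psiZ ?gt_eqF// mulrC expr2.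
  apply: is_derive_eq.
  by rewrite /= !scale0r addr0 scaler0.
pose g := fun h : R => powsum a (h *: u + x).
have dg : is_derive (0 : R) 1 g
    (\sum_j a * (Num.sg (x 0 j) * `|x 0 j| `^ (a - 1)) * u 0 j).
  rewrite (_ : g = \sum_j (fun h : R => `|h * u 0 j + x 0 j| `^ a)); last first.
    apply/funext => h; rewrite fct_sumE; apply: eq_bigr => j _.
    by rewrite !mxE.
  apply: is_derive_sum => j.
  have H2 : is_derive (0 : R) 1 (fun h : R => h * u 0 j + x 0 j) (u 0 j).
    apply: is_derive_eq; rewrite scaler0 add0r addr0; exact: mulr1.
  have := @is_derive_norm_powR a (0 * u 0 j + x 0 j) a1.
  move=> H1; have := @is_derive1_comp _ _ (fun h : R => h * u 0 j + x 0 j) 0 _ _ H1 H2.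
  by rewrite mul0r add0r.
have gx : g 0 = powsum a x by rewrite /g scale0r add0r.
have g0 : 0 < g 0 by rewrite gx powsum_gt0.
have dh := @is_derive1_powR R (2 / a) (g 0) g0.
have := is_deriveZ ((2 * (a - 1))^-1) (is_derive1_comp dh dg).
rewrite (_ : _ \*: _ = (fun h : R => psi a (h *: u + x))); last first.
  by apply/funext => h /=; rewrite psiE.
move=> H; apply: is_derive_eq.
rewrite gx /dotv /GRing.scale/= mulrA mulr_sumr.
apply: eq_bigr => j _; rewrite mxE; field.
by rewrite !gt_eqF//; lra.
Qed.

Lemma gradient_psi d a : 1 < a -> gradient (psi a) =1 @mirror_grad d a.
Proof.
move=> a1 x; apply/rowP => j; rewrite mxE.
have [_ ->] := @is_derive_psi d a x (delta_mx 0 j) a1.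
rewrite /dotv (bigD1 j)//= [delta_mx _ _ _ _]mxE !eqxx mulr1 big1 ?addr0// => k kj.
by rewrite [delta_mx _ _ _ _]mxE (negbTE kj) andbF mulr0.
Qed.

End MirrorMapGradient.

Section RowVectors.
Context {R : realType} (d : nat).
Implicit Types u v w x y : 'rV[R]_d.

Lemma dotvC u v : dotv u v = dotv v u.
Proof. by apply: eq_bigr => j _; rewrite mulrC. Qed.

Lemma dotvDr u v w : dotv u (v + w) = dotv u v + dotv u w.
Proof. by rewrite -big_split; apply: eq_bigr => j _; rewrite mxE mulrDr. Qed.

Lemma dotvZr u t v : dotv u (t *: v) = t * dotv u v.
Proof. by rewrite mulr_sumr; apply: eq_bigr => j _; rewrite mxE mulrCA. Qed.

Lemma dotvNr u v : dotv u (- v) = - dotv u v.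
Proof. by rewrite -scaleN1r dotvZr mulN1r. Qed.

Lemma dotvBr u v w : dotv u (v - w) = dotv u v - dotv u w.
Proof. by rewrite dotvDr dotvNr. Qed.

Lemma dotvBl u v w : dotv (u - v) w = dotv u w - dotv v w.
Proof. by rewrite ![dotv _ w]dotvC dotvBr. Qed.

Lemma l1normE u : l1norm u = \sum_j `|u 0 j|.
Proof. by rewrite /l1norm big_ord1. Qed.

Lemma l1norm_ge0 u : 0 <= l1norm u.
Proof. by rewrite l1normE sumr_ge0. Qed.

Lemma l1normB u v : l1norm (u - v) <= l1norm u + l1norm v.
Proof.
rewrite !l1normE -big_split/=; apply: ler_sum => j _; rewrite !mxE; exact: ler_normB.
Qed.

Lemma l1norm0 : l1norm (0 : 'rV[R]_d) = 0.
Proof. by rewrite l1normE big1// => j _; rewrite mxE normr0. Qed.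

Lemma normr_dotv_le u v M : (forall j, `|u 0 j| <= M) ->
  `|dotv u v| <= M * l1norm v.
Proof.
move=> uM; apply: le_trans (ler_norm_sum _ _ _) _.
rewrite l1normE mulr_sumr; apply: ler_sum => j _; rewrite normrM.
exact: ler_wpM2r.
Qed.

End RowVectors.

(** Cauchy-Schwarz without square roots: c_i c_j is compared with the mean of u_i v_j and u_j
    v_i. *)
Lemma sqr_sum_le {R : realType} (I : finType) (c u v : I -> R) :
  (forall i, 0 <= u i) -> (forall i, 0 <= v i) ->
  (forall i, c i ^+ 2 <= u i * v i) ->
  (\sum_i c i) ^+ 2 <= (\sum_i u i) * (\sum_i v i).
Proof.
move=> u0 v0 cuv.
have E (a b : I -> R) : (\sum_i a i) * (\sum_i b i) = \sum_i \sum_j a i * b j.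
  by rewrite mulr_suml; apply: eq_bigr => i _; rewrite mulr_sumr.
rewrite expr2 !E.
have : \sum_i \sum_j c i * c j <= \sum_i \sum_j (u i * v j + u j * v i) / 2.
  apply: ler_sum => i _; apply: ler_sum => j _.
  apply: le_trans (ler_norm _) _; rewrite -ler_sqr ?nnegrE//; last first.
    by rewrite divr_ge0// addr_ge0// mulr_ge0.
  rewrite real_normK ?num_real// exprMn.
  have : c i ^+ 2 * c j ^+ 2 <= (u i * v i) * (u j * v j) by rewrite ler_pM ?sqr_ge0.
  have := sqr_ge0 (u i * v j - u j * v i); lra.
move=> /le_trans; apply.
under eq_bigr do under eq_bigr do rewrite mulrDl.
under eq_bigr do rewrite big_split/=.
rewrite big_split/= [X in _ + X]exchange_big/=.
rewrite -big_split/=; apply: ler_sum => i _; rewrite -big_split/=; apply: ler_sum => j _.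
lra.
Qed.

Lemma powR_ge_tangent_at {R : realType} (q A S : R) : 1 <= q -> 0 < A -> 0 <= S ->
  A `^ (q - 1) * (q * (S - A)) <= S `^ q - A `^ q.
Proof.
move=> q1 A0 S0; have Aq : A `^ q = A * A `^ (q - 1).
  by rewrite mulr_powRB1 ?ltW//; lra.
have SA0 : 0 <= S / A by rewrite divr_ge0// ltW.
have H := powR_ge_tangent q1 SA0.
have Aq' : 0 < A `^ q by rewrite powR_gt0.
move: H; rewrite -(ler_pM2l Aq') -powRM ?(ltW A0)// [A * (S / A)]mulrCA.
rewrite mulfV ?gt_eqF// mulr1 Aq.
have -> : A * A `^ (q - 1) * (1 + q * (S / A - 1)) =
  A * A `^ (q - 1) + A `^ (q - 1) * (q * (S - A)) by field; rewrite gt_eqF.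
lra.
Qed.

(** Here A and S are the power sums of x and y, V the derivative of the power sum along y - x, Q the
    weighted quadratic form, D = d^(2-2/a) and q = 2/a. Convexity of S^q transfers the first-order
    bound to psi. As S <= 16 A, the sum A + S costs a factor 17, and 816/72 times q >= 3/2 is at
    least 17. *)
Lemma bregman_arith_close {R : realType} (a q A S D Q V : R) :
  1 < a <= 4 / 3 -> 3 / 2 <= q <= 2 -> 0 < A -> 0 <= S -> S <= 16 * A ->
  0 <= D -> 0 <= Q -> (a - 1) / 36 * Q <= S - A - V ->
  Q * (D * (A + S) `^ (q - 1)) <=
  816 * D * ((2 * (a - 1))^-1 * (S `^ q - A `^ q - q * A `^ (q - 1) * V)).
Proof.
move=> /andP[a1 a43] /andP[q32 q2] A0 S0 SA D0 Q0 PB.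
have q1 : 1 <= q by lra.
have tang := powR_ge_tangent_at q1 A0 S0.
have pow17 : (A + S) `^ (q - 1) <= 17 * A `^ (q - 1).
  apply: (@le_trans _ _ ((17 * A) `^ (q - 1))).
    by apply: ge0_ler_powR; rewrite ?nnegrE; lra.
  rewrite powRM ?(ltW A0) ?ler0n// ler_wpM2r ?powR_ge0//.
  rewrite -[leRHS](@powRr1 R 17) ?ler0n//.
  by apply: ler_powR; [rewrite ler1n | lra].
move: pow17 tang (powR_ge0 A (q - 1)).
move: (A `^ (q - 1)) (A `^ q) (S `^ q) ((A + S) `^ (q - 1)) => U Aq Sq W WU tang U0.
have K : U * q * ((a - 1) / 36 * Q) <= Sq - Aq - q * U * V.
  have : U * q * ((a - 1) / 36 * Q) <= U * q * (S - A - V).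
    by rewrite ler_wpM2l// mulr_ge0//; lra.
  lra.
have c0 : 0 < (2 * (a - 1))^-1 by rewrite invr_gt0; lra.
move: K; rewrite -(ler_pM2l c0).
have -> : (2 * (a - 1))^-1 * (U * q * ((a - 1) / 36 * Q)) = U * Q * (q / 72).
  by field; rewrite gt_eqF//; lra.
have D816 : 0 <= 816 * D by lra.
move=> K; apply: le_trans (ler_wpM2l D816 K).
have DUQ : 0 <= D * (U * Q) by rewrite !mulr_ge0.
apply: (@le_trans _ _ (D * (U * Q) * 17)).
  have : Q * (D * W) <= Q * (D * (17 * U)) by rewrite ler_wpM2l// ler_wpM2l.
  lra.
rewrite (_ : 816 * D * (U * Q * (q / 72)) = D * (U * Q) * (816 / 72 * q)); last by field.
by rewrite ler_wpM2l//; lra.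
Qed.

(** For t = S/A >= 16 one has t^q >= t sqrt(t) >= 4 t, so the tangent 1 + q (t - 1) <= 2 t takes at
    most half of t^q, and the rest of S^q dominates both squared norms. *)
Lemma bregman_arith_far {R : realType} (a q A S D V nx ny nxy : R) :
  1 < a <= 4 / 3 -> 3 / 2 <= q <= 2 -> 0 <= A -> 16 * A <= S -> 0 <= D ->
  0 <= S - A - V -> 0 <= nxy <= ny + nx ->
  nx ^+ 2 <= D * A `^ q -> ny ^+ 2 <= D * S `^ q ->
  nxy ^+ 2 <=
  816 * D * ((2 * (a - 1))^-1 * (S `^ q - A `^ q - q * A `^ (q - 1) * V)).
Proof.
move=> /andP[a1 a43] /andP[q32 q2] A0 SA D0 PB /andP[nxy0 nxyD] Nx Ny.
have gap : S `^ q / 2 <= S `^ q - A `^ q - q * A `^ (q - 1) * (S - A).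
  have := A0; rewrite le_eqVlt => /predU1P[A00|Agt0].
    rewrite -A00 !powR0; try (by apply/eqP; lra).
    have := powR_ge0 S q; lra.
  pose t := S / A; have St : S = A * t by rewrite /t mulrCA mulfV ?gt_eqF ?mulr1.
  have t16 : 16 <= t by rewrite ler_pdivlMr.
  clearbody t; rewrite {}St.
  have t0 : 0 < t by lra.
  have tq : 4 * t <= t `^ q.
    apply: (@le_trans _ _ (t `^ (3 / 2))).
      have -> : t `^ (3 / 2) = t * t `^ (2^-1).
        rewrite -mulr_powRB1 ?(ltW t0) ?divr_gt0//; congr (_ * _ `^ _).
        by field.
      rewrite mulrC ler_pM2l//.
      rewrite powR12_sqrt ?(ltW t0)//.
      have -> : 4 = Num.sqrt (4 ^+ 2) :> R by rewrite sqrtr_sqr ger0_norm.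
      by rewrite ler_wsqrtr//; lra.
    by rewrite ler_powR//; lra.
  have Aq : A `^ q = A * A `^ (q - 1) by rewrite mulr_powRB1//; lra.
  have Aq0 : 0 < A `^ q by rewrite powR_gt0.
  rewrite powRM ?(ltW t0)//.
  have -> : q * A `^ (q - 1) * (A * t - A) = A `^ q * (q * (t - 1)) by rewrite Aq; ring.
  have : A `^ q * (1 + q * (t - 1)) <= A `^ q * (t `^ q / 2).
    rewrite ler_pM2l//; nra.
  lra.
have slope : q * A `^ (q - 1) * V <= q * A `^ (q - 1) * (S - A).
  by rewrite ler_wpM2l ?mulr_ge0 ?powR_ge0//; lra.
have AS : A `^ q <= S `^ q by rewrite ge0_ler_powR// ?nnegrE//; lra.
move: gap slope AS Nx Ny (powR_ge0 A (q - 1)) (powR_ge0 S q).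
move: (A `^ (q - 1)) (A `^ q) (S `^ q) => U Aq Sq gap slope AS Nx Ny U0 Sq0.
have DAS : D * Aq <= D * Sq by rewrite ler_wpM2l.
have l1 : nxy ^+ 2 <= 4 * (D * Sq).
  have : nxy ^+ 2 <= (ny + nx) ^+ 2 by rewrite ler_sqr ?nnegrE//; lra.
  have := sqr_ge0 (ny - nx); lra.
apply: (le_trans l1).
have c32 : 3 / 2 <= (2 * (a - 1))^-1.
  have -> : 3 / 2 = (2 / 3)^-1 :> R by lra.
  by rewrite lef_pV2 ?posrE; lra.
have : 3 / 2 * (Sq / 2) <= (2 * (a - 1))^-1 * (Sq - Aq - q * U * V).
  by apply: ler_pM; lra.
move: (_^-1 * _) => W SW.
have D816 : 0 <= 816 * D by lra.
have DSq : 0 <= D * Sq by rewrite mulr_ge0.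
by move: (ler_wpM2l D816 SW); lra.
Qed.

(** * Strong convexity of the mirror map in the l1 norm *)

Section MirrorMapConvexity.
Context {R : realType} (d : nat) (a : R).
Hypotheses (d0 : (0 < d)%N) (a_bounds : 1 < a <= 4 / 3).
Implicit Types x y g : 'rV[R]_d.

Let a1 : 1 < a. Proof. by case/andP: a_bounds. Qed.

Let a0 : 0 < a. Proof. exact: lt_trans a1. Qed.

Let q_bounds : 3 / 2 <= 2 / a <= 2.
Proof.
have /andP[? ?] := a_bounds.
by rewrite ler_pdivlMr// ler_pdivrMr//; apply/andP; split; lra.
Qed.

Let c_gt0 : 0 < (2 * (a - 1))^-1.
Proof. by have /andP[? ?] := a_bounds; rewrite invr_gt0; lra. Qed.

Lemma sqr_l1norm_le x :
  l1norm x ^+ 2 <= d%:R `^ (2 - 2 / a) * powsum a x `^ (2 / a).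
Proof.
have /andP[a_gt1 a_le] := a_bounds.
have E : l1norm x <= d%:R `^ (1 - a^-1) * powsum a x `^ a^-1.
  rewrite l1normE (eq_bigr (fun j => (`|x 0 j| `^ a) `^ a^-1)) => [|j _].
    apply: sum_powR_le; [|exact: d0|by move=> j; exact: powR_ge0].
    by rewrite invr_ge0 ltW//= invf_le1//; lra.
  by rewrite -powRrM mulfV ?gt_eqF// powRr1.
have -> : 2 - 2 / a = (1 - a^-1) * 2 by ring.
rewrite [2 / a]mulrC !powRrM !powR_mulrn ?powR_ge0// -exprMn.
by rewrite ler_sqr ?nnegrE ?l1norm_ge0// mulr_ge0 ?powR_ge0.
Qed.

(** The derivative of [powsum a] at [x] in the direction [y - x]. *)
Definition powsum_slope x y : R :=
  \sum_j a * (Num.sg (x 0 j) * `|x 0 j| `^ (a - 1)) * (y 0 j - x 0 j).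

Let dotv_mirror_grad x y : dotv (mirror_grad a x) (y - x) =
  (2 * (a - 1))^-1 * (2 / a * powsum a x `^ (2 / a - 1) * powsum_slope x y).
Proof.
have /andP[a_gt1 a_le] := a_bounds.
rewrite /dotv /powsum_slope !mulr_sumr; apply: eq_bigr => j _; rewrite !mxE.
by field; rewrite !gt_eqF//; lra.
Qed.

Let bregmanE x y : bregman (psi a) x y = (2 * (a - 1))^-1 *
  (powsum a y `^ (2 / a) - powsum a x `^ (2 / a)
   - 2 / a * powsum a x `^ (2 / a - 1) * powsum_slope x y).
Proof. by rewrite /bregman gradient_psi// dotv_mirror_grad !psiE !mulrBr. Qed.

Definition power_curvature x y : R := \sum_j (y 0 j - x 0 j) ^+ 2 *
  Num.max `|x 0 j| `|y 0 j| `^ (a - 2).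

Let powsum_bregman x y :
  (a - 1) / 36 * power_curvature x y <= powsum a y - powsum a x - powsum_slope x y.
Proof.
have /andP[a_gt1 a_le] := a_bounds.
rewrite /powsum /powsum_slope -!sumrB mulr_sumr; apply: ler_sum => j _.
by rewrite mulrA powR_bregman// a1; lra.
Qed.

Let power_curvature_ge0 x y : 0 <= power_curvature x y.
Proof. by apply: sumr_ge0 => j _; rewrite mulr_ge0 ?sqr_ge0 ?powR_ge0. Qed.

(** Cauchy-Schwarz with weights w_j^(2-a), w_j the larger modulus. As w_j^(2-a) = (w_j^a)^(2/a-1)
    with 2/a - 1 in [0, 1], the power mean inequality bounds their sum and produces d^(2-2/a). *)
Let sqr_l1norm_le_power_curvature x y : l1norm (y - x) ^+ 2 <=
  power_curvature x y * (d%:R `^ (2 - 2 / a) * (powsum a x + powsum a y) `^ (2 / a - 1)).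
Proof.
have /andP[a_gt1 a_le] := a_bounds.
pose w j := Num.max `|x 0 j| `|y 0 j|.
apply: (@le_trans _ _ (power_curvature x y * \sum_j w j `^ (2 - a))).
  rewrite l1normE; apply: sqr_sum_le => j; rewrite ?powR_ge0//.
    by rewrite mulr_ge0 ?sqr_ge0 ?powR_ge0.
  rewrite !mxE real_normK ?num_real// -/(w j) -mulrA.
  have [wj0|wj0] := eqVneq (w j) 0.
    have : `|x 0 j| <= 0 by rewrite -wj0 le_max lexx.
    have : `|y 0 j| <= 0 by rewrite -wj0 le_max lexx orbT.
    rewrite !normr_le0 => /eqP-> /eqP->; rewrite subrr expr0n /= mul0r; exact: lexx.
  by rewrite -powRD ?wj0 ?implybT// (_ : a - 2 + (2 - a) = 0) ?powRr0 ?mulr1//; lra.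
rewrite ler_wpM2l//.
have /andP[q32 q2] := q_bounds.
have -> : \sum_j w j `^ (2 - a) = \sum_j (w j `^ a) `^ (2 / a - 1).
  apply: eq_bigr => j _; rewrite -powRrM; congr (_ `^ _).
  by rewrite mulrBr mulr1 mulrCA mulfV ?gt_eqF// mulr1.
have p01 : 0 <= 2 / a - 1 <= 1 by lra.
have wa0 j : 0 <= w j `^ a by exact: powR_ge0.
apply: (le_trans (sum_powR_le p01 d0 wa0)).
rewrite (_ : 1 - (2 / a - 1) = 2 - 2 / a); last by lra.
rewrite ler_wpM2l ?powR_ge0// ge0_ler_powR//.
- by lra.
- by rewrite nnegrE sumr_ge0// => j _; exact: powR_ge0.
- by rewrite nnegrE addr_ge0// powsum_ge0.
rewrite -big_split/=; apply: ler_sum => j _; rewrite /w.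
have := powR_ge0 `|x 0 j| a; have := powR_ge0 `|y 0 j| a.
by case: (leP `|x 0 j| `|y 0 j|) => _; lra.
Qed.

Let psi_curvature_close x y : x != 0 -> powsum a y <= 16 * powsum a x ->
  l1norm (y - x) ^+ 2 <= 816 * d%:R `^ (2 - 2 / a) * bregman (psi a) x y.
Proof.
move=> x0 yx; apply: (le_trans (sqr_l1norm_le_power_curvature x y)).
rewrite bregmanE; apply: bregman_arith_close => //.
- exact: powsum_gt0.
- exact: powsum_ge0.
Qed.

Let psi_curvature_far x y : 16 * powsum a x <= powsum a y ->
  l1norm (y - x) ^+ 2 <= 816 * d%:R `^ (2 - 2 / a) * bregman (psi a) x y.
Proof.
move=> xy; rewrite bregmanE; apply: (@bregman_arith_far _ _ _ _ _ _ _ (l1norm x) (l1norm y)) => //.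
- exact: powsum_ge0.
- apply: le_trans (powsum_bregman x y); rewrite mulr_ge0// divr_ge0//.
  by rewrite subr_ge0 ltW.
- by rewrite l1norm_ge0 l1normB.
- exact: sqr_l1norm_le.
- exact: sqr_l1norm_le.
Qed.

(* As long as the power sum of y is at most 16 times that of x, the coordinatewise
   curvature and Cauchy-Schwarz suffice; beyond that, psi(y) alone dominates. *)
Lemma psi_strong_convexity x y :
  l1norm (y - x) ^+ 2 <= 816 * d%:R `^ (2 - 2 / a) * bregman (psi a) x y.
Proof.
have [x0|x0] := eqVneq x 0.
  apply: psi_curvature_far; rewrite x0.
  have -> : powsum a (0 : 'rV[R]_d) = 0.
    by rewrite /powsum big1// => j _; rewrite mxE normr0 powR0 ?gt_eqF.
  by rewrite mulr0 powsum_ge0.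
have [yx|/ltW yx] := leP (powsum a y) (16 * powsum a x).
  exact: psi_curvature_close.
exact: psi_curvature_far.
Qed.

Lemma psi_le x : psi a x <= (2 * (a - 1))^-1 * l1norm x ^+ 2.
Proof.
have /andP[a_gt1 a_le] := a_bounds.
rewrite psiE ler_pM2l//.
have -> : l1norm x ^+ 2 = (l1norm x `^ a) `^ (2 / a).
  by rewrite -powRrM mulrCA mulfV ?gt_eqF// mulr1 powR_mulrn ?l1norm_ge0.
rewrite ge0_ler_powR ?nnegrE ?powsum_ge0 ?powR_ge0//.
  by have /andP[] := q_bounds; lra.
by rewrite l1normE; apply: sum_powR_le_powR_sum => //; lra.
Qed.

Lemma bregman_psi0 y : bregman (psi a) 0 y = psi a y.
Proof.
rewrite /bregman gradient_psi// mirror_grad0 /dotv big1 => [|j _]; last by rewrite mxE mul0r.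
have -> : psi a (0 : 'rV[R]_d) = 0.
  by rewrite -(scale0r (0 : 'rV[R]_d)) psiZ ?gt_eqF// expr0n mul0r.
by rewrite !subr0.
Qed.

End MirrorMapConvexity.

(** Only forward quotients are examined: a feasible direction of a convex set can be followed only
    towards the set. *)
Lemma is_derive_ge_slope {R : realType} (phi : R -> R) (D s : R) :
  is_derive (0 : R) 1 phi D ->
  (forall t, 0 < t <= 1 -> t * s <= phi t - phi 0) -> s <= D.
Proof.
move=> [dphi <-] H.
have C := cvg_dnbhs_at_right dphi.
rewrite /derive -(cvg_lim (@Rhausdorff R) C); apply: limr_ge; first exact: cvgP C.
near=> h; have h0 : 0 < h by near: h; exact: nbhs_right_gt.
have h1 : h <= 1 by near: h; apply: nbhs_right_le.
rewrite /= addr0 [_%:A]mulr1 /GRing.scale/= mulrC ler_pdivlMr// mulrC.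
by apply: H; rewrite h0.
Unshelve. all: by end_near. Qed.

(** Moving from the minimizer y towards u stays in the l1 ball, which gives the variational
    inequality for eta g + grad psi(y) - grad psi(x); the rest is the three-point identity of
    Bregman divergences. *)
Lemma mirror_step_three_points {R : realType} d (a B eta : R) (g x y u : 'rV[R]_d) :
  1 < a -> mirror_step (psi a) B eta g x y -> l1norm u <= B ->
  eta * dotv g (y - u) <=
  bregman (psi a) x u - bregman (psi a) y u - bregman (psi a) x y.
Proof.
move=> a1 [yB ymin] uB.
set Gx := mirror_grad a x; set Gy := mirror_grad a y.
have Gxy : dotv Gx (u - y) - eta * dotv g (u - y) <= dotv Gy (u - y).
  have dpsi := @is_derive_psi _ d a y (u - y) a1.
  have {}dpsi : is_derive (0 : R) 1 (fun h : R => psi a (h *: (u - y) + y)) (dotv Gy (u - y)).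
    by apply/is_derive_line; rewrite scale0r add0r.
  apply: (is_derive_ge_slope dpsi) => t /andP[t0 t1].
  rewrite scale0r add0r.
  have := ymin (t *: (u - y) + y).
  have -> : l1norm (t *: (u - y) + y) <= B.
    have -> : t *: (u - y) + y = t *: u - (t - 1) *: y.
      by rewrite scalerBr scalerBl scale1r opprB; rewrite addrA addrAC.
    apply: (le_trans (l1normB _ _)).
    have E (s : R) (v : 'rV[R]_d) : l1norm (s *: v) = `|s| * l1norm v.
      by rewrite !l1normE mulr_sumr; apply: eq_bigr => j _; rewrite mxE normrM.
    rewrite !E (gtr0_norm t0) distrC ger0_norm; last by lra.
    have : t * l1norm u <= t * B by rewrite ler_pM2l.
    have : (1 - t) * l1norm y <= (1 - t) * B by rewrite ler_wpM2l//; lra.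
    lra.
  move=> /(_ isT); rewrite /bregman !gradient_psi// -/Gx.
  move: (psi a _) (psi a y) (psi a x) => p1 p2 p3.
  by rewrite !(dotvDr, dotvZr, dotvNr); clearbody Gx; lra.
rewrite /bregman !gradient_psi// -/Gx -/Gy.
move: Gxy; clearbody Gx Gy; move: (psi a u) (psi a y) (psi a x) => p1 p2 p3.
by rewrite !(dotvDr, dotvZr, dotvNr); lra.
Qed.

(** * Smooth convex functions *)

Section SmoothConvex.
Context {R : realType} (d : nat) (f : 'rV[R]_d -> R).
Implicit Types x y u : 'rV[R]_d.

Lemma is_derive_gradient x u : differentiable (f : 'rV[R]_d -> R^o) x ->
  is_derive x u (f : 'rV[R]_d -> R^o) (dotv (gradient f x) u).
Proof.
move=> df; have : derivable (f : 'rV[R]_d -> R^o) x u by exact: diff_derivable.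
move=> /derivableP; congr is_derive; rewrite deriveE//.
rewrite [in LHS](row_sum_delta u) linear_sum /=; apply: eq_bigr => j _.
by rewrite linearZ/= mxE deriveE// mulrC.
Qed.

Lemma convex_tangent x y : convex_objective f ->
  differentiable (f : 'rV[R]_d -> R^o) x ->
  f x + dotv (gradient f x) (y - x) <= f y.
Proof.
move=> cf df; have := is_derive_gradient (y - x) df.
rewrite -{1}[x]add0r -{1}[0](scale0r (y - x)) => /is_derive_line dphi.
have {}dphi := is_deriveN dphi.
rewrite -lerBrDl -lerN2; apply: (is_derive_ge_slope dphi) => t /andP[t0 t1].
rewrite /GRing.opp/= scale0r add0r.
have := cf (Itv01 (ltW t0) t1) y x; rewrite !inE => /(_ I I).
move=> H.
have {}H : f (t *: y + (1 - t) *: x) <= t * f y + (1 - t) * f x := H.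
have E : t *: (y - x) + x = t *: y + (1 - t) *: x.
  by rewrite scalerBr scalerBl scale1r -addrA [_ + x]addrC.
rewrite E.
have G (A B C : R) : A <= t * C + (1 - t) * B -> t * - (C - B) <= - A - - B by lra.
exact: G.
Qed.

Context (H : R) (cf : convex_objective f) (hf : bounded_hessian f H).

Let df x : differentiable (f : 'rV[R]_d -> R^o) x. Proof. by case: (hf x). Qed.

Lemma is_derive_slope u x (t : R) :
  is_derive t (1 : R) (fun h : R => dotv (gradient f (h *: u + x)) u)
    (dotv (u *m hessian f (t *: u + x)) u).
Proof.
have [_ dg _] := hf (t *: u + x).
have dgu := diff_derivable (v := u) dg.
apply/(@is_derive_line _ _ _ (fun y => dotv (gradient f y) u)).
rewrite /hessian -deriveEjacobian//.
have dj j : is_derive (t *: u + x) u (fun y => gradient f y 0 j : R^o)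
    (('D_u (gradient f) (t *: u + x)) 0 j).
  have /derivable_mxP/(_ 0 j)/derivableP := dgu.
  by congr is_derive; rewrite derive_mx// mxE.
have -> : (fun y => dotv (gradient f y) u) =
    \sum_j (u 0 j \*: (fun y => gradient f y 0 j : R^o)).
  by apply/funext => y; rewrite fct_sumE; apply: eq_bigr => j _; rewrite mulrC.
have -> : dotv ('D_u (gradient f) (t *: u + x)) u =
    \sum_j u 0 j *: (('D_u (gradient f) (t *: u + x)) 0 j : R^o).
  by apply: eq_bigr => j _; rewrite mulrC.
by apply: is_derive_sum => j; exact: is_deriveZ.
Qed.

(** The entrywise l1 bound on the Hessian is dual to directions of sup norm 1. Sign vectors are such
    directions, so the curvature along them does not grow with d. *)
Lemma hessian_form_le u x : (forall j, `|u 0 j| <= 1) ->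
  dotv (u *m hessian f x) u <= H.
Proof.
move=> u1; have [_ _ HH] := hf x; apply: le_trans HH.
apply: le_trans (ler_norm _) _; apply: le_trans (ler_norm_sum _ _ _) _.
rewrite /l1norm exchange_big/=; apply: ler_sum => k _; rewrite mxE normrM.
apply: (@le_trans _ _ `|\sum_i u 0 i * hessian f x i k|).
  by rewrite ler_piMr.
apply: le_trans (ler_norm_sum _ _ _) _; apply: ler_sum => i _.
by rewrite normrM ler_piMl.
Qed.

Lemma slope_growth u x t : (forall j, `|u 0 j| <= 1) -> 0 <= t ->
  dotv (gradient f (t *: u + x)) u <= dotv (gradient f x) u + H * t.
Proof.
move=> u1 t0.
have [c _] := MVT_segment t0 (fun s _ => is_derive_slope u x s)
  (derivable_within_continuous (fun s _ => @ex_derive _ _ _ _ _ _ _ (is_derive_slope u x s))).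
rewrite scale0r add0r subr0 => E; rewrite -lerBlDl E.
by apply: ler_wpM2r => //; exact: hessian_form_le.
Qed.

(** The tangent inequality at the far endpoint combines with the growth of the slope. This gives H
    t^2 in place of Taylor's H t^2 / 2. *)
Lemma smooth_upper u x t : (forall j, `|u 0 j| <= 1) -> 0 <= t ->
  f (t *: u + x) <= f x + t * dotv (gradient f x) u + H * t ^+ 2.
Proof.
move=> u1 t0; have := convex_tangent x cf (df (t *: u + x)).
have -> : x - (t *: u + x) = - (t *: u) by rewrite opprD addrCA subrr addr0.
rewrite dotvNr dotvZr.
have : t * dotv (gradient f (t *: u + x)) u <= t * (dotv (gradient f x) u + H * t).
  by rewrite ler_wpM2l// slope_growth.
move: (f _) (f x) => a b; move: (dotv _ _) (dotv _ _) => *; lra.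
Qed.

Lemma smooth_lower u x t : f x + t * dotv (gradient f x) u <= f (t *: u + x).
Proof.
by have := convex_tangent (t *: u + x) cf (df x); rewrite addrK dotvZr.
Qed.

(* Compares f(xs) with f after a step of length |g_j| / (2H) along - sg(g_j) e_j. *)
Lemma gradient_self_bound x xs j : 0 < H -> (forall y, f xs <= f y) ->
  (gradient f x 0 j) ^+ 2 <= 4 * H * (f x - f xs).
Proof.
move=> H0 min; set g := gradient f x 0 j.
pose u : 'rV[R]_d := - Num.sg g *: delta_mx 0 j.
have u1 k : `|u 0 k| <= 1.
  rewrite !mxE eqxx /= normrM normrN normr_sg.
  by case: (g != 0); case: (k == j); rewrite /= ?(normr1, normr0, mulr0, mul0r, mulr1, mul1r).
have t0 : 0 <= `|g| / (2 * H) by rewrite divr_ge0// mulr_ge0// ltW.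
have := smooth_upper x u1 t0; have := min (`|g| / (2 * H) *: u + x).
have -> : dotv (gradient f x) u = - `|g|.
  rewrite /u dotvZr /dotv (bigD1 j)//= big1 => [|k kj]; last first.
    by rewrite [delta_mx _ _ _ _]mxE (negbTE kj) andbF mulr0.
  by rewrite addr0 [delta_mx _ _ _ _]mxE !eqxx mulr1 -/g mulNr -normrEsg.
have -> : `|g| / (2 * H) * - `|g| = - (`|g| ^+ 2 / (2 * H)) by ring.
rewrite exprMn exprVn real_normK ?num_real//.
have -> : H * (g ^+ 2 * (2 * H) ^- 2) = (g ^+ 2 / (2 * H)) / 2.
  by field; rewrite gt_eqF.
move: (f _) (f x) (f xs) => a b c ca ab.
have K : g ^+ 2 / (2 * H) <= 2 * (b - c) by lra.
move: K; rewrite ler_pdivrMr ?mulr_gt0//; lra.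
Qed.

End SmoothConvex.

(** * Lasso and de-biasing under incoherence *)

Section SparseRegression.
Context {R : realType} (m : nat) (I : finType).
Implicit Types (X : 'I_m -> I -> R) (Y e : 'I_m -> R) (th h : I -> R).

Definition gram X (p q : I) : R := m%:R^-1 * \sum_i X i p * X i q.

Definition incoherent X (rho : R) : Prop :=
  (forall i p, X i p ^+ 2 = 1) /\ (forall p q, p != q -> `|gram X p q| <= rho).

Definition penalized_loss X Y (lambda : R) th : R :=
  m%:R^-1 * (\sum_i (Y i - \sum_p X i p * th p) ^+ 2) + lambda * \sum_p `|th p|.

Hypothesis m0 : (0 < m)%N.

Let mR : 0 < m%:R :> R. Proof. by rewrite ltr0n. Qed.

Lemma gram_diag X rho p : incoherent X rho -> gram X p p = 1.
Proof.
move=> [X1 _]; rewrite /gram (eq_bigr (fun=> 1)) => [|i _]; last by rewrite -expr2 X1.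
by rewrite sumr_const card_ord mulVf// gt_eqF.
Qed.

Lemma mean_sqr_gram X h :
  m%:R^-1 * (\sum_i (\sum_p X i p * h p) ^+ 2) =
  \sum_p \sum_q gram X p q * (h p * h q).
Proof.
rewrite /gram mulr_sumr.
under [RHS]eq_bigr do under eq_bigr do rewrite mulrAC -mulrA !mulr_sumr.
under [RHS]eq_bigr do rewrite exchange_big.
rewrite exchange_big; apply: eq_bigr => i _ /=.
rewrite expr2 mulr_suml mulr_sumr; apply: eq_bigr => p _.
rewrite !mulr_sumr; apply: eq_bigr => q _; ring.
Qed.

(** The Gram matrix has diagonal 1 and other entries at most rho; this serves as the restricted
    eigenvalue condition. *)
Lemma mean_sqr_ge X rho h : 0 <= rho -> incoherent X rho ->
  \sum_p h p ^+ 2 - rho * (\sum_p `|h p|) ^+ 2 <=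
  m%:R^-1 * (\sum_i (\sum_p X i p * h p) ^+ 2).
Proof.
move=> rho0 Xrho; rewrite mean_sqr_gram expr2 mulr_suml mulr_sumr -sumrB.
apply: ler_sum => p _.
rewrite [leRHS](bigD1 p)//= (gram_diag _ Xrho) mul1r -expr2 lerD2l.
rewrite !mulr_sumr [in leLHS](bigD1 p)//= opprD.
rewrite -[leRHS]add0r; apply: lerD.
  by rewrite oppr_le0 !mulr_ge0.
rewrite -sumrN; apply: ler_sum => q qp.
rewrite -normrM lerNl; apply: le_trans (ler_norm _) _.
by rewrite normrN [leLHS]normrM ler_wpM2r//; apply: (proj2 Xrho); rewrite eq_sym.
Qed.

(** Let a and b be the l1 masses of the error on and off the support of th. Comparing objectives
    yields the cone condition b <= 3 a, incoherence yields a <= 3 k lambda, and a + b <= 4 a. *)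
Lemma lasso_l1_error X Y e th th' rho lambda (k : nat) :
  0 <= rho -> incoherent X rho -> 0 < lambda -> (0 < k)%N ->
  (forall i, Y i = \sum_p X i p * th p + e i) ->
  (forall p, `|m%:R^-1 * \sum_i X i p * e i| <= lambda / 4) ->
  (#|[pred p | th p != 0%R]| <= k)%N -> 32 * k%:R * rho <= 1 ->
  penalized_loss X Y lambda th' <= penalized_loss X Y lambda th ->
  \sum_p `|th' p - th p| <= 12 * k%:R * lambda.
Proof.
move=> rho0 Xrho l0 k0 YE eb Sk krho min.
pose h p := th' p - th p.
have k0R : (0 : R) < k%:R by rewrite ltr0n.
set S := [pred p | th p != 0] in Sk.
set a := \sum_(p | S p) `|h p|; set b := \sum_(p | ~~ S p) `|h p|.
have ab : \sum_p `|h p| = a + b by rewrite (bigID S).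
have a0 : 0 <= a by apply: sumr_ge0.
have b0 : 0 <= b by apply: sumr_ge0.
set M := m%:R^-1 * (\sum_i (\sum_p X i p * h p) ^+ 2).
have M0 : 0 <= M by rewrite mulr_ge0 ?invr_ge0 ?ler0n// sumr_ge0// => i _; exact: sqr_ge0.
have cross : m%:R^-1 * \sum_i e i * (\sum_p X i p * h p) <= lambda / 4 * (a + b).
  have -> : m%:R^-1 * \sum_i e i * (\sum_p X i p * h p) =
      \sum_p (m%:R^-1 * \sum_i X i p * e i) * h p.
    rewrite mulr_sumr; under eq_bigr do rewrite !mulr_sumr.
    rewrite exchange_big; apply: eq_bigr => p _ /=.
    by rewrite mulr_sumr mulr_suml; apply: eq_bigr => i _; ring.
  rewrite -ab mulr_sumr; apply: ler_sum => p _; apply: le_trans (ler_norm _) _.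
  by rewrite normrM ler_wpM2r.
have pen : \sum_p `|th p| - \sum_p `|th' p| <= a - b.
  rewrite (bigID S) [X in _ - X](bigID S) /=.
  have -> : \sum_(p | ~~ S p) `|th p| = 0.
    by apply: big1 => p; rewrite /S/= negbK => /eqP->; rewrite normr0.
  have -> : \sum_(p | ~~ S p) `|th' p| = b.
    by apply: eq_bigr => p; rewrite /S/= negbK /h => /eqP->; rewrite subr0.
  rewrite addr0 opprD addrA lerD2r /a -sumrB; apply: ler_sum => p _.
  by rewrite /h distrC; have := lerB_dist (th p) (th' p); lra.
have basic : M <= lambda * (3 / 2 * a - b / 2).
  move: min; rewrite /penalized_loss.
  have -> : \sum_i (Y i - \sum_p X i p * th' p) ^+ 2 =
    \sum_i (Y i - \sum_p X i p * th p) ^+ 2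
    - 2 * (\sum_i e i * (\sum_p X i p * h p)) + \sum_i (\sum_p X i p * h p) ^+ 2.
    rewrite mulr_sumr -sumrB -big_split; apply: eq_bigr => i _ /=.
    have -> : \sum_p X i p * h p = \sum_p X i p * th' p - \sum_p X i p * th p.
      by rewrite -sumrB; apply: eq_bigr => p _; rewrite mulrBr.
    by rewrite YE; ring.
  rewrite mulrDr mulrBr -/M.
  have : lambda * (\sum_p `|th p| - \sum_p `|th' p|) <= lambda * (a - b).
    by rewrite ler_pM2l.
  move: cross; clearbody M a b; clear - l0.
  move: (\sum_i _) (\sum_p _) (\sum_p _) (\sum_i _) => u v w t.
  by move: m%:R^-1 => mi; lra.
have lower : a ^+ 2 / k%:R - rho * (a + b) ^+ 2 <= M.
  apply: le_trans (mean_sqr_ge h rho0 Xrho); rewrite ab lerB//.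
  rewrite ler_pdivrMr//.
  pose one p : R := (S p)%:R.
  have -> : a = \sum_p one p * `|h p|.
    rewrite /a big_mkcond; apply: eq_bigr => p _; rewrite /one.
    by case: (S p); rewrite ?mul1r ?mul0r.
  have card_one : \sum_p one p <= k%:R.
    by rewrite -natr_sum -big_mkcond/= sum1_card ler_nat.
  apply: (@le_trans _ _ ((\sum_p h p ^+ 2) * \sum_p one p)).
    apply: sqr_sum_le => p; rewrite ?sqr_ge0 ?ler0n//.
    rewrite exprMn real_normK ?num_real// mulrC ler_wpM2l ?sqr_ge0// /one.
    by case: (S p); rewrite ?expr1n ?expr0n.
  by apply: ler_wpM2l => //; apply: sumr_ge0 => p _; exact: sqr_ge0.
(* The prediction error [M] is nonnegative, so the right side of [basic] is too. *)
have b3a : b <= 3 * a.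
  have : 0 <= lambda * (3 / 2 * a - b / 2) by apply: le_trans basic.
  rewrite pmulr_rge0//; lra.
rewrite ab; clearbody a b M; clear - a0 b0 l0 k0R rho0 b3a basic lower krho.
move: (k%:R : R) k0R krho lower => {}k k0 krho lower.
have kiE : k * k^-1 = 1 by rewrite mulfV ?gt_eqF.
have rk : rho <= k^-1 / 32.
  by rewrite ler_pdivlMr// -(ler_pM2l k0) kiE; lra.
(* On the cone (a + b)^2 <= 16 a^2, so 32 k rho <= 1 lets incoherence destroy at most half of a^2 /
   k. *)
have S16 : rho * (a + b) ^+ 2 <= (k^-1 / 32) * (16 * a ^+ 2).
  apply: ler_pM; rewrite ?sqr_ge0//.
  rewrite (_ : 16 * a ^+ 2 = (4 * a) ^+ 2); last by ring.
  by rewrite ler_sqr ?nnegrE; lra.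
have Q : a ^+ 2 * k^-1 / 2 <= lambda * (3 / 2 * a).
  have : lambda * (3 / 2 * a - b / 2) <= lambda * (3 / 2 * a) by rewrite ler_pM2l//; lra.
  lra.
have {}Q : a ^+ 2 <= (3 * k * lambda) * a.
  have : k * (a ^+ 2 * k^-1 / 2) <= k * (lambda * (3 / 2 * a)) by rewrite ler_pM2l.
  rewrite (_ : k * (a ^+ 2 * k^-1 / 2) = (k * k^-1) * (a ^+ 2 / 2)); last by ring.
  rewrite kiE; lra.
have : a <= 3 * k * lambda.
  have [->|an0] := eqVneq a 0; first by rewrite !mulr_ge0// ltW.
  have ap : 0 < a by rewrite lt_neqAle eq_sym an0.
  by rewrite -(ler_pM2r ap) -expr2.
lra.
Qed.

(** The correction subtracts the Gram matrix applied to the Lasso error. Its diagonal is exactly 1,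
    so the error in coordinate p cancels and only off-diagonal entries, at most rho, remain. *)
Lemma debias_error X Y e th th' rho p :
  0 <= rho -> incoherent X rho ->
  (forall i, Y i = \sum_q X i q * th q + e i) ->
  `|th' p + m%:R^-1 * (\sum_i X i p * (Y i - \sum_q X i q * th' q)) -
    (th p + m%:R^-1 * \sum_i X i p * e i)|
  <= rho * \sum_q `|th' q - th q|.
Proof.
move=> rho0 Xrho YE; pose h q := th' q - th q.
have -> : m%:R^-1 * (\sum_i X i p * (Y i - \sum_q X i q * th' q)) =
    m%:R^-1 * (\sum_i X i p * e i) - \sum_q gram X p q * h q.
  have -> : \sum_q gram X p q * h q = m%:R^-1 * \sum_i X i p * \sum_q X i q * h q.
    rewrite /gram mulr_sumr; under eq_bigr do rewrite -mulrA mulr_suml mulr_sumr.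
    rewrite exchange_big; apply: eq_bigr => i _ /=.
    by rewrite !mulr_sumr; apply: eq_bigr => q _; ring.
  rewrite -mulrBr -sumrB; congr (_ * _); apply: eq_bigr => i _; rewrite -mulrBr.
  congr (_ * _); rewrite YE.
  have -> : \sum_q X i q * h q = \sum_q X i q * th' q - \sum_q X i q * th q.
    by rewrite -sumrB; apply: eq_bigr => q _; rewrite mulrBr.
  ring.
have -> : \sum_q gram X p q * h q = h p + \sum_(q | q != p) gram X p q * h q.
  by rewrite (bigD1 p)//= (gram_diag _ Xrho) mul1r.
rewrite {1}/h; have -> (A B C D : R) : A + (C - (A - B + D)) - (B + C) = - D by ring.
rewrite normrN; apply: le_trans (ler_norm_sum _ _ _) _.
rewrite mulr_sumr [leRHS](bigD1 p)//= -[leLHS]add0r; apply: lerD.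
  by rewrite mulr_ge0.
by apply: ler_sum => q qp; rewrite normrM ler_wpM2r// (proj2 Xrho)// eq_sym.
Qed.

End SparseRegression.

(** * Independent sources and sub-Gaussian sums *)

Section JointIndependence.
Context {disp : measure_display} {Omega : measurableType disp} {R : realType}.
Context (P : probability Omega R) (I : finType) (G : I -> set (set Omega)).

Definition joint (J : {set I}) : set (set Omega) := \bigcup_(j in [set` J]) G j.

Hypotheses (G_sigma : forall i, sigma_algebra setT (G i))
  (G_measurable : forall i, G i `<=` measurable)
  (G_indep : mutually_independent P G).

Let cylinders (J : {set I}) : set (set Omega) :=
  [set A | exists2 E : I -> set Omega, (forall j, j \in J -> G j (E j)) &
           A = \bigcap_(j in [set` J]) E j].

Let G_T i : G i setT.
Proof.
by have [G0 GC _] := G_sigma i; have := GC _ G0; rewrite setD0.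
Qed.

Let G_C i A : G i A -> G i (~` A).
Proof.
by have [G0 GC _] := G_sigma i => /GC; rewrite setTD.
Qed.

Let G_I i A B : G i A -> G i B -> G i (A `&` B).
Proof.
move=> GA GB; rewrite -[A `&` B]setCK setCI; apply: G_C.
have [G0 GC GU] := G_sigma i.
have -> : ~` A `|` ~` B = \bigcup_k (if k is 0%N then ~` A else ~` B).
  apply/seteqP; split=> [w [Aw|Bw]|w [[|k] _ ?]]; [by exists 0%N|by exists 1%N|by left|by right].
by apply: GU => -[|k]; exact: G_C.
Qed.

Let joint_sub_cylinders J : joint J `<=` cylinders J.
Proof.
move=> A [j /= jJ GA]; exists (fun i => if i == j then A else setT).
  by move=> i iJ; case: eqP => [->//|_]; exact: G_T.
apply/seteqP; split=> [w Aw i _|w /(_ j jJ)] /=; last by rewrite eqxx.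
by case: eqP.
Qed.

Let cylinders_setI J : setI_closed (cylinders J).
Proof.
move=> _ _ [E GE ->] [F GF ->]; exists (fun j => E j `&` F j).
  by move=> j jJ; apply: G_I; [exact: GE|exact: GF].
by rewrite bigcapI.
Qed.

Let cylinders_measurable J A : cylinders J A -> measurable A.
Proof.
move=> [E GE ->]; apply: fin_bigcap_measurable => [|j /= jJ].
  exact: finite_finpred.
exact/G_measurable/GE.
Qed.

(** A pi-lambda argument: intersections of one event per source form a pi-system generating the
    joint sigma-algebra, and the events satisfying the product formula with [E] form a Dynkin
    system. *)
Lemma joint_indep (J : {set I}) k A E : k \notin J -> <<s joint J >> A -> G k E ->
  (P (A `&` E) = P A * P E)%E.
Proof.
move=> kJ JA GE; have mE : measurable E by exact: G_measurable GE.
pose D := [set A | measurable A /\ (P (A `&` E) = P A * P E)%E].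
suff: <<s joint J >> `<=` D by move=> /(_ _ JA)[].
apply: (@subset_trans _ <<s cylinders J >>).
  exact: sub_smallest2r.
rewrite -setI_closed_g_dynkin_g_sigma_algebra//; apply: smallest_sub.
  split.
  - by split => //; rewrite setTI probability_setT mul1e.
  - move=> B [mB PB]; split; first exact: measurableC.
    have -> : ~` B `&` E = E `\` (B `&` E).
      by rewrite setDIr setDv setU0 setDE setIC.
    rewrite measureD//; last 2 first.
      exact: measurableI.
      by rewrite ltey_eq fin_num_measure.
    have -> : E `&` (B `&` E) = B `&` E by rewrite setICA setIid.
    rewrite [X in (_ - X)%E]PB probability_setC// muleBl ?mul1e//.
      exact: fin_num_measure.
  - move=> F tF DF; have mF n : measurable (F n) by case: (DF n).
    split; first exact: bigcup_measurable.
    rewrite setI_bigcupl measure_bigcup//; last 2 first.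
      by move=> n _; exact: measurableI.
      exact/trivIset_setIr.
    rewrite measure_bigcup//.
    rewrite -[P E]fineK ?fin_num_measure// muleC -nneseriesZl//.
    by apply: eq_eseriesr => n _; rewrite fineK ?fin_num_measure// muleC; case: (DF n).
move=> _ [F GF ->]; split; first by apply: (@cylinders_measurable J); exists F.
pose F' j := if j == k then E else F j.
have F'J j : j \in J -> F' j = F j.
  by move=> jJ; rewrite /F'; case: eqP jJ kJ => // -> ->.
have GF' j : j \in k |: J -> G j (F' j).
  rewrite !inE => /orP[/eqP->|jJ]; first by rewrite /F' eqxx.
  by rewrite F'J//; exact: GF.
have F'k : F' k = E by rewrite /F' eqxx.
have := G_indep GF'; rewrite big_setU1//= F'k.
have -> : \bigcap_(j in [set` k |: J]) F' j = \bigcap_(j in [set` J]) F j `&` E.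
  apply/seteqP; split => w.
    move=> H; split; last by have := H k; rewrite /= setU11 /F' eqxx; exact.
    by move=> j /= jJ; rewrite -F'J//; apply: H; rewrite /= setU1r.
  move=> [H Ew] j /=; rewrite !inE => /orP[/eqP->|jJ]; first by rewrite /F' eqxx.
  by rewrite F'J//; exact: H.
move=> ->; rewrite muleC; congr (_ * _)%E.
by rewrite (G_indep GF); apply: eq_bigr => j jJ; rewrite F'J.
Qed.

Lemma joint_measurable J : <<s joint J >> `<=` measurable.
Proof.
apply: smallest_sub; first exact: sigma_algebra_measurable.
by move=> A [j _ /G_measurable].
Qed.

End JointIndependence.

Section IndependentExpectation.
Context {disp : measure_display} {Omega : measurableType disp} {R : realType}.
Context (P : probability Omega R).
Local Open Scope ereal_scope.

(** Factorization on rectangles identifies the joint law with the product law, so Tonelli integrates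
    out [Y] with [X] frozen. *)
Lemma ge0_integral_indep d1 d2 (T1 : measurableType d1) (T2 : measurableType d2)
    (X : {RV P >-> T1}) (Y : {RV P >-> T2}) (F : T1 * T2 -> \bar R) :
  measurable_fun setT F -> (forall z, 0 <= F z) ->
  (forall A B, measurable A -> measurable B ->
     P (X @^-1` A `&` Y @^-1` B) = P (X @^-1` A) * P (Y @^-1` B)) ->
  \int[P]_w F (X w, Y w) =
  \int[distribution P X]_x \int[distribution P Y]_y F (x, y).
Proof.
move=> mF F0 XY.
have mXY : measurable_fun setT (fun w => (X w, Y w)).
  exact: measurable_fun_pair.
pose XY' : {mfun Omega >-> (T1 * T2)%type} :=
  HB.pack (fun w => (X w, Y w)) (isMeasurableFun.Build _ _ _ _ _ mXY).
have -> : \int[P]_w F (X w, Y w) = \int[distribution P XY']_z F z.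
  by rewrite ge0_integral_distribution.
rewrite -fubini_tonelli1//; apply: eq_measure_integral => A mA _.
by apply/esym/product_measure_unique => // B C mB mC; exact: XY.
Qed.

End IndependentExpectation.

(** * Sub-Gaussian tails and adapted sums *)

Definition subgaussian {disp : measure_display} {Omega : measurableType disp}
    {R : realType} (P : probability Omega R) (v : R) (X : Omega -> R) :=
  forall a : R, (\int[P]_w (expR (a * X w))%:E <= (expR (v * a ^+ 2 / 2))%:E)%E.

Section Chernoff.
Context {disp : measure_display} {Omega : measurableType disp} {R : realType}.
Context (P : probability Omega R).

(* [v = 0] is allowed: the bound then says that X <= 0 almost surely. *)
Lemma subgaussian_tail (X : Omega -> R) (v t : R) : measurable_fun setT X ->
  0 <= v -> subgaussian P v X -> 0 < t ->
  (P [set w | (t * Num.sqrt v < X w)%R] <= (expR (- t ^+ 2 / 2))%:E)%E.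
Proof.
move=> mX v0 sX t0.
pose Y : {RV P >-> R} := HB.pack X (isMeasurableFun.Build _ _ _ _ _ mX).
have tail a b : 0 < a ->
    (P [set w | (b <= X w)%R] <= (expR (v * a ^+ 2 / 2 - a * b))%:E)%E.
  move=> a0; apply: le_trans (chernoff Y b a0) _.
  rewrite /mmt_gen_fun unlock expRD EFinM lee_wpmul2r// ?lee_fin ?expR_ge0//.
  apply: le_trans (sX a); rewrite le_eqVlt; apply/orP; left; apply/eqP.
  by apply: eq_integral => w _ /=; rewrite mulrC.
have mS b : measurable [set w | (b <= X w)%R].
  rewrite (_ : [set w | _] = X @^-1` `[b, +oo[); last first.
    by apply/seteqP; split => w /=; rewrite in_itv/= andbT.
  by rewrite -[X in measurable X]setTI; exact: (mX measurableT _ (measurable_itv _)).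
have mS' b : measurable [set w | (b < X w)%R].
  rewrite (_ : [set w | _] = X @^-1` `]b, +oo[); last first.
    by apply/seteqP; split => w /=; rewrite in_itv/= andbT.
  by rewrite -[X in measurable X]setTI; exact: (mX measurableT _ (measurable_itv _)).
move: v0; rewrite le_eqVlt => /predU1P[v0|v0]; last first.
  apply: (@le_trans _ _ (P [set w | (t * Num.sqrt v <= X w)%R])).
    by apply: le_measure; rewrite ?inE// => w /= /ltW.
  have s0 : 0 < Num.sqrt v by rewrite sqrtr_gt0.
  apply: le_trans (tail (t / Num.sqrt v) _ _) _; first by rewrite divr_gt0.
  rewrite lee_fin ler_expR -{1}(sqr_sqrtr (ltW v0)).
  rewrite le_eqVlt; apply/orP; left; apply/eqP; field; exact: lt0r_neq0.
rewrite -v0 sqrtr0 mulr0.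
have -> : [set w | (0 < X w)%R] = \bigcup_n [set w | (n.+1%:R^-1 <= X w)%R].
  apply/seteqP; split => w /= [].
    move=> Xw; exists (Num.truncn (X w)^-1) => //=.
    rewrite invf_ple ?posrE//; apply: ltW.
    by rewrite truncnS_gt// num_real.
  by move=> n _ /=; apply: lt_le_trans; rewrite invr_gt0.
have null n : (P [set w | (n.+1%:R^-1 <= X w)%R] = 0)%E.
  set A := [set w | _]; have b0 : 0 < n.+1%:R^-1 :> R by rewrite invr_gt0.
  have PA : P A = (fine (P A))%:E by rewrite fineK ?fin_num_measure//; exact: mS.
  apply/eqP; rewrite eq_le measure_ge0 andbT PA lee_fin leNgt; apply/negP => p0.
  (* For v = 0 all exponential moments are at most 1. With p the probability and b = 1/(n+1), the
     choice a = 1/(p b) gives p e^(1/p) <= 1, whereas p e^(1/p) >= p + 1. *)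
  have a0 : 0 < (fine (P A) * n.+1%:R^-1)^-1 by rewrite invr_gt0 mulr_gt0.
  have := tail _ n.+1%:R^-1 a0; rewrite -/A PA -v0 lee_fin !mul0r add0r.
  rewrite invfM -mulrA mulVf ?lt0r_neq0// mulr1 => pe.
  have : fine (P A) * expR (fine (P A))^-1 <= 1.
    apply: le_trans (ler_wpM2r (expR_ge0 _) pe) _.
    by rewrite -expRD addNr expR0.
  have : fine (P A) * (1 + (fine (P A))^-1) <= fine (P A) * expR (fine (P A))^-1.
    by rewrite ler_pM2l// expR_ge1Dx.
  rewrite mulrDr mulfV ?lt0r_neq0// mulr1; lra.
apply: (@le_trans _ _ 0%E); last by rewrite lee_fin expR_ge0.
rewrite le_eqVlt; apply/orP; left; apply/eqP/negligibleP.
  exact: bigcup_measurable.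
by apply: negligible_bigcup => n; apply/negligibleP; [exact: mS|exact: null].
Qed.

End Chernoff.

Section SubgaussianSums.
Context {disp : measure_display} {Omega : measurableType disp} {R : realType}.
Context (P : probability Omega R) (I : finType) (G : I -> set (set Omega)).
Hypotheses (G_sigma : forall i, sigma_algebra setT (G i))
  (G_measurable : forall i, G i `<=` measurable)
  (G_indep : mutually_independent P G).
Implicit Types (J : {set I}) (W c X : Omega -> R) (v : R).

Definition determined J (U : Omega -> R) : Prop :=
  measurable_fun setT (U : g_sigma_algebraType (joint G J) -> R).

Lemma determined_measurable J U : determined J U -> measurable_fun setT U.
Proof.
move=> mU _ A mA; apply: (@joint_measurable _ _ _ _ G_measurable J).
exact: (mU measurableT).
Qed.

Lemma determinedS J J' U : J \subset J' -> determined J U -> determined J' U.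
Proof.
move=> /fintype.subsetP JJ' mU _ A mA.
suff : <<s joint G J >> `<=` <<s joint G J' >> by apply; exact: (mU measurableT).
apply: sub_smallest2r; first exact: smallest_sigma_algebra.
by move=> B [j /= /JJ' jJ' GB]; exists j.
Qed.

Lemma determined_source J k U : k \in J -> measurable_wrt (G k) U -> determined J U.
Proof.
move=> kJ GU _ A mA; rewrite setTI; apply: sub_sigma_algebra; exists k => //.
exact: GU.
Qed.

(** [W] and [c] depend on the sources in [J] only, so [X] is integrated out first, with (W, c)
    frozen. *)
Lemma subgaussian_step J k W c X v : k \notin J ->
  determined J W -> (forall w, 0 <= W w) -> determined J c ->
  measurable_wrt (G k) X -> subgaussian P v X ->
  (\int[P]_w (W w * expR (c w * X w))%:E <=
   \int[P]_w (W w * expR (v * c w ^+ 2 / 2))%:E)%E.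
Proof.
move=> kJ mW W0 mc GX sX.
have mX : measurable_fun setT X.
  by move=> _ A mA; rewrite setTI; apply: (G_measurable (i := k)); exact: GX.
have mWc : measurable_fun setT (fun w => (W w, c w)).
  apply: measurable_fun_pair; first exact: (determined_measurable mW).
  exact: (determined_measurable mc).
pose X' : {RV P >-> R} := HB.pack X (isMeasurableFun.Build _ _ _ _ _ mX).
pose Wc : {RV P >-> (R * R)%type} :=
  HB.pack (fun w => (W w, c w)) (isMeasurableFun.Build _ _ _ _ _ mWc).
(* Tonelli wants an integrand nonnegative on the whole space, hence the absolute value of the
   weight. *)
pose F (z : R * R * R) : \bar R := (`|z.1.1| * expR (z.1.2 * z.2))%:E.
have mF : measurable_fun setT F.
  apply/measurable_EFinP; apply: measurable_funM.
    apply: measurableT_comp => //; exact: measurableT_comp measurable_fst measurable_fst.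
  apply: measurableT_comp => //; apply: measurable_funM => //.
  exact: measurableT_comp measurable_snd measurable_fst.
have F0 z : (0 <= F z)%E by rewrite lee_fin mulr_ge0 ?expR_ge0.
have indep A B : measurable A -> measurable B ->
    (P (Wc @^-1` A `&` X' @^-1` B) = P (Wc @^-1` A) * P (X' @^-1` B))%E.
  move=> mA mB; apply: (joint_indep G_sigma G_measurable G_indep kJ); last exact: GX.
  have mWcJ : measurable_fun setT
      ((fun w => (W w, c w)) : g_sigma_algebraType (joint G J) -> (R * R)%type).
    exact: measurable_fun_pair.
  by have := mWcJ measurableT _ mA; rewrite setTI.
have := ge0_integral_indep mF F0 indep; rewrite /F /=.
have -> : (\int[P]_w (`|W w| * expR (c w * X w))%:E = \int[P]_w (W w * expR (c w * X w))%:E)%E.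
  by apply: eq_integral => w _; rewrite ger0_norm.
move=> ->.
have mgf (a b : R) : (\int[distribution P X']_y (`|a| * expR (b * y))%:E <=
    (`|a| * expR (v * b ^+ 2 / 2))%:E)%E.
  have mexp : measurable_fun setT (fun y : R => (expR (b * y))%:E).
    by apply/measurable_EFinP; apply: measurableT_comp => //; exact: measurable_funM.
  under eq_integral do rewrite EFinM.
  rewrite ge0_integralZl//.
  rewrite EFinM lee_wpmul2l ?lee_fin//.
  rewrite ge0_integral_distribution//.
  exact: sX.
have mH : measurable_fun setT (fun z : R * R => (`|z.1| * expR (v * z.2 ^+ 2 / 2))%:E).
  apply/measurable_EFinP; apply: measurable_funM.
    by apply: measurableT_comp.
  apply: measurableT_comp => //; apply: measurable_funM => //.
  by apply: measurable_funM => //; apply: measurable_funX.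
apply: (@le_trans _ _ (\int[distribution P Wc]_z (`|z.1| * expR (v * z.2 ^+ 2 / 2))%:E)%E).
  apply: ge0_le_integral => //.
  - by move=> z _; apply: integral_ge0 => y _; rewrite lee_fin mulr_ge0 ?expR_ge0.
  - exact: (measurable_fun_fubini_tonelli_F (m2 := distribution P X') F mF F0).
rewrite ge0_integral_distribution//.
rewrite le_eqVlt; apply/orP; left; apply/eqP; apply: eq_integral => w _ /=.
by rewrite ger0_norm.
Qed.

(** The weight [W] is what the induction requires: the factor of source k is absorbed into it, k
    joins [J], and the remaining sources are treated before k is integrated out. *)
Lemma subgaussian_sum J (s : seq I) W (c X : I -> Omega -> R) (v L : R) :
  uniq s -> (forall k, k \in s -> k \notin J) -> 0 <= v ->
  determined J W -> (forall w, 0 <= W w) ->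
  (forall k, k \in s -> determined J (c k)) ->
  (forall k w, k \in s -> `|c k w| <= L) ->
  (forall k, k \in s -> measurable_wrt (G k) (X k)) ->
  (forall k, k \in s -> subgaussian P v (X k)) ->
  (\int[P]_w (W w * expR (\sum_(k <- s) c k w * X k w))%:E <=
   (expR (v * L ^+ 2 / 2 * (size s)%:R))%:E * \int[P]_w (W w)%:E)%E.
Proof.
elim: s J W => [|k s IH] J W /= us sJ v0 mW W0 mc cL GX sX.
  rewrite mulr0 expR0 mul1e le_eqVlt; apply/orP; left; apply/eqP.
  by apply: eq_integral => w _; rewrite big_nil expR0 mulr1.
have /andP[ks {}us] := us; have k1 : k \in k :: s by rewrite mem_head.
have s1 j : j \in s -> j \in k :: s by move=> js; rewrite inE js orbT.
have mck := mc _ k1; have GXk := GX _ k1.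
have mX : determined (k |: J) (X k) by apply: determined_source GXk; rewrite setU11.
have mS j : j \in k :: s -> determined (k |: J) (c j).
  by move=> /mc; apply: determinedS; exact: finset.subsetUr.
have mW' : determined (k |: J) (fun w => W w * expR (c k w * X k w)).
  apply: measurable_funM; first by apply: (determinedS _ mW); exact: finset.subsetUr.
  by apply: measurableT_comp => //; apply: measurable_funM => //; exact: mS.
have := IH (k |: J) (fun w => W w * expR (c k w * X k w)) us.
have -> : (\int[P]_w (W w * expR (c k w * X k w) *
      expR (\sum_(j <- s) c j w * X j w))%:E =
    \int[P]_w (W w * expR (\sum_(j <- k :: s) c j w * X j w))%:E)%E.
  by apply: eq_integral => w _; rewrite big_cons expRD mulrA.
move=> /(_ _ v0 mW' _ _ _ _ _)/le_trans; apply.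
- move=> j js; rewrite !inE negb_or sJ ?s1// andbT.
  by apply: contraNneq ks => <-.
- by move=> w; rewrite mulr_ge0 ?expR_ge0.
- by move=> j /s1; exact: mS.
- by move=> j w /s1; exact: cL.
- by move=> j /s1; exact: GX.
- by move=> j /s1; exact: sX.
have -> : (size s).+1%:R = (size s)%:R + 1 :> R by rewrite natr1.
rewrite mulrDr mulr1 expRD EFinM -muleA lee_wpmul2l ?lee_fin ?expR_ge0//.
apply: le_trans (subgaussian_step (sJ _ k1) mW W0 mck GXk (sX _ k1)) _.
have mWO := determined_measurable mW; have mcO := determined_measurable mck.
have mWE : measurable_fun setT (fun w => (W w)%:E) by exact/measurable_EFinP.
rewrite -ge0_integralZl//.
apply: ge0_le_integral => //.
- by move=> w _; rewrite lee_fin mulr_ge0 ?expR_ge0.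
- apply/measurable_EFinP; apply: measurable_funM => //.
  apply: measurableT_comp => //; apply: measurable_funM => //.
  by apply: measurable_funM => //; exact: measurable_funX.
- apply/measurable_EFinP; exact: measurable_funM.
move=> w _; rewrite -EFinM lee_fin mulrC ler_wpM2r// ler_expR.
have cw := cL k w k1; have L0 : 0 <= L by exact: le_trans cw.
rewrite ler_pM2r// ler_wpM2l// -[leLHS]real_normK ?num_real//.
by rewrite ler_sqr ?nnegrE.
Unshelve.
by move=> w _; rewrite lee_fin.
Qed.

End SubgaussianSums.

(** * Uniform sign vectors *)

Section RademacherSigns.
Context {R : realType}.

(** Power series are avoided at the price of 2 instead of 1/2. For a^2 <= 1/2, e^a <= 1/(1 - a) and
    its mirror image average to 1/(1 - a^2) <= 1 + 2 a^2; otherwise |a| <= 2 a^2. *)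
Lemma cosh_le (a : R) : (expR a + expR (- a)) / 2 <= expR (2 * a ^+ 2).
Proof.
have [a12|a12] := leP (a ^+ 2) (1 / 2).
  have a1 : -1 < a < 1 by apply/andP; split; nra.
  have e1 : expR a * (1 - a) <= 1.
    have := ler_wpM2l (expR_ge0 a) (expR_ge1Dx (- a)).
    by rewrite -expRD subrr expR0.
  have e2 : expR (- a) * (1 + a) <= 1.
    have := ler_wpM2l (expR_ge0 (- a)) (expR_ge1Dx a).
    by rewrite -expRD addNr expR0.
  have b : (expR a + expR (- a)) / 2 * (1 - a ^+ 2) <= 1.
    have : expR a * (1 - a) * (1 + a) <= 1 * (1 + a) by rewrite ler_wpM2r//; lra.
    have : expR (- a) * (1 + a) * (1 - a) <= 1 * (1 - a) by rewrite ler_wpM2r//; lra.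
    lra.
  apply: (@le_trans _ _ (1 + 2 * a ^+ 2)); last exact: expR_ge1Dx.
  have c : 1 <= (1 + 2 * a ^+ 2) * (1 - a ^+ 2) by nra.
  have d : 0 < 1 - a ^+ 2 by lra.
  by rewrite -(ler_pM2r d); lra.
have na : `|a| <= 2 * a ^+ 2.
  have na0 : 0 <= `|a| by [].
  have : 1 / 2 < `|a|.
    by rewrite -real_normK ?num_real// in a12; nra.
  by rewrite -[a ^+ 2]real_normK ?num_real//; nra.
have : expR a <= expR (2 * a ^+ 2).
  by rewrite ler_expR; apply: le_trans na; exact: ler_norm.
have : expR (- a) <= expR (2 * a ^+ 2).
  by rewrite ler_expR; apply: le_trans na; rewrite -normrN; exact: ler_norm.
lra.
Qed.

(* Coordinate [None] is the constant regressor attached to the intercept mu. *)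
Definition augmented_sign d (b : {ffun 'I_d -> bool}) (p : option 'I_d) : R :=
  if p is Some j then (-1) ^+ b j else 1.

Lemma augmented_sign_sqr d (b : {ffun 'I_d -> bool}) p : augmented_sign b p ^+ 2 = 1.
Proof. by case: p => [j|] /=; rewrite ?expr1n// sqrr_sign. Qed.

Lemma normr_augmented_sign d (b : {ffun 'I_d -> bool}) p : `|augmented_sign b p| = 1.
Proof. by case: p => [j|] /=; rewrite ?normr1// normr_sign. Qed.

Definition flip d (j : 'I_d) (b : {ffun 'I_d -> bool}) : {ffun 'I_d -> bool} :=
  [ffun i => if i == j then ~~ b i else b i].

Lemma flipK d (j : 'I_d) : involutive (flip j).
Proof.
by move=> b; apply/ffunP => i; rewrite !ffunE; case: eqP => // _; rewrite negbK.
Qed.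

Lemma augmented_sign_flip d (j : 'I_d) b p :
  augmented_sign (flip j b) p = (if p == Some j then -1 else 1) * augmented_sign b p.
Proof.
case: p => [i|] /=; last by rewrite mulr1.
rewrite ffunE (inj_eq Some_inj); case: eqP => [_|_]; rewrite ?mul1r//.
by rewrite signrN mulN1r.
Qed.

(** At least one of two distinct indices is a genuine coordinate; flipping it changes exactly one of
    the two factors. *)
Lemma augmented_sign_product_odd d (p q : option 'I_d) : p != q ->
  exists j, forall b, augmented_sign (flip j b) p * augmented_sign (flip j b) q =
                      - (augmented_sign b p * augmented_sign b q).
Proof.
wlog [j ->] : p q / exists j, p = Some j => [th|].
  case: p q => [i|] [k|] //; first by apply: th; exists i.
    by apply: th; exists i.
  move=> pq; case: (th (Some k) None); [by exists k|by []|] => j jE.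
  by exists j => b; rewrite mulrC jE mulrC.
move=> pq; exists j => b; rewrite !augmented_sign_flip eqxx eq_sym (negbTE pq).
by ring.
Qed.

Context {disp : measure_display} {Omega : measurableType disp}.
Context (P : probability Omega R).

Lemma integral_uniform d (Z : Omega -> {ffun 'I_d -> bool}) (h : {ffun 'I_d -> bool} -> R) :
  (forall b, measurable (Z @^-1` [set b])) ->
  (forall b, P (Z @^-1` [set b]) = (2 ^- d)%:E) -> (forall b, 0 <= h b) ->
  (\int[P]_w (h (Z w))%:E = (\sum_b h b * 2 ^- d)%:E)%E.
Proof.
move=> mZ PZ h0.
have -> : (\int[P]_w (h (Z w))%:E =
    \int[P]_w \sum_(b <- index_enum {ffun 'I_d -> bool}) (h b * \1_(Z @^-1` [set b]) w)%:E)%E.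
  apply: eq_integral => w _; rewrite sumEFin; congr EFin.
  rewrite (bigD1 (Z w))//= big1 => [|b bZ]; rewrite indicE.
    by rewrite mem_set// mulr1 addr0.
  by rewrite memNset ?mulr0//= => ZE; rewrite ZE eqxx in bZ.
rewrite ge0_integral_sum//; last 2 first.
- by move=> b; apply/measurable_EFinP; apply: measurable_funM.
- by move=> b w _; rewrite lee_fin mulr_ge0.
rewrite -sumEFin; apply: eq_bigr => b _.
under eq_integral do rewrite EFinM.
rewrite ge0_integralZl ?lee_fin//; last 1 first.
  by apply/measurable_EFinP; apply: measurable_indic; exact: mZ.
by rewrite integral_indic// setIT [X in (_ * X)%E]PZ.
Qed.

(** The flip preserves the uniform law and negates the product, so averaging b with its flip turns
    the exponential into cosh(a h) with h^2 = 1. The parameter 4 matches 2 a^2 = 4 a^2 / 2. *)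
Lemma sign_product_subgaussian d (Z : Omega -> {ffun 'I_d -> bool}) (p q : option 'I_d) :
  (forall b, measurable (Z @^-1` [set b])) ->
  (forall b, P (Z @^-1` [set b]) = (2 ^- d)%:E) -> p != q ->
  subgaussian P 4 (fun w => augmented_sign (Z w) p * augmented_sign (Z w) q).
Proof.
move=> mZ PZ pq a; set h := fun b => augmented_sign b p * augmented_sign b q.
rewrite (integral_uniform (h := fun b => expR (a * h b)) mZ PZ); last first.
  by move=> b; exact: expR_ge0.
rewrite lee_fin; have [j hj] := augmented_sign_product_odd pq.
have hN b : h (flip j b) = - h b by exact: hj.
set S := \sum_b _.
have SE : S = \sum_b (expR (a * h b) + expR (- (a * h b))) / 2 * 2 ^- d.
  have S' : S = \sum_b expR (- (a * h b)) * 2 ^- d.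
    rewrite /S (reindex_inj (inv_inj (flipK j))); apply: eq_bigr => b _.
    by rewrite hN mulrN.
  have -> : S = (S + S) / 2 by clearbody S; lra.
  by rewrite {2}S' -big_split mulr_suml; apply: eq_bigr => b _ /=; field; rewrite expf_neq0.
clearbody S; rewrite SE.
apply: (@le_trans _ _ (\sum_(b : {ffun 'I_d -> bool}) expR (2 * a ^+ 2) * 2 ^- d)).
  apply: ler_sum => b _; rewrite ler_pM2r//.
  have := cosh_le (a * h b); rewrite exprMn /h exprMn !augmented_sign_sqr mulr1 mulr1.
  exact.
rewrite sumr_const card_ffun card_bool card_ord -[leLHS]mulr_natr natrX mulfVK ?expf_neq0//.
by rewrite ler_expR; lra.
Qed.

End RademacherSigns.

(** * Measurability of continuous functions of random vectors *)

Section MeasurableComposition.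
Context {disp : measure_display} {Omega : measurableType disp} {R : realType}.

(* Row vectors carry no sigma-algebra here; f \o X is the limit of f along the
   roundings of X to the grids of mesh 1/(k+1), which take countably many values. *)
Lemma measurable_continuous_comp d (f : 'rV[R]_d -> R) (X : Omega -> 'rV[R]_d) :
  (forall x, {for x, continuous f}) ->
  (forall j, measurable_fun setT (fun w => X w 0 j)) ->
  measurable_fun setT (f \o X).
Proof.
move=> cf mX.
pose grid k (v : 'rV[int]_d) : 'rV[R]_d := \row_j ((v 0 j)%:~R / k.+1%:R).
pose N k w : 'rV[int]_d := \row_j Num.floor (k.+1%:R * X w 0 j).
apply: (@measurable_fun_cvg _ _ _ _ (fun k => f \o (grid k \o N k))) => [k|w _].
  move=> _ A mA; rewrite setTI.
  have -> : (f \o (grid k \o N k)) @^-1` A = \bigcup_(v : 'rV[int]_d)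
      (if f (grid k v) \in A then N k @^-1` [set v] else set0).
    apply/seteqP; split => [w /= fA|w [v _]].
      by exists (N k w) => //; rewrite mem_set.
    by case: ifPn => //; rewrite inE => fA /= ->.
  apply: countable_bigcupT_measurable; first exact: countableP.
  move=> v; case: ifP => // _.
  have -> : N k @^-1` [set v] = \bigcap_(j in [set` 'I_d])
      ((fun w => k.+1%:R * X w 0 j) @^-1` `[(v 0 j)%:~R, (v 0 j + 1)%:~R[).
    apply/seteqP; split => [w /= <- j _|w H]; first by rewrite /= in_itv/= mxE floor_itv.
    apply/rowP => j; have := H j isT; rewrite /= in_itv/= mxE => Hj.
    by apply: floor_def.
  apply: fin_bigcap_measurable; first exact: finite_finpred.
  move=> j _; rewrite -[X in measurable X]setTI.
  have mkX : measurable_fun setT (fun w => k.+1%:R * X w 0 j).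
    exact: measurable_funM.
  exact: (mkX measurableT _ (measurable_itv _)).
apply: (@continuous_cvg _ _ _ _ _ (fun k => grid k (N k w)) f (X w)); first exact: cf.
apply/cvg_ballP => e e0; near=> k; split => // i j; rewrite !mxE ord1.
have k0 : 0 < k.+1%:R :> R by [].
have /andP[fl fu] := floor_itv (k.+1%:R * X w 0 j).
rewrite /ball/= ger0_norm; last first.
  by rewrite subr_ge0 ler_pdivrMr// [leRHS]mulrC.
apply: (@le_lt_trans _ _ k.+1%:R^-1).
  rewrite lerBlDr -(ler_pM2l k0) mulrDr [_ * (_ / _)]mulrCA mulfV ?lt0r_neq0// mulr1.
  by apply: ltW; rewrite addrC -intrD1.
rewrite invf_plt ?posrE//; apply: (@lt_le_trans _ _ k%:R); last by rewrite ler_nat.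
by near: k; exact: nbhs_infty_gtr.
Unshelve. all: by end_near. Qed.

End MeasurableComposition.

(** * One round of gradient estimation *)

Section Round.
Context {R : realType}.

Lemma sum_option (I : finType) (F : option I -> R) :
  \sum_p F p = F None + \sum_i F (Some i).
Proof.
rewrite (bigD1 None)//=; congr (_ + _).
rewrite (reindex_omap Some id) /=; last by case.
by apply: eq_bigl => i; rewrite eqxx.
Qed.

Context (d m : nat) (b : 'I_m -> {ffun 'I_d -> bool}).

Definition sign_design : 'M[R]_(m, d) := \matrix_(i < m) signs R (b i).

Definition regressor (i : 'I_m) (p : option 'I_d) : R := augmented_sign (b i) p.

Definition parameter (g : 'rV[R]_d) (mu : R) (p : option 'I_d) : R :=
  if p is Some j then g 0 j else mu.

Lemma sign_designE i j : sign_design i j = regressor i (Some j).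
Proof. by rewrite !mxE. Qed.

Lemma regressor_parameter i g mu :
  \sum_p regressor i p * parameter g mu p = dotv g (signs R (b i)) + mu.
Proof.
rewrite sum_option/= mul1r addrC; congr (_ + _); apply: eq_bigr => j _.
by rewrite mxE mulrC.
Qed.

Lemma lasso_objectiveE Y lambda g mu :
  lasso_objective sign_design Y lambda g mu =
  penalized_loss regressor (Y 0) lambda (parameter g mu).
Proof.
rewrite /lasso_objective /penalized_loss -addrA; congr (_ * _ + _).
  apply: eq_bigr => i _; rewrite regressor_parameter rowK opprD addrA.
  by [].
by rewrite sum_option l1normE -mulrDr [in RHS]addrC.
Qed.

Lemma debiasedE Y g mu j :
  debiased sign_design Y g mu 0 j =
  parameter g mu (Some j) + m%:R^-1 * (\sum_i regressor i (Some j) *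
    (Y 0 i - \sum_q regressor i q * parameter g mu q)).
Proof.
rewrite /debiased !mxE /=; congr (_ + _ * _); apply: eq_bigr => i _.
rewrite regressor_parameter sign_designE mulrC !mxE opprD addrA; congr (_ * (_ - _ - _)).
by apply: eq_bigr => k _; rewrite [in LHS]mxE sign_designE !mxE.
Qed.

Context (f : 'rV[R]_d -> R) (s : nat) (H : R).
Hypotheses (H0 : 0 < H) (s1 : (1 <= s)%N) (cf : convex_objective f)
  (gf : sparse_gradient f s H) (hf : bounded_hessian f H).
Context (x : 'rV[R]_d) (xi : 'I_m -> R) (delta lambda rho nu : R).
Context (ghat : 'rV[R]_d) (muhat : R).
Hypotheses (delta0 : 0 < delta) (m0 : (0 < m)%N) (rho0 : 0 <= rho)
  (lambda0 : 0 < lambda).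

Let Y : 'rV[R]_m := \row_i ((f (x + delta *: signs R (b i)) + xi i) / delta).

Hypothesis lasso : lasso_solution sign_design Y lambda ghat muhat.

Hypotheses (rho_small : 64 * s%:R * rho <= 1)
  (design_incoherent : forall p q : option 'I_d, p != q -> `|gram regressor p q| <= rho)
  (noise_small : forall p, `|m%:R^-1 * \sum_i regressor i p * xi i| <= nu)
  (lambda_large : nu / delta + delta * H <= lambda / 4).

Let bias i : R := (f (x + delta *: signs R (b i)) - f x) / delta
                  - dotv (gradient f x) (signs R (b i)).

Let signs_le1 i j : `|signs R (b i) 0 j| <= 1.
Proof. by rewrite mxE normr_sign. Qed.

Let bias_bound i : `|bias i| <= delta * H.
Proof.
have up := smooth_upper cf hf x (signs_le1 i) (ltW delta0).
have lo := smooth_lower cf hf (signs R (b i)) x delta.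
rewrite /bias; move: up lo; rewrite [_ + x]addrC.
move: (f _) (f x) (dotv _ _) => A C D up lo.
rewrite ger0_norm.
  rewrite lerBlDr ler_pdivrMr//; lra.
by rewrite subr_ge0 ler_pdivlMr//; lra.
Qed.

Let bias_mean p : `|m%:R^-1 * \sum_i regressor i p * bias i| <= delta * H.
Proof.
have mR : 0 < m%:R :> R by rewrite ltr0n.
rewrite normrM gtr0_norm ?invr_gt0// mulrC ler_pdivrMr//.
apply: le_trans (ler_norm_sum _ _ _) _.
apply: (@le_trans _ _ (\sum_(i < m) delta * H)).
  by apply: ler_sum => i _; rewrite normrM normr_augmented_sign mul1r.
by rewrite sumr_const card_ord mulr_natr.
Qed.

Let error i : R := xi i / delta + bias i.

Let Y_model i : Y 0 i =
  \sum_p regressor i p * parameter (gradient f x) (f x / delta) p + error i.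
Proof. by rewrite regressor_parameter mxE /error /bias; ring. Qed.

Let error_mean p : m%:R^-1 * \sum_i regressor i p * error i =
  (m%:R^-1 * \sum_i regressor i p * xi i) / delta
  + m%:R^-1 * \sum_i regressor i p * bias i.
Proof.
rewrite -mulrA mulr_suml -mulrDr -big_split/=; congr (_ * _).
by apply: eq_bigr => i _; rewrite mulrDr mulrA.
Qed.

Let regressor_incoherent : incoherent regressor rho.
Proof. by split=> // i p; exact: augmented_sign_sqr. Qed.

(** The extra unit accounts for the intercept f(x)/delta. *)
Let support_le : (#|[pred p | parameter (gradient f x) (f x / delta) p != 0%R]| <= s.+1)%N.
Proof.
have [_ sg _] := gf x; apply: leq_trans (_ : l0norm (gradient f x) < s.+1)%N; last by [].
rewrite /l0norm -!sum1_card [X in (X <= _)%N]big_mkcond/= [in X in (_ <= X)%N]big_mkcond/=.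
rewrite (bigD1 None)//= -[X in (_ <= X)%N]add1n leq_add//; first by case: ifP.
rewrite (reindex_omap Some id) /=; last by case.
by rewrite leq_eqVlt; apply/orP; left; apply/eqP/eq_bigl => i; rewrite eqxx.
Qed.

(** The Lasso error 12 (s + 1) lambda is at most 24 s lambda, since s >= 1; de-biasing multiplies it
    by rho. The other summand is the averaged curvature bias. *)
Lemma round_error j :
  `|debiased sign_design Y ghat muhat 0 j -
    (gradient f x 0 j + (m%:R^-1 * \sum_i sign_design i j * xi i) / delta)| <=
  delta * H + rho * (24 * s%:R * lambda).
Proof.
have eb p : `|m%:R^-1 * \sum_i regressor i p * error i| <= lambda / 4.
  rewrite error_mean; apply: le_trans lambda_large.
  apply: le_trans (ler_normD _ _) _; apply: lerD; last exact: bias_mean.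
  by rewrite normrM normfV (gtr0_norm delta0) ler_pM2r ?invr_gt0.
have s1R : 1 <= s%:R :> R by rewrite ler1n.
have sS : s.+1%:R = s%:R + 1 :> R by rewrite natr1.
have krho : 32 * s.+1%:R * rho <= 1.
  apply: le_trans rho_small; rewrite sS; apply: ler_wpM2r => //; lra.
have := lasso_l1_error m0 rho0 regressor_incoherent lambda0 (ltn0Sn s) Y_model eb
  support_le krho (th' := parameter ghat muhat).
rewrite -!lasso_objectiveE => /(_ (lasso _ _)) l1e.
have := debias_error m0 (parameter ghat muhat) (Some j) rho0 regressor_incoherent Y_model.
rewrite -debiasedE error_mean => de.
have E : \sum_i sign_design i j * xi i = \sum_i regressor i (Some j) * xi i.
  by apply: eq_bigr => i _; rewrite sign_designE.
have l24 : rho * (\sum_q `|parameter ghat muhat q -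
    parameter (gradient f x) (f x / delta) q|) <= rho * (24 * s%:R * lambda).
  apply: ler_wpM2l => //; apply: le_trans l1e _.
  by apply: ler_wpM2r; [exact: ltW | rewrite sS; lra].
rewrite E; apply: le_trans (lerD (bias_mean (Some j)) (le_trans de l24)).
apply: le_trans (ler_normD _ _).
rewrite le_eqVlt; apply/orP; left; apply/eqP; congr (`|_|).
have G (A C D F : R) : A - (C + D) = F + (A - (C + (D + F))) by ring.
exact: G.
Qed.

(** The mean of the sign vectors is the Gram column of the constant regressor, of sup norm at most
    rho. The first-order cost is thus delta H rho instead of delta H, which would be of order
    T^(-1/4). *)
Lemma query_average :
  m%:R^-1 * \sum_i f (x + delta *: signs R (b i)) <=
  f x + delta * H * rho + H * delta ^+ 2.
Proof.
have mR : 0 < m%:R :> R by rewrite ltr0n.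
pose S : 'rV[R]_d := m%:R^-1 *: \sum_i signs R (b i).
have S_le j : `|S 0 j| <= rho.
  have -> : S 0 j = gram regressor (Some j) None.
    rewrite mxE summxE /gram; congr (_ * _); apply: eq_bigr => i _.
    by rewrite mulr1 mxE.
  exact: design_incoherent.
have dS : dotv (gradient f x) S = m%:R^-1 * \sum_i dotv (gradient f x) (signs R (b i)).
  rewrite dotvZr; congr (_ * _).
  by elim/big_ind2: _ => [|u u' v v' <- <-|//]; rewrite ?dotvDr// -(scale0r 0) dotvZr mul0r.
have gS : dotv (gradient f x) S <= H * rho.
  apply: le_trans (ler_norm _) _; rewrite dotvC mulrC.
  apply: le_trans (normr_dotv_le _ S_le) _.
  by apply: ler_wpM2l => //; case: (gf x).
apply: (@le_trans _ _ (m%:R^-1 * \sum_(i < m) (f x + delta * dotv (gradient f x) (signs R (b i))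
    + H * delta ^+ 2))).
  rewrite ler_pM2l ?invr_gt0//; apply: ler_sum => i _.
  have := smooth_upper cf hf x (signs_le1 i) (ltW delta0).
  by rewrite [_ + x]addrC.
rewrite !big_split/= -mulr_sumr !sumr_const card_ord !mulrDr.
have mean (C : R) : m%:R^-1 * (C *+ m) = C.
  by rewrite -(mulr_natl C m) mulrA mulVf ?gt_eqF// mul1r.
rewrite !mean mulrCA -dS lerD2r lerD2l -mulrA.
by rewrite ler_pM2l.
Qed.

End Round.

(** * Mirror descent with perturbed gradients *)

Section MirrorDescent.
Context {R : realType} (d r : nat).

(** 816 comes from the strong convexity of psi, and e is the dimension factor d^(2-2/a) at the
    chosen exponent. *)
Definition bregman_const : R := 816 * expR 1.

Lemma bregman_const_gt0 : 0 < bregman_const.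
Proof. by rewrite mulr_gt0 ?expR_gt0 ?ltr0n. Qed.

Hypothesis L2 : 2 <= ln d%:R :> R.

Let a : R := psi_exponent d.

Let dgt0 : (0 < d)%N.
Proof.
rewrite lt0n; apply/eqP => d0; have := L2; rewrite d0 ln0//; lra.
Qed.

(** The upper bound is equivalent to ln d >= 2. *)
Let a_bounds : 1 < a <= 4 / 3.
Proof.
have h := L2; have p : 0 < 2 * ln d%:R - 1 :> R by lra.
rewrite /a /psi_exponent ltr_pdivlMr// ler_pdivrMr//; apply/andP; split; lra.
Qed.

(** The reason for the choice of exponent: 2 - 2/a = 1/ln d. *)
Let dual_power : d%:R `^ (2 - 2 / a) = expR 1.
Proof.
have h := L2; have dR : 0 < d%:R :> R by rewrite ltr0n.
rewrite /powR gt_eqF//; congr expR; rewrite /a /psi_exponent.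
by field; rewrite !gt_eqF//; lra.
Qed.

Lemma bregman_exponent_ge (x y : 'rV[R]_d) :
  l1norm (y - x) ^+ 2 <= bregman_const * bregman (psi (psi_exponent d)) x y.
Proof.
rewrite /bregman_const -dual_power; exact: psi_strong_convexity.
Qed.

Lemma bregman_origin_le (y : 'rV[R]_d) :
  bregman (psi (psi_exponent d)) 0 y <= ln d%:R * l1norm y ^+ 2.
Proof.
rewrite bregman_psi0//; apply: le_trans (psi_le _ _) _ => //.
apply: ler_wpM2r; first exact: sqr_ge0.
have h := L2; have -> : (2 * (psi_exponent d - 1))^-1 = (2 * ln d%:R - 1) / 2 :> R.
  by rewrite /psi_exponent; field; rewrite !gt_eqF//; lra.
lra.
Qed.

Context (B eta : R) (x : nat -> 'rV[R]_d) (g : 'I_r -> 'rV[R]_d).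
Context (xs : 'rV[R]_d).
Hypotheses (eta0 : 0 < eta) (x00 : x 0%N = 0)
  (step : forall t : 'I_r, mirror_step (psi (psi_exponent d)) B eta (g t) (x t) (x t.+1))
  (xsB : l1norm xs <= B).

(** The Bregman terms telescope. The move from x_t to x_(t+1), of l1 length N, costs eta G N, which
    the divergence, at least N^2 / [bregman_const], absorbs by completing the square. *)
Lemma mirror_descent_regret (G : 'I_r -> R) :
  (forall t j, `|g t 0 j| <= G t) ->
  eta * \sum_t dotv (g t) (x t - xs) <=
  ln d%:R * B ^+ 2 + eta ^+ 2 * bregman_const / 4 * \sum_t G t ^+ 2.
Proof.
move=> gG; pose V t := bregman (psi (psi_exponent d)) (x t) xs.
have K0 := bregman_const_gt0.
have one_step (t : 'I_r) : eta * dotv (g t) (x t - xs) <=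
    (V t - V t.+1) + eta ^+ 2 * bregman_const / 4 * G t ^+ 2.
  have tp := mirror_step_three_points (proj1 (andP a_bounds)) (step t) xsB.
  have sc := bregman_exponent_ge (x t) (x t.+1).
  have lin : `|dotv (g t) (x t.+1 - x t)| <= G t * l1norm (x t.+1 - x t).
    exact: normr_dotv_le.
  have -> : dotv (g t) (x t - xs) =
      dotv (g t) (x t.+1 - xs) - dotv (g t) (x t.+1 - x t).
    by rewrite -dotvBr; congr (dotv _ _); rewrite opprB [RHS]addrC addrA subrK.
  have {}lin : - (eta * dotv (g t) (x t.+1 - x t)) <=
      eta * (G t * l1norm (x t.+1 - x t)).
    rewrite -mulrN ler_pM2l//; apply: le_trans lin; rewrite -normrN; exact: ler_norm.
  move: tp; rewrite -/(V t) -/(V t.+1).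
  move: (dotv _ _) (dotv _ _) (l1norm _) (bregman _ _ _) sc lin => p q N D sc lin tp.
  have quad : eta * (G t * N) - D <= eta ^+ 2 * bregman_const / 4 * G t ^+ 2.
    have sq := sqr_ge0 (N - eta * bregman_const * G t / 2).
    rewrite -(ler_pM2l K0); nra.
  rewrite mulrBr; lra.
rewrite [leLHS]mulr_sumr.
apply: (le_trans (ler_sum _ (fun t _ => one_step t))).
rewrite big_split/= -mulr_sumr lerD2r.
rewrite -(big_mkord xpredT (fun t => V t - V t.+1)).
under eq_bigr do rewrite -opprB.
rewrite sumrN telescope_sumr// opprB.
have Vr : 0 <= V r.
  have := bregman_exponent_ge (x r) xs; rewrite -/(V r) => h.
  by have := le_trans (sqr_ge0 _) h; rewrite pmulr_rge0.
have V0 : V 0%N <= ln d%:R * B ^+ 2.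
  rewrite /V x00; apply: le_trans (bregman_origin_le _) _.
  have h := L2; apply: ler_wpM2l; first lra.
  rewrite ler_sqr ?nnegrE ?l1norm_ge0//; exact: le_trans (l1norm_ge0 _) xsB.
lra.
Qed.

Context (f : 'rV[R]_d -> R) (H gamma nu M : R).
Context (zeta : 'I_r -> 'rV[R]_d).
Hypotheses (H0 : 0 < H) (B0 : 0 < B) (cf : convex_objective f) (hf : bounded_hessian f H)
  (fmin : forall y, f xs <= f y) (gamma0 : 0 <= gamma)
  (decomposition : forall t j,
     `|g t 0 j - (gradient f (x t) 0 j + zeta t 0 j)| <= gamma)
  (zeta_le : forall t j, `|zeta t 0 j| <= nu)
  (martingale : - \sum_t dotv (zeta t) (x t - xs) <= M)
  (self_bounding : 3 * bregman_const * eta * H <= 1 / 2).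

Let xB (t : 'I_r) : l1norm (x t - xs) <= 2 * B.
Proof.
apply: le_trans (l1normB _ _) _.
have : l1norm (x t) <= B.
  case: t => -[|t] tr /=; first by rewrite x00 l1norm0; apply: ltW.
  by have [] := step (Ordinal (ltnW tr)).
by have h := xsB; lra.
Qed.

(* Since |grad f(x_t)|^2 <= 4H (f(x_t) - f(xs)), the gradient part of the quadratic
   term is absorbed into half of the sum being bounded. *)
Lemma optimality_gap_sum :
  \sum_(t < r) (f (x t) - f xs) <=
  2 * (ln d%:R * B ^+ 2) / eta
  + r%:R * (3 * bregman_const * eta / 2 * (nu ^+ 2 + gamma ^+ 2))
  + r%:R * (4 * B * gamma) + 2 * M.
Proof.
pose D (t : 'I_r) := f (x t) - f xs.
have D0 t : 0 <= D t by rewrite subr_ge0.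
have K0 := bregman_const_gt0.
(* The three parts of the sup norm of g_t: gradient, noise and bias; squaring the sum costs a factor
   3. *)
pose G t := Num.sqrt (4 * H * D t) + nu + gamma.
have HD t : 0 <= 4 * H * D t by rewrite !mulr_ge0// ltW.
have gG t j : `|g t 0 j| <= G t.
  have grad : `|gradient f (x t) 0 j| <= Num.sqrt (4 * H * D t).
    rewrite -sqrtr_sqr ler_wsqrtr//; exact: (gradient_self_bound cf hf).
  have -> : g t 0 j = gradient f (x t) 0 j + zeta t 0 j
      + (g t 0 j - (gradient f (x t) 0 j + zeta t 0 j)) by rewrite addrC subrK.
  apply: le_trans (ler_normD _ _) _; apply: lerD => //.
  by apply: le_trans (ler_normD _ _) _; apply: lerD.
have G2 t : G t ^+ 2 <= 12 * H * D t + 3 * (nu ^+ 2 + gamma ^+ 2).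
  rewrite /G; have := sqr_sqrtr (HD t); move: (Num.sqrt _) => q q2.
  have := sqr_ge0 (q - nu); have := sqr_ge0 (q - gamma); have := sqr_ge0 (nu - gamma).
  lra.
have reg := mirror_descent_regret gG.
have gap t : D t <= dotv (g t) (x t - xs) - dotv (zeta t) (x t - xs) + 2 * B * gamma.
  have [dft _ _] := hf (x t); have := convex_tangent xs cf dft.
  pose e := g t - (gradient f (x t) + zeta t).
  have eb : `|dotv e (x t - xs)| <= gamma * (2 * B).
    apply: le_trans (normr_dotv_le (M := gamma) _ _) _; last by rewrite ler_wpM2l.
    move=> j; have := decomposition t j; rewrite /e.
    by move: (g t) (gradient f (x t)) (zeta t) => A C E; rewrite !mxE.
  have -> : dotv (gradient f (x t)) (xs - x t) =
     - (dotv (g t) (x t - xs) - dotv (zeta t) (x t - xs) - dotv e (x t - xs)).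
    rewrite -!dotvBl -dotvNr; congr (dotv _ _); last by rewrite opprB.
    rewrite /e; move: (g t) (gradient f (x t)) (zeta t) => A C E.
    by apply/rowP => j; rewrite !mxE; ring.
  move: eb => /ler_normlP[]; rewrite /D.
  move: (dotv (g t) _) (dotv (zeta t) _) (dotv e _) (f (x t)) (f xs) => p q w A C.
  lra.
have sumD : \sum_t D t <= \sum_t dotv (g t) (x t - xs) + M + r%:R * (2 * B * gamma).
  apply: (le_trans (ler_sum _ (fun t _ => gap t))).
  rewrite big_split/= sumrB sumr_const card_ord -mulr_natl.
  by have h := martingale; lra.
have sumG : \sum_t G t ^+ 2 <= 12 * H * \sum_t D t + r%:R * (3 * (nu ^+ 2 + gamma ^+ 2)).
  apply: (le_trans (ler_sum _ (fun t _ => G2 t))).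
  by rewrite big_split/= -mulr_sumr sumr_const card_ord -[X in _ + X]mulr_natl.
have sD0 : 0 <= \sum_t D t by apply: sumr_ge0.
move: sumD sumG reg sD0; rewrite -/D.
have -> : \sum_(t < r) (f (x t) - f xs) = \sum_t D t by [].
move: (\sum_t D t) (\sum_t G t ^+ 2) (\sum_t dotv _ _) => SD SG SR sumD sumG reg sD0.
move: (ln d%:R * B ^+ 2) (self_bounding) K0 reg => A.
move: bregman_const => K sb K0 reg.
have e0 : 0 <= eta * K / 4 by rewrite divr_ge0// mulr_ge0// ltW.
have sumG' := ler_wpM2l e0 sumG.
have reg' : SR <= A / eta + eta * K / 4 * SG.
  rewrite -(ler_pM2l eta0); apply: le_trans reg _.
  by rewrite le_eqVlt; apply/orP; left; apply/eqP; field; rewrite gt_eqF.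
(* The factor is 12 H times eta K / 4. *)
have absorb : 3 * K * eta * H * SD <= 1 / 2 * SD by rewrite ler_wpM2r.
have -> : 2 * A / eta = 2 * (A / eta) by rewrite mulrA.
move: (A / eta) reg' => Ae reg'.
lra.
Qed.

End MirrorDescent.

(** * Tuning of the parameters *)

(* In terms of the square roots [a], [b], [c], [l], [e] of n, T, s, ln d and the
   number of rounds, all tuning parameters are monomials. *)
Section ParameterArithmetic.
Context {R : realType}.

Lemma ler_sqr_bound (x y : R) : 0 <= y -> x ^+ 2 <= y ^+ 2 -> x <= y.
Proof.
move=> y0 xy; have [x0|x0] := leP 0 x; first by rewrite -ler_sqr ?nnegrE.
by apply: le_trans y0; exact: ltW.
Qed.

Let gamma_arith (q D h t : R) : 0 <= D * h -> D * h * q <= D * h * (1 / 256) ->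
  D * h + (768 * t * D + 768 * q * (D * h)) <= 768 * (t + h) * D.
Proof. by move=> *; lra. Qed.

Context (a b c l e B H sigma Q K : R).
Hypotheses (a1 : 1 <= a) (b0 : 0 < b) (c1 : 1 <= c) (l1 : 1 <= l) (e0 : 0 < e)
  (B0 : 0 < B) (H0 : 0 < H) (sigma0 : 0 <= sigma) (Q0 : 0 <= Q) (K0 : 0 < K)
  (Qb : Q ^+ 2 * b = (1 + H) * c) (n_le : a ^+ 2 <= (1 + H) * (c * b))
  (n_ge : (1 + H) * (c * b) <= 2 * a ^+ 2) (r_ge : b ^+ 2 <= 4 * a ^+ 2 * e ^+ 2)
  (n_large : 256 * (c ^+ 2 * l) <= a).

Let a0 : 0 < a. Proof. exact: lt_le_trans a1. Qed.
Let c0 : 0 < c. Proof. exact: lt_le_trans c1. Qed.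
Let l0 : 0 < l. Proof. exact: lt_le_trans l1. Qed.

(** [Q] stands for the target rate ((1+H)^2 s/T)^(1/4), and [Qb] encodes it without fourth roots.
    The bound says sqrt(n/T) <= Q. *)
Let ab : a / b <= Q.
Proof.
apply: ler_sqr_bound => //; rewrite exprMn exprVn ler_pdivrMr ?exprn_gt0//.
apply: le_trans n_le _; have -> : Q ^+ 2 * b ^+ 2 = Q ^+ 2 * b * b by ring.
by rewrite Qb mulrA.
Qed.

Let be : b <= 2 * a * e.
Proof.
apply: ler_sqr_bound; first by rewrite !mulr_ge0// ltW.
by apply: le_trans r_ge _; rewrite !exprMn -natrX.
Qed.

Let delta : R := c * l / a.

Let delta0 : 0 < delta. Proof. by rewrite divr_gt0// mulr_gt0. Qed.

Let deltaH : (1 + H) * delta <= 2 * (l * Q).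
Proof.
have h : (1 + H) * c <= 2 * a * Q.
  apply: ler_sqr_bound; first by rewrite !mulr_ge0// ltW.
  rewrite -(ler_pM2r b0).
  have -> : (2 * a * Q) ^+ 2 * b = 4 * a ^+ 2 * (Q ^+ 2 * b) by ring.
  rewrite Qb; have -> : ((1 + H) * c) ^+ 2 * b = (1 + H) * (c * b) * ((1 + H) * c) by ring.
  have p : 0 <= (1 + H) * c by rewrite mulr_ge0 ?addr_ge0 ?ltW.
  apply: ler_wpM2r => //; apply: le_trans n_ge _.
  by have := sqr_ge0 a; lra.
have -> : (1 + H) * delta = (1 + H) * c * l / a by rewrite /delta; ring.
rewrite ler_pdivrMr//; have -> : 2 * (l * Q) * a = 2 * a * Q * l by ring.
by rewrite ler_pM2r.
Qed.

Let delta_small : c ^+ 2 * l / a <= 1 / 256.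
Proof. by rewrite ler_pdivrMr//; have h := n_large; lra. Qed.

(** 768 = 4 * 24 * 8, from the coherence level, the Lasso error and the factor in lambda. The noise
    part reproduces delta because delta = c l / a; the bias part is damped by s times the
    coherence. *)
Lemma gamma_le :
  delta * H + 4 * (l / a) * (24 * c ^+ 2 * (8 * (delta^-1 * sigma * (l / a) + delta * H)))
  <= 768 * (sigma + H) * delta.
Proof.
have -> : 4 * (l / a) * (24 * c ^+ 2 * (8 * (delta^-1 * sigma * (l / a) + delta * H))) =
    768 * sigma * delta + 768 * (c ^+ 2 * l / a) * (delta * H).
  by rewrite /delta; field; rewrite !gt_eqF.
have dH : 0 <= delta * H by rewrite mulr_ge0// ltW.
exact: (gamma_arith sigma dH (ler_wpM2l dH delta_small)).
Qed.

(** This lemma and the next four bound the summands of [optimality_gap_sum] per round, e^2 being the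
    number of rounds. All are multiples of B l Q, except the part of the bias term carrying H^2,
    which is of order 1/b = T^(-1/2). *)
Lemma initial_term :
  (e ^+ 2)^-1 * (2 * (l ^+ 2 * B ^+ 2) / (B * (a * l / b))) <= 8 * (B * l * Q).
Proof.
have -> : (e ^+ 2)^-1 * (2 * (l ^+ 2 * B ^+ 2) / (B * (a * l / b))) =
    2 * B * l * (b / (a * e ^+ 2)) by field; rewrite !gt_eqF.
have h : b / (a * e ^+ 2) <= 4 * Q.
  apply: (@le_trans _ _ (4 * (a / b))); last by rewrite ler_pM2l.
  rewrite ler_pdivrMr ?mulr_gt0 ?exprn_gt0//.
  have -> : 4 * (a / b) * (a * e ^+ 2) = 4 * a ^+ 2 * e ^+ 2 / b by ring.
  by rewrite ler_pdivlMr// -expr2.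
have p : 0 <= 2 * B * l by rewrite !mulr_ge0// ltW.
by have := ler_wpM2l p h; lra.
Qed.

Lemma noise_term :
  3 * K * (B * (a * l / b)) / 2 * (2 * sigma * (l / a) / delta) ^+ 2
  <= 6 * K * (sigma ^+ 2 / c ^+ 2) * (B * l * Q).
Proof.
have -> : 3 * K * (B * (a * l / b)) / 2 * (2 * sigma * (l / a) / delta) ^+ 2 =
    6 * K * (sigma ^+ 2 / c ^+ 2) * (B * l * (a / b)).
  by rewrite /delta; field; rewrite !gt_eqF.
apply: ler_wpM2l; last by rewrite ler_pM2l// mulr_gt0.
by rewrite !mulr_ge0 ?invr_ge0 ?sqr_ge0// ltW.
Qed.

Lemma bias_term :
  3 * K * (B * (a * l / b)) / 2 * (768 * (sigma + H) * delta) ^+ 2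
  <= 3 * K * 768 ^+ 2 * (sigma ^+ 2 / c ^+ 2) * (B * l * Q)
     + 3 * K * 768 ^+ 2 * (B * H ^+ 2 * c ^+ 2 * (l ^+ 2) ^+ 2) / b.
Proof.
set k := 3 * K * 768 ^+ 2.
have k0 : 0 <= k.
  by rewrite /k; apply: mulr_ge0; [apply: mulr_ge0 => //; exact: ltW | exact: sqr_ge0].
set et := B * (a * l / b); have et0 : 0 <= et by rewrite !mulr_ge0 ?invr_ge0// ltW.
have split : 3 * K * et / 2 * (768 * (sigma + H) * delta) ^+ 2 <=
    k * (et * (sigma ^+ 2 * delta ^+ 2)) + k * (et * (H ^+ 2 * delta ^+ 2)).
  have := mulr_ge0 (mulr_ge0 k0 et0) (mulr_ge0 (sqr_ge0 delta) (sqr_ge0 (sigma - H))).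
  by rewrite /k; move: et et0 (delta) => E _ D; lra.
apply: (le_trans split); apply: lerD.
  have sd : sigma ^+ 2 * delta ^+ 2 <= sigma ^+ 2 / c ^+ 2.
    rewrite ler_wpM2l ?sqr_ge0// -[leRHS]mul1r ler_pdivlMr ?exprn_gt0//.
    have -> : delta ^+ 2 * c ^+ 2 = (c ^+ 2 * l / a) ^+ 2 by rewrite /delta; ring.
    have p : 0 <= c ^+ 2 * l / a by rewrite !mulr_ge0 ?invr_ge0// ltW.
    by have := delta_small; move: (_ / a) p => q p; nra.
  have eQ : et <= B * l * Q.
    rewrite /et; have -> : B * (a * l / b) = B * l * (a / b) by ring.
    by rewrite ler_pM2l// mulr_gt0.
  rewrite -mulrA; apply: ler_wpM2l => //; rewrite mulrC; apply: ler_pM => //.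
  by rewrite mulr_ge0 ?sqr_ge0.
rewrite -mulrA; apply: ler_wpM2l => //.
have -> : et * (H ^+ 2 * delta ^+ 2) = B * H ^+ 2 * c ^+ 2 * l ^+ 3 / a / b.
  by rewrite /et /delta; field; rewrite !gt_eqF.
rewrite ler_pM2r ?invr_gt0//.
have h : l ^+ 3 <= (l ^+ 2) ^+ 2 * a.
  have -> : (l ^+ 2) ^+ 2 * a = l ^+ 3 * (l * a) by ring.
  by rewrite ler_peMr ?exprn_ge0 ?(ltW l0)// mulr_ege1.
rewrite ler_pdivrMr// -[leRHS]mulrA; apply: ler_wpM2l h.
by rewrite !mulr_ge0 ?sqr_ge0// ltW.
Qed.

Lemma drift_term :
  4 * B * (768 * (sigma + H) * delta) <= 6144 * (1 + sigma) * (B * l * Q).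
Proof.
have s1 : (sigma + H) * delta <= (1 + sigma) * (2 * (l * Q)).
  apply: (@le_trans _ _ ((1 + sigma) * ((1 + H) * delta))).
    rewrite mulrA ler_pM2r//; have := mulr_ge0 sigma0 (ltW H0); lra.
  by rewrite ler_wpM2l// addr_ge0.
have p : 0 <= 3072 * B by rewrite mulr_ge0 ?ler0n ?ltW.
by have := ler_wpM2l p s1; move: (delta) => D; lra.
Qed.

Lemma martingale_term :
  (e ^+ 2)^-1 * (2 * (2 * sigma * B * e / c)) <= 8 * sigma * (B * l * Q).
Proof.
have -> : (e ^+ 2)^-1 * (2 * (2 * sigma * B * e / c)) = 4 * sigma * B * (e^-1 / c).
  by field; rewrite !gt_eqF.
have h : e^-1 / c <= 2 * (l * Q).
  apply: (@le_trans _ _ e^-1); first by rewrite ler_pdivrMr// ler_peMr// invr_ge0 ltW.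
  apply: (@le_trans _ _ (2 * (a / b))).
    rewrite -[leLHS]mul1r ler_pdivrMr//.
    have -> : 2 * (a / b) * e = 2 * a * e / b by ring.
    by rewrite ler_pdivlMr// mul1r.
  rewrite ler_pM2l//; apply: le_trans ab _; exact: ler_peMl.
have p : 0 <= 4 * sigma * B by rewrite !mulr_ge0// ltW.
by have := ler_wpM2l p h; lra.
Qed.

Let inv_sqr_a : (a ^+ 2)^-1 * ((1 + H) * (c * b)) <= 2.
Proof. by rewrite mulrC ler_pdivrMr ?exprn_gt0. Qed.

(** The exploration costs delta rho and delta^2 are of order 1/n, and n >= (1+H) sqrt(sT) / 2
    absorbs the factor H. *)
Let H_over_n (q : R) : 0 <= q -> H * (c * q) / a ^+ 2 <= 2 * q / b.
Proof.
move=> q0; rewrite ler_pdivlMr//.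
have -> : H * (c * q) / a ^+ 2 * b = q * ((a ^+ 2)^-1 * (H * (c * b))) by ring.
rewrite [2 * q]mulrC ler_wpM2l//; apply: le_trans inv_sqr_a.
rewrite ler_pM2l ?invr_gt0 ?exprn_gt0// ler_pM2r ?mulr_gt0//; lra.
Qed.

Lemma exploration_linear_term : delta * H * (4 * (l / a)) <= 8 * l ^+ 2 / b.
Proof.
have -> : delta * H * (4 * (l / a)) = H * (c * (4 * l ^+ 2)) / a ^+ 2.
  by rewrite /delta; field; rewrite !gt_eqF.
apply: le_trans (H_over_n _) _; first by rewrite mulr_ge0 ?sqr_ge0.
by rewrite ler_pM2r ?invr_gt0//; lra.
Qed.

Lemma exploration_quadratic_term : H * delta ^+ 2 <= 2 * (c ^+ 2 * l ^+ 2) / b.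
Proof.
have -> : H * delta ^+ 2 = H * (c * (c * l ^+ 2)) / a ^+ 2.
  by rewrite /delta; field; rewrite !gt_eqF.
apply: le_trans (H_over_n _) _; first by rewrite mulr_ge0 ?sqr_ge0// ltW.
rewrite ler_pM2r ?invr_gt0// ler_pM2l// ler_pM2r ?exprn_gt0//.
by rewrite expr2 ler_peMr// ltW.
Qed.

End ParameterArithmetic.

(** * Consequences of the lower bound on T *)

Section Tuning.
Context {R : realType}.

(** A square, because T enters through its square root. The root 36 K^2 is dictated by the step size
    and also exceeds 2 * 256^2, as a large batch requires. *)
Definition horizon_const : R := (36 * bregman_const ^+ 2) ^+ 2.

Let bregman_const_ge : 816 <= bregman_const :> R.
Proof.
rewrite /bregman_const -[leLHS]mulr1; apply: ler_wpM2l; first by rewrite ler0n.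
by apply: le_trans (expR_ge1Dx 1); rewrite lerDl.
Qed.

Lemma horizon_root_ge : 2 * 256 ^+ 2 <= 36 * bregman_const ^+ 2 :> R.
Proof.
have := bregman_const_ge; move: bregman_const => K h.
have K0 : 0 <= K by lra.
have K2 := ler_wpM2r K0 h.
by rewrite [K ^+ 2]expr2; move: (K * K) K2 => q K2; lra.
Qed.

Let horizon_const_ge : expR 2 <= horizon_const.
Proof.
have E : expR 1 <= 36 * bregman_const ^+ 2 :> R.
  have : 1 <= expR 1 :> R by apply: le_trans (expR_ge1Dx 1); rewrite lerDl.
  rewrite /bregman_const; move: (expR 1) => q q1.
  have q2 : q <= q ^+ 2 by rewrite expr2 ler_peMr//; lra.
  by rewrite exprMn; lra.
have -> : expR 2 = expR 1 ^+ 2 :> R by rewrite -expRM_natl mulr1.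
by rewrite /horizon_const ler_sqr// nnegrE ?expR_ge0// mulr_ge0 ?sqr_ge0// ler0n.
Qed.

(** The bracket is at least 1 and the constant at least e^2, so e^2 <= T <= d. *)
Lemma log_dimension_ge2 (d s T : nat) (B H : R) : 0 < B -> 0 < H -> (1 <= s)%N ->
  horizon_const * (s%:R ^+ 3 * ln d%:R ^+ 2
     + s%:R * (1 + H) ^+ 2 * (1 + B ^+ 4 * H ^+ 4 * ln d%:R ^+ 2)) <= T%:R ->
  (T <= d)%N -> 2 <= ln d%:R :> R.
Proof.
move=> B0 H0 s1 h Td; have Tn : T%:R <= d%:R :> R by rewrite ler_nat.
have C0 : 0 <= horizon_const :> R by exact: sqr_ge0.
have S1 : 1 <= s%:R :> R by rewrite ler1n.
have e2 : expR 2 <= d%:R :> R.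
  apply: le_trans Tn; apply: le_trans h; apply: le_trans horizon_const_ge _.
  rewrite ler_peMr//; move: (s%:R : R) (ln d%:R) S1 => S L S1.
  rewrite -[leLHS]add0r; apply: lerD; first by rewrite mulr_ge0 ?sqr_ge0 ?exprn_ge0//; lra.
  rewrite mulr_ege1//.
    by rewrite mulr_ege1// exprn_ege1//; lra.
  rewrite lerDl; apply: mulr_ge0; last exact: sqr_ge0.
  by rewrite mulr_ge0 ?exprn_ge0// ltW.
by rewrite -ler_expR lnK ?posrE//; exact: lt_le_trans (expR_gt0 _) e2.
Qed.

(** Each expanded summand is a square times S, so its root is a bound of the form q sqrt(S) <=
    sqrt(T). *)
Lemma horizon_split (c0 S L B H T : R) : 0 < B -> 0 < H -> 1 <= S ->
  c0 ^+ 2 * (S ^+ 3 * L ^+ 2 + S * (1 + H) ^+ 2 * (1 + B ^+ 4 * H ^+ 4 * L ^+ 2)) <= T ->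
  [/\ (c0 * (S * L)) ^+ 2 * S <= T, (c0 * (1 + H)) ^+ 2 * S <= T &
  (c0 * (1 + H) * (B ^+ 2 * H ^+ 2 * L)) ^+ 2 * S <= T].
Proof.
move=> B0 H0 S1 h.
have S0 : 0 <= S by lra.
have x0 : 0 <= (c0 * (S * L)) ^+ 2 * S by rewrite mulr_ge0 ?sqr_ge0.
have y0 : 0 <= (c0 * (1 + H)) ^+ 2 * S by rewrite mulr_ge0 ?sqr_ge0.
have v0 : 0 <= (c0 * (1 + H) * (B ^+ 2 * H ^+ 2 * L)) ^+ 2 * S.
  by rewrite mulr_ge0 ?sqr_ge0.
have {}h : (c0 * (S * L)) ^+ 2 * S + (c0 * (1 + H)) ^+ 2 * S +
    (c0 * (1 + H) * (B ^+ 2 * H ^+ 2 * L)) ^+ 2 * S <= T.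
  by apply: le_trans h; rewrite le_eqVlt; apply/orP; left; apply/eqP; ring.
move: (_ * S) (_ * S) (_ * S) h x0 y0 v0 => X Y V h x0 y0 v0.
by split; lra.
Qed.

Context (c0 K S L B H b c l : R) (T n : nat).
Hypotheses (B0 : 0 < B) (H0 : 0 < H) (K0 : 0 < K) (S1 : 1 <= S) (L2 : 2 <= L)
  (c0_large : 2 * 256 ^+ 2 <= c0) (c0K : c0 = 36 * K ^+ 2) (b0 : 0 < b)
  (b2 : b ^+ 2 = T%:R) (c1 : 1 <= c) (c2 : c ^+ 2 = S) (l1 : 1 <= l) (l2 : l ^+ 2 = L)
  (T_large : c0 ^+ 2 * (S ^+ 3 * L ^+ 2
     + S * (1 + H) ^+ 2 * (1 + B ^+ 4 * H ^+ 4 * L ^+ 2)) <= T%:R)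
  (nE : n = Num.truncn ((1 + H) * (c * b))).

Let c0_ge2 : 2 <= c0.
Proof. by have h := c0_large; lra. Qed.

Let c0_ge0 : 0 <= c0.
Proof. by have h := c0_ge2; lra. Qed.

Let S0 : 0 <= S. Proof. by have h := S1; lra. Qed.

Let b_ge (q : R) : 0 <= q -> q ^+ 2 * S <= T%:R -> q * c <= b.
Proof.
move=> q0 qT; apply: ler_sqr_bound; first exact: ltW.
by rewrite exprMn c2 b2.
Qed.

Let w_ge : c0 * (S ^+ 2 * L) <= c * b.
Proof.
have [h _ _] := horizon_split B0 H0 S1 T_large.
have p : 0 <= c0 * (S * L).
  by rewrite !mulr_ge0//; have h' := L2; lra.
have cc : 0 <= c by apply: le_trans c1.
apply: le_trans (ler_wpM2l cc (b_ge p h)).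
by rewrite le_eqVlt; apply/orP; left; apply/eqP; rewrite -c2; ring.
Qed.

Let w2 : 2 <= c * b.
Proof.
apply: le_trans w_ge; apply: le_trans c0_ge2 _.
rewrite ler_peMr// mulr_ege1//; first by rewrite exprn_ege1.
by have h := L2; lra.
Qed.

Let y_ge : c * b <= (1 + H) * (c * b).
Proof.
by rewrite ler_peMl// ?lerDl ?(ltW H0)//; apply: le_trans w2.
Qed.

Let y_ge0 : 0 <= (1 + H) * (c * b).
Proof. by apply: le_trans y_ge; apply: le_trans w2. Qed.

Lemma batch_le : n%:R <= (1 + H) * (c * b).
Proof. by have /andP[] := truncn_itv y_ge0; rewrite -nE. Qed.

Lemma batch_ge : (1 + H) * (c * b) <= 2 * n%:R.
Proof.
have /andP[_] := truncn_itv y_ge0; rewrite -nE -[_.+1%:R]natr1.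
have := le_trans w2 y_ge; move: (_ * (c * b)) (n%:R) => Y N; lra.
Qed.

Lemma batch_gt0 : (0 < n)%N.
Proof.
rewrite -(ltr_nat R); have := batch_ge; have := le_trans w2 y_ge.
move: (_ * (c * b)) (n%:R) => Y N; lra.
Qed.

Lemma two_batches_le : (2 * n <= T)%N.
Proof.
rewrite -(ler_nat R) natrM -b2.
have [_ h _] := horizon_split B0 H0 S1 T_large.
have H1 : 0 <= 1 + H by have h' := H0; lra.
have hb := b_ge (mulr_ge0 c0_ge0 H1) h.
apply: (@le_trans _ _ (c0 * (1 + H) * c * b)); last first.
  by rewrite expr2 ler_pM2r.
have := ler_wpM2l y_ge0 c0_ge2; have := batch_le.
move: (n%:R) => N; lra.
Qed.

Lemma rounds_gt0 : (0 < T %/ (2 * n))%N.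
Proof. by rewrite divn_gt0 ?two_batches_le// muln_gt0 batch_gt0. Qed.

Lemma rounds_ge : T%:R <= 4 * n%:R * (T %/ (2 * n))%:R :> R.
Proof.
rewrite -!natrM ler_nat.
have n2 : (0 < 2 * n)%N by rewrite muln_gt0 batch_gt0.
apply: leq_trans (ltnW (ltn_ceil T n2)) _.
have := rounds_gt0; move: (T %/ (2 * n))%N => r r0.
rewrite (_ : 4 * n * r = (2 * r) * (2 * n))%N; last by rewrite [RHS]mulnACA (mulnC r) mulnA.
by rewrite leq_mul// mul2n -addnn -[in leqLHS]addn1 leq_add2l.
Qed.

Lemma batch_large : 256 * (S * l) <= Num.sqrt n%:R.
Proof.
apply: ler_sqr_bound; first exact: sqrtr_ge0.
rewrite sqr_sqrtr ?ler0n//.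
have p : 0 <= S ^+ 2 * L by rewrite mulr_ge0 ?sqr_ge0//; have h := L2; lra.
have -> : (256 * (S * l)) ^+ 2 = 256 ^+ 2 * (S ^+ 2 * L) by rewrite -l2; ring.
have G (k q Y w N : R) : 2 * 256 ^+ 2 * q <= k * q -> k * q <= w -> w <= Y ->
    Y <= 2 * N -> 256 ^+ 2 * q <= N by lra.
exact: G (ler_wpM2r p c0_large) w_ge y_ge batch_ge.
Qed.

(** After squaring, the left side is 9 K^2 B^2 H^2 L n / T. Inserting n <= (1+H) c b and the third
    bound of [horizon_split] leaves 9 K^2 / c0 = 1/4, the origin of the factor 36. *)
Lemma step_size_small :
  3 * K * (B * (Num.sqrt n%:R * l / b)) * H <= 1 / 2.
Proof.
have [_ _ h] := horizon_split B0 H0 S1 T_large.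
have : Num.sqrt n%:R ^+ 2 = n%:R :> R by rewrite sqr_sqrtr.
move: (Num.sqrt n%:R) => a a2.
have q0 : 0 <= B ^+ 2 * H ^+ 2 * L.
  by rewrite -l2 mulr_ge0 ?sqr_ge0// mulr_ge0 ?sqr_ge0.
have H1 : 0 <= 1 + H by have h' := H0; lra.
have hb := b_ge (mulr_ge0 (mulr_ge0 c0_ge0 H1) q0) h.
apply: ler_sqr_bound; first by rewrite divr_ge0.
have -> : (3 * K * (B * (a * l / b)) * H) ^+ 2 =
    9 * K ^+ 2 * (B ^+ 2 * H ^+ 2 * L * a ^+ 2) / b ^+ 2.
  by rewrite -l2; field; rewrite gt_eqF.
rewrite ler_pdivrMr ?exprn_gt0//.
have hn := ler_wpM2l q0 batch_le; rewrite -a2 in hn.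
have K9 : 0 <= 9 * K ^+ 2 by rewrite mulr_ge0 ?sqr_ge0.
apply: le_trans (ler_wpM2l K9 hn) _.
have := ler_wpM2r (ltW b0) hb; rewrite c0K -expr2.
have -> : 36 * K ^+ 2 * (1 + H) * (B ^+ 2 * H ^+ 2 * L) * c * b =
    4 * (9 * K ^+ 2 * (B ^+ 2 * H ^+ 2 * L * ((1 + H) * (c * b)))) by ring.
move: (9 * K ^+ 2 * _) (b ^+ 2) => A Z; lra.
Qed.

End Tuning.

(** 6160 = 8 + 6144 + 8 collects the initial, drift and martingale terms; the multiples of
    [bregman_const] come from noise and bias. *)
Definition regret_const {R : realType} : R :=
  6160 + (6 + 3 * 768 ^+ 2) * bregman_const.

Definition lower_order {R : realType} (s H B L : R) : R :=
  8 * L + 2 * (s * L) + 3 * bregman_const * 768 ^+ 2 * (B * H ^+ 2 * s * L ^+ 2).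

(** * The regret bound for a fixed outcome *)

Section RegretOnEvent.
Context {R : realType} (d s T n m r : nat) (B H sigma eta delta lambda : R)
  (f : 'rV[R]_d -> R) (xs : 'rV[R]_d).
Hypotheses (B0 : 0 < B) (H0 : 0 < H) (sigma0 : 0 <= sigma) (s1 : (1 <= s)%N)
  (cf : convex_objective f) (gf : sparse_gradient f s H) (hf : bounded_hessian f H)
  (T_large : horizon_const * (s%:R ^+ 3 * ln d%:R ^+ 2
     + s%:R * (1 + H) ^+ 2 * (1 + B ^+ 4 * H ^+ 4 * ln d%:R ^+ 2)) <= T%:R)
  (Td : (T <= d)%N) (fmin : forall y, f xs <= f y) (xsB : l1norm xs <= B).
Hypotheses (nE : n = Num.truncn ((1 + H) * Num.sqrt (s%:R * T%:R)))
  (etaE : eta = B * Num.sqrt (n%:R * ln d%:R / T%:R))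
  (deltaE : delta = Num.sqrt (s%:R * ln d%:R / n%:R))
  (lambdaE : lambda = 8 * (delta^-1 * sigma * Num.sqrt (ln d%:R / n%:R) + delta * H))
  (mE : m = (2 * n)%N) (rE : r = (T %/ (2 * n))%N).

Context (z : 'I_r -> 'I_m -> {ffun 'I_d -> bool}) (xi : 'I_r -> 'I_m -> R)
  (x : nat -> 'rV[R]_d) (ghat : 'I_r -> 'rV[R]_d) (muhat : 'I_r -> R).

Let Y (t : 'I_r) : 'rV[R]_m :=
  \row_i ((f (x t + delta *: signs R (z t i)) + xi t i) / delta).

Hypotheses (x00 : x 0%N = 0)
  (lasso : forall t : 'I_r, lasso_solution (sign_design (z t)) (Y t) lambda (ghat t) (muhat t))
  (step : forall t : 'I_r, mirror_step (psi (psi_exponent d)) B eta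
     (debiased (sign_design (z t)) (Y t) (ghat t) (muhat t)) (x t) (x t.+1)).

Hypotheses
  (design_incoherent : forall (t : 'I_r) (p q : option 'I_d), p != q ->
     `|gram (@regressor R _ _ (z t)) p q| <= 4 * Num.sqrt (ln d%:R / n%:R))
  (noise_small : forall (t : 'I_r) p,
     `|m%:R^-1 * \sum_i regressor (z t) i p * xi t i| <= 2 * sigma * Num.sqrt (ln d%:R / n%:R))
  (martingale_small :
     \sum_(t < r) \sum_i (- dotv (signs R (z t i)) (x t - xs)) * xi t i <=
     Num.sqrt (2 * ln d%:R) * Num.sqrt (sigma ^+ 2 * (2 * B) ^+ 2 * (r * m)%:R)).

Let noise (t : 'I_r) : 'rV[R]_d :=
  \row_j ((m%:R^-1 * \sum_i sign_design (z t) i j * xi t i) / delta).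

Let sum_noise : 0 < delta -> - \sum_t dotv (noise t) (x t - xs) =
  (m%:R * delta)^-1 *
  \sum_(t < r) \sum_i (- dotv (signs R (z t i)) (x t - xs)) * xi t i.
Proof.
move=> d0; rewrite mulr_sumr -sumrN; apply: eq_bigr => t _.
rewrite /dotv -sumrN mulr_sumr.
under [RHS]eq_bigr do rewrite -sumrN mulr_suml mulr_sumr.
rewrite exchange_big; apply: eq_bigr => j _ /=.
rewrite mxE invfM mulr_sumr !mulr_suml -sumrN; apply: eq_bigr => i _.
by rewrite [sign_design _ _ _]mxE; ring.
Qed.

(** Here U = B l Q, V = sigma, W = sigma^2 / s and b' = T^(-1/2); as variables they leave an
    inequality linear in a few products. *)
Let total (A U V W K M1 L S BH b' I1 I2 I3 I4 I5 I6 I7 : R) :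
  0 <= U -> 0 <= V -> 0 <= W -> 0 <= K -> 0 <= M1 ->
  I1 <= 8 * U -> I2 <= 6 * K * W * U -> I3 <= 3 * K * M1 * W * U + 3 * K * M1 * BH * b' ->
  I4 <= 6144 * (1 + V) * U -> I5 <= 8 * V * U -> I6 <= 8 * L * b' -> I7 <= 2 * S * b' ->
  A <= I1 + (I2 + I3) + I4 + I5 ->
  A + I6 + I7 <= (6160 + (6 + 3 * M1) * K) * (1 + V + W) * U
    + (8 * L + 2 * S + 3 * K * M1 * BH) * b'.
Proof.
move=> U0 V0 W0 K0 M0 h1 h2 h3 h4 h5 h6 h7 hA.
have KU : 0 <= K * U by rewrite mulr_ge0.
have KMU : 0 <= K * M1 * U by rewrite !mulr_ge0.
have VU := mulr_ge0 V0 U0; have WU := mulr_ge0 W0 U0.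
have a1 := mulr_ge0 V0 KU; have a2 := mulr_ge0 V0 KMU.
have := mulr_ge0 W0 KU; have := mulr_ge0 W0 KMU.
lra.
Qed.

Lemma regret_on_event :
  (r * m)%:R^-1 * (\sum_(t < r) \sum_i f (x t + delta *: signs R (z t i))) - f xs <=
  regret_const * (1 + sigma + sigma ^+ 2 / s%:R) * B * Num.sqrt (ln d%:R)
    * ((1 + H) ^+ 2 * s%:R / T%:R) `^ 4^-1
  + lower_order s%:R H B (ln d%:R) * T%:R `^ (- 2^-1).
Proof.
have L2 := log_dimension_ge2 B0 H0 s1 T_large Td.
have L0 : 0 < ln d%:R :> R by lra.
have S1 : 1 <= s%:R :> R by rewrite ler1n.
have S0 : 0 < s%:R :> R by lra.
have T0 : 0 < T%:R :> R.
  apply: lt_le_trans T_large; rewrite mulr_gt0 ?exprn_gt0//.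
    by rewrite mulr_gt0 ?ltr0n// exprn_gt0// bregman_const_gt0.
  rewrite ltr_pwDl ?mulr_gt0 ?exprn_gt0//.
  apply: mulr_ge0; first by rewrite mulr_ge0 ?sqr_ge0 ?ltW.
  by rewrite addr_ge0// !mulr_ge0 ?exprn_ge0 ?ltW.
have [b bE] : exists b, b = Num.sqrt T%:R :> R by eexists.
have [c cE] : exists c, c = Num.sqrt s%:R :> R by eexists.
have [l lE] : exists l, l = Num.sqrt (ln d%:R) :> R by eexists.
have [a aE] : exists a, a = Num.sqrt n%:R :> R by eexists.
have [e eE] : exists e, e = Num.sqrt r%:R :> R by eexists.
have b2 : b ^+ 2 = T%:R by rewrite bE sqr_sqrtr// ltW.
have c2 : c ^+ 2 = s%:R by rewrite cE sqr_sqrtr// ltW.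
have l2 : l ^+ 2 = ln d%:R by rewrite lE sqr_sqrtr// ltW.
have a2 : a ^+ 2 = n%:R by rewrite aE sqr_sqrtr.
have e2 : e ^+ 2 = r%:R by rewrite eE sqr_sqrtr.
have b0 : 0 < b by rewrite bE sqrtr_gt0.
have c1 : 1 <= c by rewrite cE -[leLHS]sqrtr1 ler_wsqrtr.
have l1 : 1 <= l by rewrite lE -[leLHS]sqrtr1 ler_wsqrtr//; lra.
have c0 : 0 < c by lra.
have l0 : 0 < l by lra.
have K0 := @bregman_const_gt0 R.
have nE' : n = Num.truncn ((1 + H) * (c * b)) by rewrite nE cE bE sqrtrM// ltW.
have n0 := batch_gt0 B0 H0 S1 L2 horizon_root_ge b0 b2 c1 c2 T_large nE'.
have n_le := batch_le B0 H0 S1 L2 horizon_root_ge b0 b2 c1 c2 T_large nE'.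
have n_ge := batch_ge B0 H0 S1 L2 horizon_root_ge b0 b2 c1 c2 T_large nE'.
have r0 := rounds_gt0 B0 H0 S1 L2 horizon_root_ge b0 b2 c1 c2 T_large nE'.
have r_ge := rounds_ge B0 H0 S1 L2 horizon_root_ge b0 b2 c1 c2 T_large nE'.
have n_large := batch_large B0 H0 S1 L2 horizon_root_ge b0 b2 c1 c2 l2 T_large nE'.
have small := step_size_small B0 H0 S1 L2 horizon_root_ge (erefl _) b0 b2 c1 c2
  l2 T_large nE'.
rewrite -aE in n_large small; rewrite -rE in r0 r_ge.
rewrite -a2 in n_le n_ge; rewrite -c2 in n_large; rewrite -b2 -a2 -e2 in r_ge.
have a1 : 1 <= a by rewrite aE -[leLHS]sqrtr1 ler_wsqrtr// ler1n.
have a0 : 0 < a by lra.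
have e0 : 0 < e by rewrite eE sqrtr_gt0 ltr0n.
have uE : Num.sqrt (ln d%:R / n%:R) = l / a.
  by rewrite sqrtrM ?(ltW L0)// sqrtrV// lE aE.
have etaE' : eta = B * (a * l / b).
  have nL : 0 <= n%:R * ln d%:R :> R by rewrite mulr_ge0// ltW.
  rewrite etaE (sqrtrM _ nL) (sqrtrM _ (ler0n _ n)) (sqrtrV (ltW T0)).
  by rewrite aE lE bE.
have deltaE' : delta = c * l / a.
  have sL : 0 <= s%:R * ln d%:R :> R by rewrite mulr_ge0// ltW.
  rewrite deltaE (sqrtrM _ sL) (sqrtrM _ (ltW S0)) (sqrtrV (ler0n _ n)).
  by rewrite aE lE cE.
have m2 : m%:R = 2 * a ^+ 2 :> R by rewrite mE natrM a2.
have m0 : (0 < m)%N by rewrite mE muln_gt0 n0.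
have [Q QE] : exists Q, Q = ((1 + H) ^+ 2 * s%:R / T%:R) `^ 4^-1 by eexists.
have Q0 : 0 <= Q by rewrite QE powR_ge0.
have Qb : Q ^+ 2 * b = (1 + H) * c.
  have v0 : 0 <= (1 + H) * c / b by rewrite divr_ge0 ?mulr_ge0 ?addr_ge0// ltW.
  have -> : Q = Num.sqrt ((1 + H) * c / b).
    rewrite QE -c2 -b2 -powR12_sqrt//.
    have -> : (1 + H) ^+ 2 * c ^+ 2 / b ^+ 2 = ((1 + H) * c / b) `^ 2%:R.
      by rewrite powR_mulrn// !exprMn exprVn.
    by rewrite -powRrM; congr (_ `^ _); field.
  by rewrite sqr_sqrtr// mulfVK ?gt_eqF.
have delta0 : 0 < delta by rewrite deltaE' divr_gt0 ?mulr_gt0.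
have eta0 : 0 < eta by rewrite etaE' mulr_gt0// divr_gt0// mulr_gt0.
have rho0 : 0 <= 4 * (l / a) by rewrite mulr_ge0// divr_ge0// ltW.
have design_bound := design_incoherent; have noise_bound := noise_small.
have lambdaE' := lambdaE; rewrite uE in design_bound noise_bound lambdaE'.
have dH0 : 0 < delta * H by rewrite mulr_gt0.
have noise_rate : 0 <= 2 * sigma * (l / a).
  by rewrite !mulr_ge0// ?invr_ge0 ltW.
have lambda0 : 0 < lambda.
  rewrite lambdaE' mulr_gt0// ltr_wpDl//.
  by rewrite !mulr_ge0 ?invr_ge0// ltW.
have lambda_large : 2 * sigma * (l / a) / delta + delta * H <= lambda / 4.
  have -> : 2 * sigma * (l / a) / delta = 2 * (delta^-1 * sigma * (l / a)) by ring.
  by move: lambdaE' dH0; move: (delta^-1 * _ * _) (delta * H) => A D ->; lra.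
have rho_small : 64 * s%:R * (4 * (l / a)) <= 1.
  rewrite -c2; have -> : 64 * c ^+ 2 * (4 * (l / a)) = 256 * (c ^+ 2 * l) / a by ring.
  by rewrite ler_pdivrMr// mul1r.
have decomp t j : `|debiased (sign_design (z t)) (Y t) (ghat t) (muhat t) 0 j -
    (gradient f (x t) 0 j + noise t 0 j)| <= 768 * (sigma + H) * delta.
  have := round_error s1 cf gf hf delta0 m0 rho0 lambda0 (@lasso t) rho_small
    (@design_bound t) (noise_bound t) lambda_large j.
  rewrite [noise t 0 j]mxE => /le_trans; apply.
  have := gamma_le sigma a1 c1 l1 H0 n_large; rewrite -deltaE'.
  by rewrite lambdaE' c2.
have noise_le t j : `|noise t 0 j| <= 2 * sigma * (l / a) / delta.
  rewrite mxE normrM normfV (gtr0_norm delta0) ler_pM2r ?invr_gt0//.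
  have := noise_bound t (Some j); congr (`|_ * _| <= _).
  by apply: eq_bigr => i _; rewrite -sign_designE.
have mart : - \sum_t dotv (noise t) (x t - xs) <= 2 * sigma * B * e / c.
  rewrite sum_noise//; have md : 0 < (m%:R * delta)^-1.
    by rewrite invr_gt0 mulr_gt0// ltr0n.
  apply: le_trans (ler_wpM2l (ltW md) martingale_small) _.
  have -> : Num.sqrt (2 * ln d%:R) * Num.sqrt (sigma ^+ 2 * (2 * B) ^+ 2 * (r * m)%:R) =
      4 * l * sigma * B * a * e.
    rewrite -sqrtrM ?mulr_ge0 ?(ltW L0)//.
    have -> : 2 * ln d%:R * (sigma ^+ 2 * (2 * B) ^+ 2 * (r * m)%:R) =
        (4 * l * sigma * B * a * e) ^+ 2.
      by rewrite natrM m2 -e2 -l2; ring.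
    by rewrite sqrtr_sqr ger0_norm// !mulr_ge0// ltW.
  rewrite m2 deltaE' le_eqVlt; apply/orP; left; apply/eqP; field.
  by rewrite !gt_eqF.
have gamma0 : 0 <= 768 * (sigma + H) * delta.
  apply: mulr_ge0; last exact: ltW.
  by apply: mulr_ge0; [rewrite ler0n | rewrite addr_ge0// ltW].
have small' : 3 * bregman_const * eta * H <= 1 / 2 by rewrite etaE'.
have gap := optimality_gap_sum L2 eta0 x00 step xsB H0 B0 cf hf fmin gamma0 decomp
  noise_le mart small'.
have rR : 0 < r%:R :> R by rewrite ltr0n.
have query (t : 'I_r) : m%:R^-1 * (\sum_i f (x t + delta *: signs R (z t i))) <=
    f (x t) + delta * H * (4 * (l / a)) + H * delta ^+ 2.
  exact: (query_average cf gf hf (x t) delta0 m0 rho0 (@design_bound t)).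
have avg : (r * m)%:R^-1 * (\sum_(t < r) \sum_i f (x t + delta *: signs R (z t i))) - f xs <=
    r%:R^-1 * (\sum_(t < r) (f (x t) - f xs)) + delta * H * (4 * (l / a)) + H * delta ^+ 2.
  have -> (A : R) : (r * m)%:R^-1 * A = r%:R^-1 * (m%:R^-1 * A).
    by rewrite natrM invfM mulrA.
  rewrite [m%:R^-1 * _]mulr_sumr.
  apply: (@le_trans _ _ (r%:R^-1 * (\sum_(t < r)
      (f (x t) + delta * H * (4 * (l / a)) + H * delta ^+ 2)) - f xs)).
    rewrite lerD2r; apply: ler_wpM2l; first by rewrite invr_ge0.
    by apply: ler_sum => t _; exact: query.
  have mean (C : R) : r%:R^-1 * (\sum_(t < r) C) = C.
    by rewrite sumr_const card_ord -(mulr_natl C r) mulrA mulVf ?gt_eqF// mul1r.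
  rewrite !big_split/= sumrN !mulrDr !mean mulrN mean.
  by move: (_ * \sum_(t < r) _) (_ * (4 * _)) => A C; lra.
apply: (le_trans avg); rewrite powRN powR12_sqrt ?(ltW T0)// -QE -bE -lE -c2 -l2.
have i0 : 0 <= r%:R^-1 :> R by rewrite invr_ge0.
have avg_gap := ler_wpM2l i0 gap.
rewrite etaE' deltaE' -l2 -e2 in avg_gap *.
have VW : 0 <= sigma ^+ 2 / c ^+ 2 by rewrite divr_ge0 ?sqr_ge0.
have M0 : 0 <= 768 ^+ 2 :> R by exact: sqr_ge0.
have U0 : 0 <= B * l * Q by rewrite !mulr_ge0// ltW.
have T1 := initial_term a1 b0 l1 e0 B0 Q0 Qb n_le r_ge.
have T2 := noise_term a1 b0 c1 l1 B0 sigma0 Q0 K0 Qb n_le.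
have T3 := bias_term sigma a1 b0 c1 l1 B0 H0 Q0 K0 Qb n_le n_large.
have T4 := drift_term a1 b0 c1 l1 B0 H0 sigma0 Q0 Qb n_ge.
have T5 := martingale_term a1 b0 c1 l1 e0 B0 sigma0 Q0 Qb n_le r_ge.
have T6 := exploration_linear_term l a1 b0 c1 n_ge.
have T7 := exploration_quadratic_term a1 b0 c1 l1 n_ge.
apply: (le_trans (total U0 sigma0 VW (ltW K0) M0 T1 T2 T3 T4 T5 T6 T7 _)); last first.
  rewrite /regret_const /lower_order le_eqVlt; apply/orP; left; apply/eqP.
  move: (768 ^+ 2) (bregman_const) (_ / c ^+ 2) => M1 K1 W.
  by ring.
apply: le_trans avg_gap _; rewrite le_eqVlt; apply/orP; left; apply/eqP.
have e20 : e ^+ 2 != 0 by rewrite gt_eqF// exprn_gt0.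
move: (2 * (_ * _) / _) (3 * _ * _ / 2) (2 * _ * _ / _) (768 * _ * _) (2 * sigma * B * e / c).
move=> q1 q2 q3 q4 q5; field.
by rewrite -sqrf_eq0.
Qed.

End RegretOnEvent.

(** * The good event *)

Section UniformTail.
Context {disp : measure_display} {Omega : measurableType disp} {R : realType}.
Context (P : probability Omega R).

Lemma subgaussianN (v : R) X : subgaussian P v X -> subgaussian P v (fun w => - X w).
Proof.
move=> sX a; have := sX (- a); rewrite sqrrN; apply: le_trans.
rewrite le_eqVlt; apply/orP; left; apply/eqP.
by apply: eq_integral => w _; rewrite mulrN mulNr.
Qed.

Lemma subgaussian0 (v : R) : 0 <= v -> subgaussian P v (fun=> 0).
Proof.
move=> v0 a; under eq_integral do rewrite mulr0 expR0.
rewrite integral_cst// mul1e [X in (X <= _)%E]probability_setT lee_fin -[leLHS]expR0 ler_expR.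
by rewrite divr_ge0// mulr_ge0// sqr_ge0.
Qed.

Lemma measurable_gt (X : Omega -> R) b : measurable_fun setT X ->
  measurable [set w | b < X w].
Proof.
move=> mX; rewrite (_ : [set w | _] = X @^-1` `]b, +oo[); last first.
  by apply/seteqP; split => w /=; rewrite in_itv/= andbT.
by rewrite -[X in measurable X]setTI; exact: (mX measurableT _ (measurable_itv _)).
Qed.

Lemma measure_exists_le (I : finType) (A : I -> set Omega) (p : R) :
  (forall i, measurable (A i)) -> (forall i, (P (A i) <= p%:E)%E) ->
  measurable [set w | exists i, A i w] /\
  (P [set w | exists i, A i w] <= (#|I|%:R * p)%:E)%E.
Proof.
move=> mA PA.
have -> : [set w | exists i, A i w] = \big[setU/set0]_(i <- enum I) A i.
  apply/seteqP; split => w.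
    by move=> [i Ai]; rewrite (big_rem i) ?mem_enum//=; left.
  elim/big_ind: _ => [//|B C IB IC [/IB|/IC]//|i _ Ai]; by exists i.
rewrite cardE; elim: (enum I) => [|i s [mU PU]].
  by rewrite big_nil mul0r measure0.
rewrite big_cons; split; first exact: measurableU.
apply: le_trans (measureU2 _ (mA i) mU) _.
have -> : (size (i :: s))%:R * p = p + (size s)%:R * p.
  by rewrite /= -natr1 mulrDl mul1r addrC.
rewrite EFinD; exact: (leeD (PA i) PU).
Qed.

(** The sign of the deviation is made part of the index, which doubles the number of one-sided
    events. *)
Lemma uniform_tail (I : finType) (S : I -> Omega -> R) (v t : R) :
  (forall i, measurable_fun setT (S i)) -> 0 <= v ->
  (forall i, subgaussian P v (S i)) -> 0 < t ->
  measurable [set w | exists i, t * Num.sqrt v < `|S i w|] /\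
  (P [set w | exists i, (t * Num.sqrt v < `|S i w|)%R] <=
   (2 * #|I|%:R * expR (- t ^+ 2 / 2))%:E)%E.
Proof.
move=> mS v0 sS t0.
pose A (k : I * bool) := [set w | t * Num.sqrt v < (-1) ^+ k.2 * S k.1 w].
have -> : [set w | exists i, t * Num.sqrt v < `|S i w|] = [set w | exists k, A k w].
  apply/seteqP; split => w /= [].
    move=> i; rewrite ltr_normr => /orP[] h; first by exists (i, false); rewrite /A/= mul1r.
    by exists (i, true); rewrite /A/= expr1 mulN1r.
  move=> [i b] /=; rewrite /A/= => h; exists i; apply: lt_le_trans h _.
  by apply: le_trans (ler_norm _) _; rewrite normrM normr_sign mul1r.
have mS' (k : I * bool) : measurable_fun setT (fun w => (-1) ^+ k.2 * S k.1 w).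
  exact: measurable_funM.
have -> : 2 * #|I|%:R = #|{: I * bool}|%:R :> R.
  by rewrite card_prod card_bool natrM mulrC.
apply: measure_exists_le => k; first exact: measurable_gt.
apply: (subgaussian_tail (mS' k) v0 _ t0).
case: k => i [] /=; last first.
  by move=> a; under eq_integral do rewrite mul1r; exact: sS.
by move=> a; under eq_integral do rewrite mulN1r; exact: subgaussianN.
Qed.

End UniformTail.

Lemma measurable_dotv {disp : measure_display} {Omega : measurableType disp}
    {R : realType} d (X Y : Omega -> 'rV[R]_d) :
  (forall j, measurable_fun setT (fun w => X w 0 j)) ->
  (forall j, measurable_fun setT (fun w => Y w 0 j)) ->
  measurable_fun setT (fun w => dotv (X w) (Y w)).
Proof. by move=> mX mY; apply: measurable_sum => j; exact: measurable_funM. Qed.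

Section WeightedSum.
Context {disp : measure_display} {Omega : measurableType disp} {R : realType}.
Context (P : probability Omega R) (I : finType) (G : I -> set (set Omega)).
Hypotheses (G_sigma : forall i, sigma_algebra setT (G i))
  (G_measurable : forall i, G i `<=` measurable)
  (G_indep : mutually_independent P G).

Lemma determined_cst (J : {set I}) (a : R) : determined G J (fun=> a).
Proof. by rewrite /determined; exact: measurable_cst. Qed.

Lemma weighted_sum_subgaussian (J : {set I}) (s : seq I) (c X : I -> Omega -> R) (v L : R) :
  uniq s -> (forall k, k \in s -> k \notin J) -> 0 <= v ->
  (forall k, k \in s -> determined G J (c k)) ->
  (forall k w, k \in s -> `|c k w| <= L) ->
  (forall k, k \in s -> measurable_wrt (G k) (X k)) ->
  (forall k, k \in s -> subgaussian P v (X k)) ->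
  subgaussian P (v * L ^+ 2 * (size s)%:R) (fun w => \sum_(k <- s) c k w * X k w).
Proof.
move=> us sJ v0 mc cL GX sX a.
have W0 (w : Omega) : 0 <= 1 :> R by [].
have m1 := determined_cst (J := J) 1.
have mac k : k \in s -> determined G J (fun w => a * c k w).
  by move=> /mc mck; apply: measurable_funM => //; exact: (determined_cst _).
have aL k w : k \in s -> `|a * c k w| <= `|a| * L.
  by move=> ks; rewrite normrM ler_wpM2l// cL.
have := subgaussian_sum G_sigma G_measurable G_indep us sJ v0 m1 W0 mac aL GX sX.
rewrite integral_cst// mul1e [X in (_ <= _ * X)%E]probability_setT mule1.
have -> : v * (`|a| * L) ^+ 2 / 2 * (size s)%:R = v * L ^+ 2 * (size s)%:R * a ^+ 2 / 2.
  by rewrite exprMn real_normK ?num_real//; ring.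
apply: le_trans; rewrite le_eqVlt; apply/orP; left; apply/eqP.
apply: eq_integral => w _; rewrite mul1r mulr_sumr; congr (expR _)%:E.
by apply: eq_bigr => k _; rewrite mulrA.
Qed.

End WeightedSum.

(* The sources that the algorithm may have used before querying in round [n]:
   all sign vectors are included, since the noise of round [n] is fresh given them. *)
Definition past r m (n : nat) : {set option ('I_r * 'I_m + 'I_r * 'I_m)} :=
  [set k : option ('I_r * 'I_m + 'I_r * 'I_m) |
     if k is Some (inr (t, _)) then (t < n)%N else true]%SET.

(** * Sub-Gaussian sums in the sampling model *)

Section Sampled.
Context {disp : measure_display} {Omega : measurableType disp} {R : realType}.
Context (P : probability Omega R) (d r m : nat) (V : set (set Omega)).
Context (z : 'I_r -> 'I_m -> Omega -> {ffun 'I_d -> bool}).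
Context (xi : 'I_r -> 'I_m -> {RV P >-> R}) (sigma : R).
Hypothesis model : sampling_model V z xi sigma.

Let G := sources V z xi.

Let G_sigma k : sigma_algebra setT (G k).
Proof.
case: k => [[[t i]|[t i]]|] /=; last exact: coins_sigma_algebra model.
  by apply: sigma_algebra_preimage; split.
by apply: sigma_algebra_preimage; exact: sigma_algebra_measurable.
Qed.

Let G_measurable k : G k `<=` measurable.
Proof.
case: k => [[[t i]|[t i]]|] /=; last exact: coins_measurable model.
  exact: (signs_measurable model).
by move=> _ [A mA <-]; exact: (@measurable_funPT _ _ _ _ (xi t i) measurableT A mA).
Qed.

Let G_indep : mutually_independent P G := sources_independent model.

Let signs_wrt t i (h : {ffun 'I_d -> bool} -> R) :
  measurable_wrt (G (Some (inl (t, i)))) (fun w => h (z t i w)).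
Proof.
move=> A mA; rewrite /= /sign_events; exists (h @^-1` A) => //.
by rewrite setTI.
Qed.

Let noise_wrt t i : measurable_wrt (G (Some (inr (t, i)))) (xi t i).
Proof. by move=> A mA; exists A => //; rewrite setTI. Qed.

Let noise_sg t i : subgaussian P (sigma ^+ 2) (xi t i).
Proof.
move=> a; have := noise_subgaussian model t i a.
rewrite /mmt_gen_fun unlock; apply: le_trans; rewrite le_eqVlt; apply/orP; left.
by apply/eqP; apply: eq_integral => w _ /=; rewrite mulrC.
Qed.

Let signs_preimage t i b : measurable (z t i @^-1` [set b]).
Proof.
by apply: (G_measurable (k := Some (inl (t, i)))); exists [set b] => //; rewrite setTI.
Qed.

Lemma coherence_subgaussian t p q : p != q -> subgaussian P (4 * m%:R)
  (fun w => \sum_i augmented_sign (z t i w) p * augmented_sign (z t i w) q).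
Proof.
move=> pq.
(* The value 0 is a default: the sum runs over [s] only. *)
pose X (k : option ('I_r * 'I_m + 'I_r * 'I_m)) (w : Omega) : R :=
  if k is Some (inl (t', i)) then augmented_sign (z t' i w) p * augmented_sign (z t' i w) q
  else 0.
pose s : seq (option ('I_r * 'I_m + 'I_r * 'I_m)) :=
  [seq Some (inl (t, i)) | i <- enum 'I_m].
have us : uniq s by rewrite map_inj_uniq ?enum_uniq// => i j [].
have s0 k : k \in s -> k \notin (finset.set0 : {set option ('I_r * 'I_m + 'I_r * 'I_m)}).
  by rewrite finset.in_set0.
have mc k : k \in s -> determined G finset.set0 (fun=> 1 : R).
  by move=> _; exact: (determined_cst _).
have c1 k (w : Omega) : k \in s -> `|1 : R| <= 1 by rewrite normr1.
have GX k : k \in s -> measurable_wrt (G k) (X k).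
  move=> /mapP[i _ ->].
  exact: (@signs_wrt t i (fun b => augmented_sign b p * augmented_sign b q)).
have sX k : k \in s -> subgaussian P 4 (X k).
  move=> /mapP[i _ ->] /=; apply: sign_product_subgaussian pq; first exact: signs_preimage.
  by move=> b; rewrite (signs_uniform model).
have := weighted_sum_subgaussian G_sigma G_measurable G_indep us s0 (ler0n _ 4) mc c1 GX sX.
rewrite size_map size_enum_ord expr1n mulr1 => h a; have := h a; apply: le_trans.
rewrite le_eqVlt; apply/orP; left; apply/eqP; apply: eq_integral => w _.
rewrite big_map big_enum; congr (expR (_ * _))%:E.
by apply: eq_bigr => i _; rewrite mul1r.
Qed.

(** [J] consists of all sign sources; they determine the coefficients, which have modulus 1, and the
    noise is fresh. *)
Lemma noise_average_subgaussian t p : subgaussian P (sigma ^+ 2 * m%:R)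
  (fun w => \sum_i augmented_sign (z t i w) p * xi t i w).
Proof.
pose X (k : option ('I_r * 'I_m + 'I_r * 'I_m)) (w : Omega) : R :=
  if k is Some (inr (t', i)) then xi t' i w else 0.
pose c (k : option ('I_r * 'I_m + 'I_r * 'I_m)) (w : Omega) : R :=
  if k is Some (inr (t', i)) then augmented_sign (z t' i w) p else 0.
pose s : seq (option ('I_r * 'I_m + 'I_r * 'I_m)) :=
  [seq Some (inr (t, i)) | i <- enum 'I_m].
pose J : {set option ('I_r * 'I_m + 'I_r * 'I_m)} :=
  [set k : option ('I_r * 'I_m + 'I_r * 'I_m) | if k is Some (inl _) then true else false]%SET.
have us : uniq s by rewrite map_inj_uniq ?enum_uniq// => i j [].
have sJ k : k \in s -> k \notin J by move=> /mapP[i _ ->]; rewrite inE.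
have mc k : k \in s -> determined G J (c k).
  move=> /mapP[i _ ->]; apply: (@determined_source _ _ _ _ G _ (Some (inl (t, i)))).
    by rewrite inE.
  exact: (@signs_wrt t i (fun b => augmented_sign b p)).
have c1 k w : k \in s -> `|c k w| <= 1.
  by move=> /mapP[i _ ->] /=; rewrite normr_augmented_sign.
have GX k : k \in s -> measurable_wrt (G k) (X k).
  by move=> /mapP[i _ ->]; exact: (@noise_wrt t i).
have sX k : k \in s -> subgaussian P (sigma ^+ 2) (X k).
  by move=> /mapP[i _ ->] /=; exact: (@noise_sg t i).
have := weighted_sum_subgaussian G_sigma G_measurable G_indep us sJ (sqr_ge0 sigma) mc c1 GX sX.
rewrite size_map size_enum_ord expr1n mulr1 => h a; have := h a; apply: le_trans.
rewrite le_eqVlt; apply/orP; left; apply/eqP; apply: eq_integral => w _.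
by rewrite big_map big_enum.
Qed.

Let history_sub n : history V z xi n `<=` <<s joint G (past r m n) >>.
Proof.
apply: smallest_sub; first exact: smallest_sigma_algebra.
move=> A [VA|[t /= tn [i _] tiA]]; apply: sub_sigma_algebra.
  by exists None => //=; rewrite inE.
case: tiA => [zA|xA]; first by exists (Some (inl (t, i))) => //=; rewrite inE.
by exists (Some (inr (t, i))) => //=; rewrite inE.
Qed.

Section NoiseMartingale.
Context (c : 'I_r -> 'I_m -> Omega -> R) (L : R).
Hypotheses (c_past : forall (t : 'I_r) i, determined G (past r m t) (c t i))
  (c_le : forall t i w, `|c t i w| <= L).

(** Induction over rounds: the exponential of the earlier rounds is the weight in [subgaussian_sum].
    Coefficients of a round may use every sign vector but no noise of that round or later. *)
Lemma martingale_subgaussian : subgaussian P (sigma ^+ 2 * L ^+ 2 * (r * m)%:R)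
  (fun w => \sum_t \sum_i c t i w * xi t i w).
Proof.
move=> a; pose S n w := \sum_(t < r | (t < n)%N) \sum_i c t i w * xi t i w.
have pastS n n' : (n <= n')%N -> past r m n \subset past r m n'.
  move=> nn'; apply/fintype.subsetP => -[[k|[t i]]|]; rewrite !inE//.
  by move=> /leq_trans; apply.
have mS n : determined G (past r m n) (S n).
  rewrite /S; under eq_fun do rewrite big_mkcond.
  apply: measurable_sum => t; case: (boolP (t < n)%N) => tn; last exact: measurable_cst.
  apply: measurable_sum => i; apply: measurable_funM.
    exact: (determinedS (pastS _ _ (ltnW tn)) (@c_past t i)).
  apply: (@determined_source _ _ _ _ G _ (Some (inr (t, i)))); first by rewrite inE.
  exact: (@noise_wrt t i).
suff bound n : (n <= r)%N -> (\int[P]_w (expR (a * S n w))%:E <=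
    (expR (sigma ^+ 2 * L ^+ 2 * (n * m)%:R * a ^+ 2 / 2))%:E)%E.
  have := bound r (leqnn r); apply: le_trans; rewrite le_eqVlt; apply/orP; left.
  apply/eqP; apply: eq_integral => w _; rewrite /S.
  by congr (expR (_ * _))%:E; apply: eq_bigl => t; rewrite ltn_ord.
elim: n => [_|n IH nr].
  under eq_integral do rewrite /S big_pred0// mulr0 expR0.
  by rewrite integral_cst// mul1e [X in (X <= _)%E]probability_setT mul0n mulr0 !mul0r expR0.
have {}IH := IH (ltnW nr); pose t := Ordinal nr.
pose X (k : option ('I_r * 'I_m + 'I_r * 'I_m)) (w : Omega) : R :=
  if k is Some (inr (t', i)) then xi t' i w else 0.
pose C (k : option ('I_r * 'I_m + 'I_r * 'I_m)) (w : Omega) : R :=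
  if k is Some (inr (t', i)) then a * c t' i w else 0.
pose s : seq (option ('I_r * 'I_m + 'I_r * 'I_m)) :=
  [seq Some (inr (t, i)) | i <- enum 'I_m].
have us : uniq s by rewrite map_inj_uniq ?enum_uniq// => i j [].
have sJ k : k \in s -> k \notin past r m n by move=> /mapP[i _ ->]; rewrite inE ltnn.
have mC k : k \in s -> determined G (past r m n) (C k).
  move=> /mapP[i _ ->]; apply: measurable_funM; first exact: (determined_cst _).
  exact: (@c_past t i).
have CL k w : k \in s -> `|C k w| <= `|a| * L.
  by move=> /mapP[i _ ->] /=; rewrite normrM ler_wpM2l.
have GX k : k \in s -> measurable_wrt (G k) (X k).
  by move=> /mapP[i _ ->]; exact: (@noise_wrt t i).
have sX k : k \in s -> subgaussian P (sigma ^+ 2) (X k).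
  by move=> /mapP[i _ ->] /=; exact: (@noise_sg t i).
have mW : determined G (past r m n) (fun w => expR (a * S n w)).
  apply: measurableT_comp; first exact: measurable_expR.
  by apply: measurable_funM; [exact: (determined_cst _) | exact: mS].
have W0 (w : Omega) : 0 <= expR (a * S n w) by exact: expR_ge0.
have := subgaussian_sum G_sigma G_measurable G_indep us sJ (sqr_ge0 sigma) mW W0 mC CL GX sX.
have -> : (\int[P]_w (expR (a * S n w) * expR (\sum_(k <- s) C k w * X k w))%:E =
    \int[P]_w (expR (a * S n.+1 w))%:E)%E.
  apply: eq_integral => w _; rewrite -expRD; congr (expR _)%:E.
  rewrite big_map big_enum /= /S [in RHS](bigD1 t)//= mulrDr addrC; congr (_ + _).
    by rewrite mulr_sumr; apply: eq_bigr => i _; rewrite mulrA.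
  congr (_ * _); apply: eq_bigl => t'; rewrite ltnS [in RHS]leq_eqVlt -(inj_eq val_inj)/=.
  by case: (eqVneq (t' : nat) n) => [->|]; rewrite ?ltnn// andbT.
move=> /le_trans; apply.
apply: (le_trans (lee_wpmul2l _ IH)); first by rewrite lee_fin expR_ge0.
rewrite -EFinM -expRD lee_fin ler_expR size_map size_enum_ord exprMn real_normK ?num_real//.
by rewrite mulSn natrD le_eqVlt; apply/orP; left; apply/eqP; ring.
Qed.

End NoiseMartingale.

Context (f : 'rV[R]_d -> R) (B eta delta lambda : R) (x : nat -> Omega -> 'rV[R]_d).
Context (ghat : 'I_r -> Omega -> 'rV[R]_d) (muhat : 'I_r -> Omega -> R).
Hypothesis run : mirror_descent_run V z xi f B eta delta lambda x ghat muhat.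

Let iterate_past n j : (n < r)%N -> determined G (past r m n) (fun w => x n w 0 j).
Proof.
case: n => [_|n nr].
  have -> : (fun w => x 0%N w 0 j) = fun=> 0.
    by apply/funext => w; rewrite (run_init run) mxE.
  exact: (determined_cst _).
move=> _ A mA; rewrite setTI; apply: history_sub.
exact: (iterate_adapted run (t := Ordinal (ltnW nr))).
Qed.

Lemma measurable_sign_function t i (h : {ffun 'I_d -> bool} -> R) :
  measurable_fun setT (fun w => h (z t i w)).
Proof.
move=> _ A mA; rewrite setTI; apply: (G_measurable (k := Some (inl (t, i)))).
exact: (@signs_wrt t i h).
Qed.

Lemma measurable_iterate n j : (n < r)%N -> measurable_fun setT (fun w => x n w 0 j).
Proof. by move=> nr; exact: (determined_measurable G_measurable (iterate_past j nr)). Qed.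

Lemma drift_martingale_subgaussian xs (L : R) :
  (forall (t : 'I_r) w, l1norm (x t w - xs) <= L) ->
  subgaussian P (sigma ^+ 2 * L ^+ 2 * (r * m)%:R)
    (fun w => \sum_t \sum_i (- dotv (signs R (z t i w)) (x t w - xs)) * xi t i w).
Proof.
move=> xL; apply: martingale_subgaussian => [t i|t i w].
  apply: measurable_funN; apply: measurable_dotv => j.
    apply: (@determined_source _ _ _ _ G _ (Some (inl (t, i)))); first by rewrite inE.
    exact: (@signs_wrt t i (fun b => signs R b 0 j)).
  under eq_fun do rewrite mxE [(- xs) 0 j]mxE.
  apply: measurable_funB; first exact: (iterate_past j (ltn_ord t)).
  exact: measurable_cst.
rewrite normrN; apply: le_trans (normr_dotv_le (M := 1) _ _) _; last by rewrite mul1r; exact: xL.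
by move=> j; rewrite mxE normr_sign.
Qed.

End Sampled.

Section GoodEvent.
Context {disp : measure_display} {Omega : measurableType disp} {R : realType}.
Context (P : probability Omega R) (d r n : nat) (V : set (set Omega)).
Let m := (2 * n)%N.
Context (z : 'I_r -> 'I_m -> Omega -> {ffun 'I_d -> bool}).
Context (xi : 'I_r -> 'I_m -> {RV P >-> R}) (sigma : R).
Context (f : 'rV[R]_d -> R) (B eta delta lambda : R) (x : nat -> Omega -> 'rV[R]_d).
Context (ghat : 'I_r -> Omega -> 'rV[R]_d) (muhat : 'I_r -> Omega -> R) (xs : 'rV[R]_d).
Hypotheses (sigma0 : 0 <= sigma) (model : sampling_model V z xi sigma)
  (run : mirror_descent_run V z xi f B eta delta lambda x ghat muhat)
  (B0 : 0 < B) (xsB : l1norm xs <= B) (L0 : 0 < ln d%:R :> R)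
  (rd : (r <= d)%N).

Let L : R := ln d%:R.

Let d0 : (0 < d)%N.
Proof. by rewrite lt0n; apply/eqP => d0; have := L0; rewrite d0 ln0// ltxx. Qed.

Let rate (k X : R) : 0 <= k -> `|X| <= Num.sqrt (8 * L) * Num.sqrt (k ^+ 2 * m%:R) ->
  `|m%:R^-1 * X| <= 2 * k * Num.sqrt (L / n%:R).
Proof.
move=> k0 XL; case: (posnP n) => [E|n0].
  (* For n = 0 the inverse of 0 is 0, and the left side vanishes. *)
  have -> : m%:R = 0 :> R by rewrite /m E.
  by rewrite invr0 mul0r normr0 !mulr_ge0.
have nR : 0 < n%:R :> R by rewrite ltr0n.
have mR : m%:R = 2 * n%:R :> R by rewrite natrM.
rewrite normrM ger0_norm ?invr_ge0//.
have := ler_wpM2l (_ : 0 <= m%:R^-1) XL; rewrite invr_ge0 => /(_ (ler0n _ _))/le_trans; apply.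
rewrite le_eqVlt; apply/orP; left; apply/eqP.
rewrite -sqrtrM; last by rewrite mulr_ge0// ltW.
have -> : 8 * L * (k ^+ 2 * m%:R) = (4 * k * n%:R) ^+ 2 * (L / n%:R).
  by rewrite mR; field; exact: lt0r_neq0.
rewrite sqrtrM ?sqr_ge0// sqrtr_sqr ger0_norm ?mulr_ge0// mR.
by field; exact: lt0r_neq0.
Qed.

(** The level 8 ln d yields d^(-4), enough against the at most 2 d (d+1)^2 coherence events. *)
Let tail8 : expR (- Num.sqrt (8 * L) ^+ 2 / 2) = d%:R ^- 4.
Proof.
rewrite sqr_sqrtr ?mulr_ge0// ?(ltW L0)//.
have -> : - (8 * L) / 2 = - (4%:R * L) by lra.
by rewrite expRN expRM_natl lnK// posrE ltr0n.
Qed.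

Let tail2 : expR (- Num.sqrt (2 * L) ^+ 2 / 2) = d%:R^-1.
Proof.
rewrite sqr_sqrtr ?mulr_ge0// ?(ltW L0)//.
have -> : - (2 * L) / 2 = - L by lra.
by rewrite expRN lnK// posrE ltr0n.
Qed.

Let iterate_le (t : 'I_r) w : l1norm (x t w - xs) <= 2 * B.
Proof.
apply: le_trans (l1normB _ _) _.
have : l1norm (x t w) <= B.
  case: t => -[|t] tr /=; first by rewrite (run_init run) l1norm0; apply: ltW.
  by have [] := run_step run (Ordinal (ltnW tr)) w.
by have h := xsB; lra.
Qed.

(** With q rounds and D = d, the estimate D + 1 <= 2 D gives 8/D for coherence, 4/D for noise
    averages and 1/D for the martingale. *)
Let failure (q D : R) : 0 <= q -> q <= D -> 1 <= D ->
  2 * (q * ((D + 1) * (D + 1))) * D ^- 4 + 2 * (q * (D + 1)) * D ^- 4 + D^-1 <= 13 / D.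
Proof.
move=> q0 qD D1; have D0 : 0 < D by lra.
have E : D + 1 <= 2 * D by lra.
have D10 : 0 <= D + 1 by lra.
have h2 : q * (D + 1) <= D * (2 * D) by apply: ler_pM.
have h1 : q * ((D + 1) * (D + 1)) <= D * ((2 * D) * (2 * D)).
  by apply: ler_pM => //; [rewrite mulr_ge0 | apply: ler_pM].
have i0 : 0 < D ^- 4 by rewrite invr_gt0 exprn_gt0.
have g1 : 2 * (q * ((D + 1) * (D + 1))) * D ^- 4 <= 8 / D.
  have -> : 8 / D = 2 * (D * ((2 * D) * (2 * D))) * D ^- 4 by field; exact: lt0r_neq0.
  by rewrite ler_pM2r// ler_pM2l.
have g2 : 2 * (q * (D + 1)) * D ^- 4 <= 4 / D.
  apply: (@le_trans _ _ (2 * (D * (2 * D)) * D ^- 4)).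
    by rewrite ler_pM2r// ler_pM2l.
  have -> : 2 * (D * (2 * D)) * D ^- 4 = 4 / D * D^-1 by field; exact: lt0r_neq0.
  by rewrite ler_piMr ?divr_ge0 ?invf_le1// ltW.
have -> : 13 / D = 8 / D + 4 / D + D^-1 by field; exact: lt0r_neq0.
by apply: lerD => //; apply: lerD.
Qed.

Lemma good_event : exists Bad : set Omega,
  [/\ measurable Bad, (P Bad <= (13 / d%:R)%:E)%E & forall w, ~ Bad w ->
   [/\ forall t (p q : option 'I_d), p != q ->
         `|gram (@regressor R _ _ (fun i => z t i w)) p q| <= 4 * Num.sqrt (ln d%:R / n%:R),
       forall t p, `|m%:R^-1 * \sum_i regressor (fun i => z t i w) i p * xi t i w| <=
         2 * sigma * Num.sqrt (ln d%:R / n%:R) &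
       \sum_(t < r) \sum_i (- dotv (signs R (z t i w)) (x t w - xs)) * xi t i w <=
         Num.sqrt (2 * ln d%:R) * Num.sqrt (sigma ^+ 2 * (2 * B) ^+ 2 * (r * m)%:R)]].
Proof.
have mz t i (h : {ffun 'I_d -> bool} -> R) : measurable_fun setT (fun w => h (z t i w)).
  exact: (measurable_sign_function model t i h).
(* Diagonal pairs are sent to 0, so the union bound can run over the full product type. *)
pose S1 (k : 'I_r * (option 'I_d * option 'I_d)) w : R := if k.2.1 != k.2.2 then
  \sum_i augmented_sign (z k.1 i w) k.2.1 * augmented_sign (z k.1 i w) k.2.2 else 0.
pose S2 (k : 'I_r * option 'I_d) w : R := \sum_i augmented_sign (z k.1 i w) k.2 * xi k.1 i w.
pose S3 w : R := \sum_(t < r) \sum_i (- dotv (signs R (z t i w)) (x t w - xs)) * xi t i w.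
have mS1 k : measurable_fun setT (S1 k).
  rewrite /S1; case: (k.2.1 != k.2.2); last exact: measurable_cst.
  apply: measurable_sum => i.
  exact: (mz k.1 i (fun b => augmented_sign b _ * augmented_sign b _)).
have mS2 k : measurable_fun setT (S2 k).
  apply: measurable_sum => i; apply: measurable_funM => //.
  exact: (mz k.1 i (fun b => augmented_sign b _)).
have mS3 : measurable_fun setT S3.
  apply: measurable_sum => t; apply: measurable_sum => i; apply: measurable_funM => //.
  apply: measurable_funN; apply: measurable_dotv => j.
    exact: (mz t i (fun b => signs R b 0 j)).
  under eq_fun do rewrite mxE [(- xs) 0 j]mxE.
  apply: measurable_funB; last exact: measurable_cst.
  exact: (measurable_iterate model run j (ltn_ord t)).
have v1 : 0 <= 2 ^+ 2 * m%:R :> R by rewrite mulr_ge0// sqr_ge0.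
have v2 : 0 <= sigma ^+ 2 * m%:R :> R by rewrite mulr_ge0// sqr_ge0.
have v3 : 0 <= sigma ^+ 2 * (2 * B) ^+ 2 * (r * m)%:R :> R.
  by rewrite mulr_ge0// mulr_ge0// sqr_ge0.
have sS1 k : subgaussian P (2 ^+ 2 * m%:R) (S1 k).
  have -> : 2 ^+ 2 = 4 :> R by rewrite -natrX.
  rewrite /S1; case: (boolP (k.2.1 != k.2.2)) => [pq|_].
    exact: (coherence_subgaussian model k.1 pq).
  by apply: subgaussian0; rewrite mulr_ge0.
have sS2 k : subgaussian P (sigma ^+ 2 * m%:R) (S2 k).
  exact: (noise_average_subgaussian model k.1 k.2).
have sS3 := drift_martingale_subgaussian model run iterate_le.
have t8 : 0 < Num.sqrt (8 * L) by rewrite sqrtr_gt0 mulr_gt0.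
have t2 : 0 < Num.sqrt (2 * L) by rewrite sqrtr_gt0 mulr_gt0.
have [mB1 PB1] := uniform_tail mS1 v1 sS1 t8.
have [mB2 PB2] := uniform_tail mS2 v2 sS2 t8.
have PB3 := subgaussian_tail mS3 v3 sS3 t2.
have mB3 := measurable_gt
  (Num.sqrt (2 * L) * Num.sqrt (sigma ^+ 2 * (2 * B) ^+ 2 * (r * m)%:R)) mS3.
move: mB1 PB1 mB2 PB2 mB3 PB3; rewrite tail8 tail2.
set B1 := [set w | _]; set B2 := [set w | _]; set B3 := [set w | _].
move=> mB1 PB1 mB2 PB2 mB3 PB3; exists (B1 `|` B2 `|` B3); split.
- by apply: measurableU => //; exact: measurableU.
- apply: le_trans (measureU2 _ (measurableU _ _ mB1 mB2) mB3) _.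
  apply: le_trans (leeD (le_trans (measureU2 _ mB1 mB2) (leeD PB1 PB2)) PB3) _.
  rewrite -!EFinD lee_fin !card_prod !card_option !card_ord !natrM.
  have -> : d.+1%:R = d%:R + 1 :> R by rewrite natr1.
  have D1 : 1 <= d%:R :> R by rewrite ler1n.
  have rD : r%:R <= d%:R :> R by rewrite ler_nat.
  have r0 : 0 <= r%:R :> R by [].
  exact: (failure r0 rD D1).
move=> w nB; split.
- move=> t p q pq; have -> : 4 = 2 * 2 :> R by rewrite -natrM.
  apply: rate => //; rewrite leNgt; apply/negP => h; apply: nB; left; left.
  by exists (t, (p, q)); rewrite /S1/= pq.
- move=> t p; apply: rate => //; rewrite leNgt; apply/negP => h; apply: nB; left; right.
  by exists (t, p).
- by rewrite leNgt; apply/negP => h; apply: nB; right.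
Qed.

End GoodEvent.

Lemma inf_range_minimizer (R : realType) (T : Type) (f : T -> R) xs :
  (forall y, f xs <= f y) -> inf (range f) = f xs.
Proof.
move=> fmin; apply/eqP; rewrite eq_le; apply/andP; split.
  by apply: ge_inf; [exists (f xs) => _ [y _ <-] | exists xs].
by apply: lb_le_inf; [exists (f xs), xs | move=> _ [y _ <-]].
Qed.

Section LowerOrderPolynomial.
Import -(notations) mpoly.

(* The variables 0, ..., 4 are sigma, s, H, B, ln d. *)
Definition lower_order_poly (R : realType) : mpoly.mpoly 5 R :=
  let X (i : nat) := mpoly.mpolyX R (mpoly.mnm1 (@inord 4 i)) in
  8 *: X 4%N + 2 *: (X 1%N * X 4%N)
  + (3 * bregman_const * 768 ^+ 2) *:
      (X 3%N * (X 2%N * X 2%N) * X 1%N * (X 4%N * X 4%N)).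

Lemma meval_lower_order_poly (R : realType) (sigma s H B L : R) :
  mpoly.meval (tnth [tuple sigma; s; H; B; L]) (lower_order_poly R) =
  lower_order s H B L.
Proof.
rewrite /lower_order_poly !mpoly.mevalD !mpoly.mevalZ !mpoly.mevalM !mpoly.mevalXU.
by rewrite !(tnth_nth 0)/= !inordK.
Qed.

End LowerOrderPolynomial.

Theorem theorem2 (R : realType) :
  exists (C0 C1 C K : R) (p : mpoly.mpoly 5 R),
  [/\ 0 < C0, 0 < C1, 0 < C & 0 < K] /\
  forall (d s T : nat) (B H sigma : R) (f : 'rV[R]_d -> R),
    0 < B -> 0 < H -> 0 <= sigma -> (1 <= s)%N ->
    convex_objective f ->
    has_bounded_minimizer f B ->
    sparse_gradient f s H ->
    bounded_hessian f H ->
    C0 * (s%:R ^+ 3 * ln d%:R ^+ 2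
          + s%:R * (1 + H) ^+ 2 * (1 + B ^+ 4 * H ^+ 4 * ln d%:R ^+ 2)) <= T%:R ->
    (T <= d)%N ->
    let n : nat := Num.truncn ((1 + H) * Num.sqrt (s%:R * T%:R)) in
    let eta : R := B * Num.sqrt (n%:R * ln d%:R / T%:R) in
    let delta : R := Num.sqrt (s%:R * ln d%:R / n%:R) in
    let lambda : R :=
      C1 * (delta^-1 * sigma * Num.sqrt (ln d%:R / n%:R) + delta * H) in
    let m : nat := (2 * n)%N in
    let r : nat := (T %/ (2 * n))%N in
    forall (disp : measure_display) (Omega : measurableType disp)
      (P : probability Omega R) (V : set (set Omega))
      (z : 'I_r -> 'I_m -> Omega -> {ffun 'I_d -> bool})
      (xi : 'I_r -> 'I_m -> {RV P >-> R})
      (x : nat -> Omega -> 'rV[R]_d)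
      (ghat : 'I_r -> Omega -> 'rV[R]_d) (muhat : 'I_r -> Omega -> R),
    sampling_model V z xi sigma ->
    mirror_descent_run V z xi f B eta delta lambda x ghat muhat ->
    ((1 - K / d%:R)%:E <=
      P [set w | (cumulative_regret z f delta x w <=
          C * (1 + sigma + sigma ^+ 2 / s%:R) * B * Num.sqrt (ln d%:R)
            * ((1 + H) ^+ 2 * s%:R / T%:R) `^ 4^-1
          + mpoly.meval (tnth [tuple sigma; s%:R; H; B; ln d%:R]) p
            * T%:R `^ (- 2^-1))%R])%E.
Proof.
(* The Lasso needs [lambda / 4] to dominate the mean error, whose noise part carries a factor 2;
   hence 8. The number 13 sums the failure probabilities. *)
exists horizon_const, 8, regret_const, 13, (lower_order_poly R); split.
  have K0 := @bregman_const_gt0 R.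
  split; rewrite ?ltr0n//; first by rewrite /horizon_const exprn_gt0// mulr_gt0// exprn_gt0.
  have pos (K M : R) : 0 < K -> 0 <= M -> 0 < 6160 + (6 + 3 * M) * K.
    by move=> K1 M0; have := mulr_ge0 M0 (ltW K1); lra.
  exact: pos K0 (sqr_ge0 _).
move=> d s T B H sigma f B0 H0 sigma0 s1 cf [xs [fmin xsB]] gf hf T_large Td.
move=> n eta delta lambda m r disp Omega P V z xi x ghat muhat model run.
rewrite meval_lower_order_poly.
have L2 := log_dimension_ge2 B0 H0 s1 T_large Td.
have L0 : 0 < ln d%:R :> R by exact: lt_le_trans L2.
have rd : (r <= d)%N by apply: leq_trans (leq_div _ _) Td.
have [Bad [mBad PBad good]] := good_event sigma0 model run B0 xsB L0 rd.
(* Comparing probabilities requires a measurable regret event: iterates and signs are measurable,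
   and f is continuous. *)
have mregret : measurable_fun setT (cumulative_regret z f delta x).
  apply: measurable_funB; last exact: measurable_cst.
  apply: measurable_funM; first exact: measurable_cst.
  apply: measurable_sum => t; apply: measurable_sum => i.
  apply: (@measurable_continuous_comp _ _ _ _ f (query_point z delta x t i)) => [y|j].
    by have [df _ _] := hf y; exact: differentiable_continuous df.
  rewrite /query_point; under eq_fun do rewrite !mxE.
  apply: measurable_funD; first exact: (measurable_iterate model run j (ltn_ord t)).
  apply: measurable_funM; first exact: measurable_cst.
  exact: (measurable_sign_function model t i (fun b => (-1) ^+ b j)).
set bound := regret_const * _ * _ * _ * _ + _; set A := [set w | _].
have mA : measurable A.
  have -> : A = cumulative_regret z f delta x @^-1` `]-oo, bound].
    by apply/seteqP; split => w; rewrite /A/= in_itv/=.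
  by rewrite -[X in measurable X]setTI; exact: (mregret measurableT _ (measurable_itv _)).
have BadA : ~` Bad `<=` A.
  move=> w /good[incoherent noise mart].
  have regret := regret_on_event B0 H0 sigma0 s1 cf gf hf T_large Td fmin xsB (erefl n)
    (erefl eta) (erefl delta) (erefl lambda) (erefl m) (erefl r).
  have := regret (fun t i => z t i w) (fun t i => xi t i w) (x^~ w) (ghat^~ w) (muhat^~ w)
    (run_init run w) (run_lasso run ^~ w) (run_step run ^~ w) incoherent noise mart.
  by rewrite /A /= /cumulative_regret (inf_range_minimizer fmin).
apply: (@le_trans _ _ (P (~` Bad))).
  by rewrite probability_setC// EFinB; apply: leeB.
by apply: le_measure; rewrite ?inE//; exact: measurableC.
Qed.
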